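(* Let $(M,g)$ be a 2-dimensional (pseudo-)Riemannian manifold. Suppose that the geodesic flow of $(M,g)$ admits a first integral $f$ that is a homogeneous polynomial of degree $N$ in the momenta of the factorized form $$f=\prod_{m=1}^{N}(\alpha_m^1p_1+\alpha_m^2p_2),\qquad \alpha_m^k=\alpha_m^k(x^1,x^2),$$ and that $f$ admits at least two distinct roots, i.e. $$f=(\alpha_1^1p_1+\alpha_1^2p_2)(\alpha_2^1p_1+\alpha_2^2p_2)\,Q,$$ where $Q$ is a homogeneous polynomial of degree $N-2$ in the momenta and, at a point $p\in M$, $\alpha_1^1(p)\alpha_2^2(p)-\alpha_2^1(p)\alpha_1^2(p)\neq 0$, $(\alpha_1^1(p),\alpha_1^2(p))\neq 0$ and $(\alpha_2^1(p),\alpha_2^2(p))\neq 0$. Then there exists a system of coordinates $(x^i,p_i)$ where the Hamiltonian of the geodesic flow has the form $$H=\tfrac12\epsilon_1p_1^2+g^{12}p_1p_2+\tfrac12\epsilon_2p_2^2,\qquad g^{12}=g^{12}(x^1,x^2),\qquad \epsilon_i\in\{-1,0,1\},$$ and the polynomial $f$ has the form $$f=p_1p_2\prod_{i=1}^{N-2}(\alpha_i^1p_1+\alpha_i^2p_2),\qquad \alpha_j^k=\alpha_j^k(x^1,x^2),$$ where the functions $\alpha_j^k$ in this last formula are in general different from those in the initial factorization.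
   Context: The geodesic flow of $(M,g)$ is the Hamiltonian flow on $T^*M$ with Hamiltonian $H(\mathbf{x},\mathbf{p})=\frac12 g^{km}(\mathbf{x})p_kp_m$, where $g^{km}$ are the components of the inverse metric and $(x^i,p_i)=(x^1,x^2,p_1,p_2)$ denotes the coordinates on $T^*M$ induced by coordinates $(x^1,x^2)$ on $M$. A function $f$ on $T^*M$ is a first integral if $\{f,H\}=0$, where $$\{f,H\}=\sum_{i=1}^2\left(\frac{\partial f}{\partial x^i}\frac{\partial H}{\partial p_i}-\frac{\partial f}{\partial p_i}\frac{\partial H}{\partial x^i}\right).$$ The $N$ roots of $f$ are real and not necessarily all distinct. All results are of local character, meaning that one always works in suitable neighborhoods.
   Formalization: For N=2 the empty product becomes a nonvanishing function c(x), since f=p1p2 fails for f=H non-flat. Coordinates exist arbitrarily near p, and around p if the signs of H at the two roots are constant near p. f vanishes identically on no open set. *)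

(* Defs.v *)
From Stdlib Require Import Reals List.
From Coquelicot Require Import Coquelicot.
Open Scope R_scope.

(* Everything is local, so the surface is an open set U of R^2 carrying the
   coordinates (x, y) = (x^1, x^2).  Functions on U are total functions
   R -> R -> R of which only the values on U matter; functions on T^*U have
   arguments x y p1 p2. *)

(* Coquelicot's [ex_diff_n h n] at every point of an open set is C^n there. *)
Definition smooth_on (U : R * R -> Prop) (h : R -> R -> R) : Prop :=
  forall x y, U (x, y) -> forall n, ex_diff_n h n x y.

Definition D1 (h : R -> R -> R) (x y : R) : R := Derive (fun t => h t y) x.
Definition D2 (h : R -> R -> R) (x y : R) : R := Derive (fun t => h x t) y.

Definition poisson (F H : R -> R -> R -> R -> R) (x y p1 p2 : R) : R :=
  (Derive (fun t => F t y p1 p2) x * Derive (fun t => H x y t p2) p1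
   - Derive (fun t => F x y t p2) p1 * Derive (fun t => H t y p1 p2) x)
  + (Derive (fun t => F x t p1 p2) y * Derive (fun t => H x y p1 t) p2
     - Derive (fun t => F x y p1 t) p2 * Derive (fun t => H x t p1 p2) y).

Definition first_integral_on (U : R * R -> Prop)
    (F H : R -> R -> R -> R -> R) : Prop :=
  forall x y p1 p2, U (x, y) -> poisson F H x y p1 p2 = 0.

Definition metric_det (g11 g12 g22 : R -> R -> R) (x y : R) : R :=
  g11 x y * g22 x y - g12 x y * g12 x y.

(* No condition on the signature: Riemannian and Lorentzian are both allowed. *)
Definition pseudo_riemannian_on (U : R * R -> Prop)
    (g11 g12 g22 : R -> R -> R) : Prop :=
  smooth_on U g11 /\ smooth_on U g12 /\ smooth_on U g22 /\
  forall x y, U (x, y) -> metric_det g11 g12 g22 x y <> 0.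

(* (1/2) g^{km} p_k p_m, the inverse metric being written out. *)
Definition hamiltonian (g11 g12 g22 : R -> R -> R) (x y p1 p2 : R) : R :=
  / 2 * (  g22 x y / metric_det g11 g12 g22 x y * (p1 * p1)
         + 2 * (- g12 x y / metric_det g11 g12 g22 x y) * (p1 * p2)
         + g11 x y / metric_det g11 g12 g22 x y * (p2 * p2)).

(* prod_{m=1}^{n} (a_m^1 p1 + a_m^2 p2); it is 1 for n = 0. *)
Definition linear_product (n : nat) (a1 a2 : nat -> R -> R -> R)
    (x y p1 p2 : R) : R :=
  fold_right Rmult 1
    (map (fun m => a1 m x y * p1 + a2 m x y * p2) (seq 1 n)).

(* (phi1, phi2) is a smooth diffeomorphism of the open set V onto the open set
   V', with inverse (psi1, psi2). *)
Definition coordinate_change (V V' : R * R -> Prop)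
    (phi1 phi2 psi1 psi2 : R -> R -> R) : Prop :=
  open V /\ open V' /\
  smooth_on V phi1 /\ smooth_on V phi2 /\
  smooth_on V' psi1 /\ smooth_on V' psi2 /\
  (forall x y, V (x, y) ->
     V' (phi1 x y, phi2 x y) /\
     psi1 (phi1 x y) (phi2 x y) = x /\ psi2 (phi1 x y) (phi2 x y) = y) /\
  (forall x y, V' (x, y) ->
     V (psi1 x y, psi2 x y) /\
     phi1 (psi1 x y) (psi2 x y) = x /\ phi2 (psi1 x y) (psi2 x y) = y).

(* A function on the cotangent bundle in the induced new coordinates
   (y1, y2, q1, q2): momenta transform by p_k = sum_i q_i d(phi^i)/dx^k. *)
Definition in_coordinates (phi1 phi2 psi1 psi2 : R -> R -> R)
    (F : R -> R -> R -> R -> R) (y1 y2 q1 q2 : R) : R :=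
  let x1 := psi1 y1 y2 in
  let x2 := psi2 y1 y2 in
  F x1 x2 (D1 phi1 x1 x2 * q1 + D1 phi2 x1 x2 * q2)
          (D2 phi1 x1 x2 * q1 + D2 phi2 x1 x2 * q2).

Definition is_epsilon (e : R) : Prop := e = -1 \/ e = 0 \/ e = 1.

(* V carries coordinates in which
     H = (1/2) e1 p1^2 + G p1 p2 + (1/2) e2 p2^2   and
     f = p1 p2 prod_{i=1}^{N-2} (b_i^1 p1 + b_i^2 p2).
   If N = 2 the product is empty and the cofactor of p1 p2, a homogeneous
   polynomial of degree 0 in the momenta, is a function c of the position; it
   cannot be normalized to 1 (take f = H = G p1 p2 with non-flat metric).
   If N >= 3 no such factor is allowed: c = 1. *)
Definition has_normal_form_on (V : R * R -> Prop) (N : nat)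
    (H f : R -> R -> R -> R -> R) : Prop :=
  exists (V' : R * R -> Prop) (phi1 phi2 psi1 psi2 : R -> R -> R)
         (e1 e2 : R) (G c : R -> R -> R) (b1 b2 : nat -> R -> R -> R),
    coordinate_change V V' phi1 phi2 psi1 psi2 /\
    is_epsilon e1 /\ is_epsilon e2 /\
    smooth_on V' G /\ smooth_on V' c /\
    (forall i, (1 <= i <= N - 2)%nat ->
       smooth_on V' (b1 i) /\ smooth_on V' (b2 i)) /\
    (forall y1 y2, V' (y1, y2) ->
       c y1 y2 <> 0 /\ ((3 <= N)%nat -> c y1 y2 = 1)) /\
    (forall y1 y2 q1 q2, V' (y1, y2) ->
       in_coordinates phi1 phi2 psi1 psi2 H y1 y2 q1 q2
       = / 2 * e1 * (q1 * q1) + G y1 y2 * (q1 * q2) + / 2 * e2 * (q2 * q2)) /\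
    (forall y1 y2 q1 q2, V' (y1, y2) ->
       in_coordinates phi1 phi2 psi1 psi2 f y1 y2 q1 q2
       = q1 * q2 * (c y1 y2 * linear_product (N - 2) b1 b2 y1 y2 q1 q2)).

(* The sign of H on the root (- a^2, a^1) of the factor a^1 p1 + a^2 p2 is
   constant near (u, v).  For the factors p1 and p2 of the normal form these
   signs are e2 and e1. *)
Definition root_sign_locally_constant (H : R -> R -> R -> R -> R)
    (a1 a2 : R -> R -> R) (u v : R) : Prop :=
  locally_2d (fun x y => sign (H x y (- a2 x y) (a1 x y))
                         = sign (H u v (- a2 u v) (a1 u v))) u v.

(* Main.v *)
Require Import Defs.
From Stdlib Require Import Reals List Lra Lia Classical ClassicalEpsilon.
From Coquelicot Require Import Coquelicot.
Open Scope R_scope.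

(** Let L = a1 p1 + a2 p2 be one of the first two factors of f.  The idea is that
    {f, H} = 0 forces {L, H} to vanish where L does: {f, H} / f is the sum of the
    {L_m, H} / L_m over all factors, and if {L, H} were nonzero at the root
    (- a2, a1) of L, this sum would have a pole there
    ([bracket_vanishes_at_root]).  The argument needs every factor either to have
    its root apart from that of L or to be proportional to L on an open set; this
    holds on a dense set of points ([generic_dichotomy]), which is enough because
    the value of {L, H} at the root is a continuous function of the point.

    Next, there is a function phi with nonzero differential such that L vanishes
    at d phi and H has a constant value e / 2 there, e in {-1, 0, 1}
    ([adapted_function]).  If H is nonzero at the root, rescale the root to a
    1-form on which 2 H is 1 or -1.  It takes its values in the surface L = 0,
    H = constant, on which the two functions are in involution, so this surface is
    Lagrangian and the 1-form is closed ([divergence_identity]); it is d phi by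
    the Poincare lemma.  If H vanishes at the root over a neighbourhood, any phi
    that is constant along the integral curves of the vector field (a1, a2) will
    do.  Such a phi is obtained from the flow of the field
    ([annihilated_function]); its existence and smoothness are proved by the Picard
    iteration, with derivatives in the initial value given by the linearized
    equation ([flow_smooth]).

    Let phi1 be such a function for the second factor and phi2 one for the first.
    The roots of the two factors are independent, so (phi1, phi2) is a coordinate
    system by the inverse function theorem ([inverse_function]).  In it the first
    two factors are multiples of the momenta q1 and q2, and the coefficients of
    q1 ^ 2 and q2 ^ 2 in 2 H are the two constants e ([normal_form_at]).

    The signs of H at the two roots have to be constant for this.  They are so on
    some open set arbitrarily near any point, since a continuous function is
    nonzero near some point or zero everywhere, and that gives the first part of
    the statement; in the second part they are constant by assumption. *)

(** * Calculus of functions of two variables *)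

Lemma open_locally_2d (W : R * R -> Prop) (x y : R) :
  open W -> W (x, y) -> locally_2d (fun a b => W (a, b)) x y.
Proof.
  intros HW Hxy. apply locally_2d_locally.
  apply filter_imp with (2 := HW _ Hxy). now intros [a b].
Qed.

Lemma open_of_locally_2d (W : R * R -> Prop) :
  (forall x y, W (x, y) -> locally_2d (fun a b => W (a, b)) x y) -> open W.
Proof.
  intros HW [x y] Hxy. apply HW, locally_2d_locally in Hxy.
  apply filter_imp with (2 := Hxy). now intros [a b].
Qed.

Lemma open_and_locally_2d (W : R * R -> Prop) (P : R -> R -> Prop) :
  open W ->
  (forall x y, W (x, y) -> P x y -> locally_2d P x y) ->
  open (fun z => W z /\ P (fst z) (snd z)).
Proof.
  intros HW HP. apply open_of_locally_2d. intros x y [H1 H2].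
  apply locally_2d_and; [now apply open_locally_2d | now apply HP].
Qed.

Lemma continuity_2d_pt_comp (f g h : R -> R -> R) (x y : R) :
  continuity_2d_pt h (f x y) (g x y) ->
  continuity_2d_pt f x y -> continuity_2d_pt g x y ->
  continuity_2d_pt (fun a b => h (f a b) (g a b)) x y.
Proof.
  intros Hh Hf Hg eps.
  destruct (Hh eps) as [d Hd].
  generalize (locally_2d_and _ _ _ _ (Hf d) (Hg d)).
  apply locally_2d_impl, locally_2d_forall. intros a b [H1 H2]. now apply Hd.
Qed.

Lemma differentiable_pt_lim_partials (h : R -> R -> R) (x y lx ly : R) :
  differentiable_pt_lim h x y lx ly ->
  is_derive (fun t => h t y) x lx /\ is_derive (fun t => h x t) y ly.
Proof.
  intros Hh. split; apply is_derive_Reals.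
  - replace lx with (lx * 1 + ly * 0) by ring.
    apply (derivable_pt_lim_comp_2d h (fun t => t) (fun _ => y)); trivial.
    + apply derivable_pt_lim_id.
    + apply derivable_pt_lim_const.
  - replace ly with (lx * 0 + ly * 1) by ring.
    apply (derivable_pt_lim_comp_2d h (fun _ => x) (fun t => t)); trivial.
    + apply derivable_pt_lim_const.
    + apply derivable_pt_lim_id.
Qed.

Lemma differentiable_pt_lim_D (h : R -> R -> R) (x y lx ly : R) :
  differentiable_pt_lim h x y lx ly -> D1 h x y = lx /\ D2 h x y = ly.
Proof. intros Hh. apply (differentiable_pt_lim_unique _ _ _ _ _ Hh). Qed.

Lemma differentiable_pt_lim_continuity (h : R -> R -> R) (x y lx ly : R) :
  differentiable_pt_lim h x y lx ly -> continuity_2d_pt h x y.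
Proof. intros Hh. apply differentiable_continuity_pt. now exists lx, ly. Qed.

Lemma differentiable_pt_lim_of_partials (W : R * R -> Prop)
    (h hx : R -> R -> R) (x y hy : R) :
  open W -> W (x, y) ->
  (forall a b, W (a, b) -> is_derive (fun t => h t b) a (hx a b)) ->
  is_derive (fun t => h x t) y hy ->
  continuity_2d_pt hx x y ->
  differentiable_pt_lim h x y (hx x y) hy.
Proof.
  intros HW Hxy H1 H2 H3.
  apply filterdiff_differentiable_pt_lim.
  apply filterdiff_ext_lin with
    (fun u : R * R => plus (scal (fst u) (hx x y)) (scal (snd u) hy)); [|easy].
  apply is_derive_filterdiff; trivial.
  - apply filter_imp with (2 := HW _ Hxy). intros [a b]; apply H1.
  - now apply continuity_2d_pt_filterlim in H3.
Qed.

Lemma differentiable_pt_lim_plus (f g : R -> R -> R) (x y fx fy gx gy : R) :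
  differentiable_pt_lim f x y fx fy -> differentiable_pt_lim g x y gx gy ->
  differentiable_pt_lim (fun a b => f a b + g a b) x y (fx + gx) (fy + gy).
Proof.
  intros Hf Hg.
  replace (fx + gx) with (1 * fx + 1 * gx) by ring.
  replace (fy + gy) with (1 * fy + 1 * gy) by ring.
  apply (differentiable_pt_lim_comp Rplus); trivial.
  intros eps. apply locally_2d_forall. intros a b.
  replace (a + b - _ - _) with 0 by ring. rewrite Rabs_R0.
  apply Rmult_le_pos; [apply Rlt_le, eps | ].
  apply Rle_trans with (1 := Rabs_pos (a - f x y)), Rmax_l.
Qed.

Lemma differentiable_pt_lim_mult (f g : R -> R -> R) (x y fx fy gx gy : R) :
  differentiable_pt_lim f x y fx fy -> differentiable_pt_lim g x y gx gy ->
  differentiable_pt_lim (fun a b => f a b * g a b) x y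
    (fx * g x y + f x y * gx) (fy * g x y + f x y * gy).
Proof.
  intros Hf Hg.
  rewrite (Rmult_comm fx), (Rmult_comm fy).
  apply (differentiable_pt_lim_comp Rmult); trivial.
  intros eps. exists eps. intros a b Ha Hb.
  replace (a * b - _ - _) with ((a - f x y) * (b - g x y)) by ring.
  rewrite Rabs_mult. apply Rmult_le_compat; auto using Rabs_pos, Rlt_le, Rmax_r.
Qed.

Lemma differentiable_pt_lim_const (c x y : R) :
  differentiable_pt_lim (fun _ _ => c) x y 0 0.
Proof.
  apply (differentiable_pt_lim_proj1_0 (fun _ => c)), derivable_pt_lim_const.
Qed.

(** Regularity C^n on W.  Statements on smooth functions are proved for each [n],
    since the inductions below need the degrees one by one. *)
Definition Cn (W : R * R -> Prop) (n : nat) (h : R -> R -> R) : Prop :=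
  forall x y, W (x, y) -> ex_diff_n h n x y.

Lemma Cn_ext (W : R * R -> Prop) (n : nat) (f g : R -> R -> R) :
  open W -> (forall x y, W (x, y) -> f x y = g x y) -> Cn W n f -> Cn W n g.
Proof.
  intros HW Hfg Hf x y Hxy. apply ex_diff_n_ext_loc with f; [|now apply Hf].
  generalize (open_locally_2d _ _ _ HW Hxy).
  apply locally_2d_impl, locally_2d_forall. exact Hfg.
Qed.

Lemma Cn_le (W : R * R -> Prop) (n m : nat) (h : R -> R -> R) :
  (m <= n)%nat -> Cn W n h -> Cn W m h.
Proof. intros Hm Hh x y Hxy. apply ex_diff_n_m with (1 := Hm), Hh, Hxy. Qed.

Lemma Cn_continuity (W : R * R -> Prop) (n : nat) (h : R -> R -> R) (x y : R) :
  Cn W n h -> W (x, y) -> continuity_2d_pt h x y.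
Proof. intros Hh Hxy. specialize (Hh x y Hxy). destruct n; apply Hh. Qed.

Lemma Cn_0 (W : R * R -> Prop) (h : R -> R -> R) :
  (forall x y, W (x, y) -> continuity_2d_pt h x y) -> Cn W 0 h.
Proof. intros Hh x y Hxy. split; auto. Qed.

Lemma Cn_D (W : R * R -> Prop) (n : nat) (h : R -> R -> R) :
  Cn W (S n) h -> Cn W n (D1 h) /\ Cn W n (D2 h).
Proof. intros Hh. split; intros x y Hxy; apply (Hh x y Hxy). Qed.

Lemma Cn_differentiable (W : R * R -> Prop) (n : nat) (h : R -> R -> R)
    (x y : R) :
  open W -> Cn W (S n) h -> W (x, y) ->
  differentiable_pt_lim h x y (D1 h x y) (D2 h x y).
Proof.
  intros HW Hh Hxy. apply (differentiable_pt_lim_of_partials W); trivial.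
  - intros a b Hab. apply Derive_correct. apply (Hh a b Hab).
  - apply Derive_correct. apply (Hh x y Hxy).
  - apply (Cn_continuity W n); trivial. now apply Cn_D.
Qed.

Lemma Cn_succ (W : R * R -> Prop) (n : nat) (h hx hy : R -> R -> R) :
  open W ->
  (forall x y, W (x, y) -> differentiable_pt_lim h x y (hx x y) (hy x y)) ->
  Cn W n hx -> Cn W n hy -> Cn W (S n) h.
Proof.
  intros HW Hd H1 H2 x y Hxy. simpl. repeat split.
  - apply (differentiable_pt_lim_continuity _ _ _ _ _ (Hd x y Hxy)).
  - exists (hx x y). now apply differentiable_pt_lim_partials with (1 := Hd x y Hxy).
  - exists (hy x y). now apply differentiable_pt_lim_partials with (1 := Hd x y Hxy).
  - revert x y Hxy. change (Cn W n (D1 h)). apply (Cn_ext W n hx); trivial.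
    intros x y Hxy. symmetry. apply (differentiable_pt_lim_D _ _ _ _ _ (Hd x y Hxy)).
  - revert x y Hxy. change (Cn W n (D2 h)). apply (Cn_ext W n hy); trivial.
    intros x y Hxy. symmetry. apply (differentiable_pt_lim_D _ _ _ _ _ (Hd x y Hxy)).
Qed.

Lemma Cn_const (W : R * R -> Prop) (n : nat) (c : R) :
  open W -> Cn W n (fun _ _ => c).
Proof.
  intros HW. revert c. induction n as [|n IH]; intros c.
  - apply Cn_0. intros x y _. apply continuity_2d_pt_const.
  - apply Cn_succ with (fun _ _ => 0) (fun _ _ => 0); trivial.
    intros x y _. apply differentiable_pt_lim_const.
Qed.

Lemma differentiable_pt_lim_fst (x y : R) :
  differentiable_pt_lim (fun a _ => a) x y 1 0.
Proof. apply (differentiable_pt_lim_proj1_0 (fun a => a)), derivable_pt_lim_id. Qed.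

Lemma differentiable_pt_lim_snd (x y : R) :
  differentiable_pt_lim (fun _ b => b) x y 0 1.
Proof.
  intros eps. apply locally_2d_forall. intros a b.
  replace (b - y - _) with 0 by ring. rewrite Rabs_R0.
  apply Rmult_le_pos; [apply Rlt_le, eps | ].
  apply Rle_trans with (1 := Rabs_pos (a - x)), Rmax_l.
Qed.

Lemma Cn_fst (W : R * R -> Prop) (n : nat) : open W -> Cn W n (fun x _ => x).
Proof.
  intros HW. destruct n as [|n].
  - apply Cn_0. intros x y _. apply continuity_2d_pt_id1.
  - apply Cn_succ with (fun _ _ => 1) (fun _ _ => 0); auto using Cn_const.
    intros x y _. apply differentiable_pt_lim_fst.
Qed.

Lemma Cn_snd (W : R * R -> Prop) (n : nat) : open W -> Cn W n (fun _ y => y).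
Proof.
  intros HW. destruct n as [|n].
  - apply Cn_0. intros x y _. apply continuity_2d_pt_id2.
  - apply Cn_succ with (fun _ _ => 0) (fun _ _ => 1); auto using Cn_const.
    intros x y _. apply differentiable_pt_lim_snd.
Qed.

Lemma Cn_plus (W : R * R -> Prop) (n : nat) (f g : R -> R -> R) :
  open W -> Cn W n f -> Cn W n g -> Cn W n (fun x y => f x y + g x y).
Proof.
  intros HW. revert f g. induction n as [|n IH]; intros f g Hf Hg.
  - apply Cn_0. intros x y Hxy.
    apply continuity_2d_pt_plus; apply (Cn_continuity W 0); auto.
  - apply Cn_succ with (fun x y => D1 f x y + D1 g x y)
      (fun x y => D2 f x y + D2 g x y); trivial.
    + intros x y Hxy.
      apply differentiable_pt_lim_plus; apply (Cn_differentiable W n); auto.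
    + apply IH; now apply Cn_D.
    + apply IH; now apply Cn_D.
Qed.

Lemma Cn_mult (W : R * R -> Prop) (n : nat) (f g : R -> R -> R) :
  open W -> Cn W n f -> Cn W n g -> Cn W n (fun x y => f x y * g x y).
Proof.
  intros HW. revert f g. induction n as [|n IH]; intros f g Hf Hg.
  - apply Cn_0. intros x y Hxy.
    apply continuity_2d_pt_mult; apply (Cn_continuity W 0); auto.
  - assert (Hf' := Cn_le W (S n) n f (Nat.le_succ_diag_r n) Hf).
    assert (Hg' := Cn_le W (S n) n g (Nat.le_succ_diag_r n) Hg).
    apply Cn_succ with (fun x y => D1 f x y * g x y + f x y * D1 g x y)
      (fun x y => D2 f x y * g x y + f x y * D2 g x y); trivial.
    + intros x y Hxy.
      apply differentiable_pt_lim_mult; apply (Cn_differentiable W n); auto.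
    + apply Cn_plus; trivial; apply IH; trivial; now apply Cn_D.
    + apply Cn_plus; trivial; apply IH; trivial; now apply Cn_D.
Qed.

Lemma Cn_comp (W W' : R * R -> Prop) (n : nat) (h f g : R -> R -> R) :
  open W -> open W' ->
  (forall x y, W (x, y) -> W' (f x y, g x y)) ->
  Cn W' n h -> Cn W n f -> Cn W n g -> Cn W n (fun x y => h (f x y) (g x y)).
Proof.
  intros HW HW' Hfg. revert h. induction n as [|n IH]; intros h Hh Hf Hg.
  - apply Cn_0. intros x y Hxy.
    apply continuity_2d_pt_comp;
      [apply (Cn_continuity W' 0) | apply (Cn_continuity W 0)
      | apply (Cn_continuity W 0)]; auto.
  - assert (Hf' := Cn_le W (S n) n f (Nat.le_succ_diag_r n) Hf).
    assert (Hg' := Cn_le W (S n) n g (Nat.le_succ_diag_r n) Hg).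
    destruct (Cn_D _ _ _ Hh) as [Hh1 Hh2].
    destruct (Cn_D _ _ _ Hf) as [Hf1 Hf2].
    destruct (Cn_D _ _ _ Hg) as [Hg1 Hg2].
    apply Cn_succ with
      (fun x y => D1 h (f x y) (g x y) * D1 f x y + D2 h (f x y) (g x y) * D1 g x y)
      (fun x y => D1 h (f x y) (g x y) * D2 f x y + D2 h (f x y) (g x y) * D2 g x y);
      trivial.
    + intros x y Hxy.
      apply (differentiable_pt_lim_comp h f g);
        [apply (Cn_differentiable W' n) | apply (Cn_differentiable W n)
        | apply (Cn_differentiable W n)]; auto.
    + apply Cn_plus; trivial; apply Cn_mult; auto.
    + apply Cn_plus; trivial; apply Cn_mult; auto.
Qed.

(** A function whose gradient is built smoothly from the function itself is
    smooth: each degree of regularity of the function gives the next one.  This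
    is how the flow of a vector field is seen to be smooth. *)
Lemma Cn_bootstrap (W : R * R -> Prop) (h hx hy : R -> R -> R) :
  open W ->
  (forall x y, W (x, y) -> differentiable_pt_lim h x y (hx x y) (hy x y)) ->
  (forall n, Cn W n h -> Cn W n hx /\ Cn W n hy) ->
  smooth_on W h.
Proof.
  intros HW Hd Hn.
  enough (H : forall n, Cn W n h) by (intros x y Hxy n; now apply H).
  induction n as [|n IH].
  - apply Cn_0. intros x y Hxy. eapply differentiable_pt_lim_continuity; eauto.
  - destruct (Hn n IH). apply Cn_succ with hx hy; trivial.
Qed.

Lemma smooth_Cn (W : R * R -> Prop) (h : R -> R -> R) (n : nat) :
  smooth_on W h -> Cn W n h.
Proof. intros Hh x y Hxy. now apply Hh. Qed.

Lemma Cn_smooth (W : R * R -> Prop) (h : R -> R -> R) :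
  (forall n, Cn W n h) -> smooth_on W h.
Proof. intros Hh x y Hxy n. now apply Hh. Qed.

Lemma smooth_ext (W : R * R -> Prop) (f g : R -> R -> R) :
  open W -> (forall x y, W (x, y) -> f x y = g x y) ->
  smooth_on W f -> smooth_on W g.
Proof.
  intros HW He Hf. apply Cn_smooth. intros n.
  apply (Cn_ext W n f); auto using smooth_Cn.
Qed.

Lemma smooth_subset (W W' : R * R -> Prop) (h : R -> R -> R) :
  (forall z, W' z -> W z) -> smooth_on W h -> smooth_on W' h.
Proof. intros HW Hh x y Hxy. apply Hh, HW, Hxy. Qed.

Lemma smooth_continuity (W : R * R -> Prop) (h : R -> R -> R) (x y : R) :
  smooth_on W h -> W (x, y) -> continuity_2d_pt h x y.
Proof. intros Hh Hxy. apply (Cn_continuity W 0); auto using smooth_Cn. Qed.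

Lemma smooth_differentiable (W : R * R -> Prop) (h : R -> R -> R) (x y : R) :
  open W -> smooth_on W h -> W (x, y) ->
  differentiable_pt_lim h x y (D1 h x y) (D2 h x y).
Proof. intros HW Hh Hxy. apply (Cn_differentiable W 0); auto using smooth_Cn. Qed.

Lemma smooth_D (W : R * R -> Prop) (h : R -> R -> R) :
  smooth_on W h -> smooth_on W (D1 h) /\ smooth_on W (D2 h).
Proof.
  intros Hh. split; apply Cn_smooth; intros n; apply Cn_D; now apply smooth_Cn.
Qed.

Lemma smooth_const (W : R * R -> Prop) (c : R) :
  open W -> smooth_on W (fun _ _ => c).
Proof. intros HW. apply Cn_smooth. intros n. now apply Cn_const. Qed.

Lemma smooth_fst (W : R * R -> Prop) : open W -> smooth_on W (fun x _ => x).
Proof. intros HW. apply Cn_smooth. intros n. now apply Cn_fst. Qed.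

Lemma smooth_snd (W : R * R -> Prop) : open W -> smooth_on W (fun _ y => y).
Proof. intros HW. apply Cn_smooth. intros n. now apply Cn_snd. Qed.

Lemma smooth_plus (W : R * R -> Prop) (f g : R -> R -> R) :
  open W -> smooth_on W f -> smooth_on W g ->
  smooth_on W (fun x y => f x y + g x y).
Proof.
  intros HW Hf Hg. apply Cn_smooth. intros n. apply Cn_plus; auto using smooth_Cn.
Qed.

Lemma smooth_mult (W : R * R -> Prop) (f g : R -> R -> R) :
  open W -> smooth_on W f -> smooth_on W g ->
  smooth_on W (fun x y => f x y * g x y).
Proof.
  intros HW Hf Hg. apply Cn_smooth. intros n. apply Cn_mult; auto using smooth_Cn.
Qed.

Lemma smooth_opp (W : R * R -> Prop) (f : R -> R -> R) :
  open W -> smooth_on W f -> smooth_on W (fun x y => - f x y).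
Proof.
  intros HW Hf. apply (smooth_ext W (fun x y => -1 * f x y)); trivial.
  - intros x y _. ring.
  - apply (smooth_mult W (fun _ _ => -1)); auto using smooth_const.
Qed.

Lemma smooth_minus (W : R * R -> Prop) (f g : R -> R -> R) :
  open W -> smooth_on W f -> smooth_on W g ->
  smooth_on W (fun x y => f x y - g x y).
Proof.
  intros HW Hf Hg. apply (smooth_plus W f (fun x y => - g x y)); auto using smooth_opp.
Qed.

Lemma smooth_comp (W W' : R * R -> Prop) (h f g : R -> R -> R) :
  open W -> open W' ->
  (forall x y, W (x, y) -> W' (f x y, g x y)) ->
  smooth_on W' h -> smooth_on W f -> smooth_on W g ->
  smooth_on W (fun x y => h (f x y) (g x y)).
Proof.
  intros HW HW' Hfg Hh Hf Hg. apply Cn_smooth. intros n.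
  apply (Cn_comp W W'); auto using smooth_Cn.
Qed.

Lemma open_fst (I : R -> Prop) : open I -> open (fun z : R * R => I (fst z)).
Proof.
  intros HI. apply open_of_locally_2d. intros x y Hx.
  destruct (HI x Hx) as [d Hd]. exists d. intros a b Ha _. now apply Hd.
Qed.

Lemma Cn_comp_1d (I : R -> Prop) (k k' : R -> R) (W : R * R -> Prop) (n : nat)
    (f : R -> R -> R) :
  open I -> (forall t, I t -> is_derive k t (k' t)) ->
  (forall m, Cn (fun z => I (fst z)) m (fun x _ => k x) ->
             Cn (fun z => I (fst z)) m (fun x _ => k' x)) ->
  open W -> (forall x y, W (x, y) -> I (f x y)) ->
  Cn W n f -> Cn W n (fun x y => k (f x y)).
Proof.
  intros HI Hk Hk' HW Hf Cf.
  assert (HI2 := open_fst I HI).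
  apply (Cn_comp W (fun z => I (fst z)) n (fun x _ => k x) f f); trivial.
  apply smooth_Cn.
  apply Cn_bootstrap with (fun x _ => k' x) (fun _ _ => 0); trivial.
  - intros x y Hx. apply differentiable_pt_lim_proj1_0.
    now apply is_derive_Reals, Hk.
  - intros m Hm. split; [now apply Hk' | now apply Cn_const].
Qed.

Lemma Cn_exp (W : R * R -> Prop) (n : nat) (f : R -> R -> R) :
  open W -> Cn W n f -> Cn W n (fun x y => exp (f x y)).
Proof.
  intros HW Hf. apply (Cn_comp_1d (fun _ => True) exp exp); trivial.
  - apply open_true.
  - intros t _. apply is_derive_exp.
Qed.

Lemma Cn_inv (W : R * R -> Prop) (n : nat) (f : R -> R -> R) :
  open W -> (forall x y, W (x, y) -> f x y <> 0) -> Cn W n f ->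
  Cn W n (fun x y => / f x y).
Proof.
  intros HW Hf Cf.
  apply (Cn_comp_1d (fun t => t <> 0) Rinv (fun t => -1 * (/ t * / t))); trivial.
  - apply open_neq.
  - intros t Ht. auto_derive; [trivial | field; trivial].
  - intros m Hm.
    assert (HI2 := open_fst _ (open_neq 0)).
    apply (Cn_mult _ m (fun _ _ => -1)); auto using Cn_const.
    apply (Cn_mult _ m (fun x _ => / x) (fun x _ => / x)); auto.
Qed.

Lemma smooth_inv (W : R * R -> Prop) (f : R -> R -> R) :
  open W -> (forall x y, W (x, y) -> f x y <> 0) -> smooth_on W f ->
  smooth_on W (fun x y => / f x y).
Proof.
  intros HW Hf Cf. apply Cn_smooth. intros n. apply Cn_inv; auto using smooth_Cn.
Qed.

Lemma smooth_div (W : R * R -> Prop) (f g : R -> R -> R) :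
  open W -> (forall x y, W (x, y) -> g x y <> 0) -> smooth_on W f ->
  smooth_on W g -> smooth_on W (fun x y => f x y / g x y).
Proof.
  intros HW Hg Cf Cg. apply (smooth_mult W f (fun x y => / g x y)); auto using smooth_inv.
Qed.

Lemma smooth_sqrt (W : R * R -> Prop) (f : R -> R -> R) :
  open W -> (forall x y, W (x, y) -> 0 < f x y) -> smooth_on W f ->
  smooth_on W (fun x y => sqrt (f x y)).
Proof.
  intros HW Hf Cf. apply Cn_smooth. intros n.
  apply (Cn_comp_1d (fun t => 0 < t) sqrt (fun t => / 2 * / sqrt t)); auto using smooth_Cn.
  - apply open_gt.
  - intros t Ht. auto_derive; trivial. field. apply Rgt_not_eq, sqrt_lt_R0, Ht.
  - intros m Hm.
    assert (HI2 := open_fst _ (open_gt 0)).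
    apply (Cn_mult _ m (fun _ _ => / 2)); auto using Cn_const.
    apply (Cn_inv _ m (fun x _ => sqrt x)); trivial.
    intros x y Hx. apply Rgt_not_eq, sqrt_lt_R0, Hx.
Qed.

(** * Mean value estimates on boxes *)

Definition box (u v r : R) (z : R * R) : Prop :=
  Rabs (fst z - u) < r /\ Rabs (snd z - v) < r.

Lemma Rabs_lt_open (a u r : R) :
  Rabs (a - u) < r -> exists d : posreal, forall b, Rabs (b - a) < d -> Rabs (b - u) < r.
Proof.
  intros Ha. assert (Hd : 0 < r - Rabs (a - u)) by lra.
  exists (mkposreal _ Hd). simpl. intros b Hb.
  replace (b - u) with ((b - a) + (a - u)) by ring.
  apply Rle_lt_trans with (1 := Rabs_triang _ _). lra.
Qed.

Lemma open_box (u v r : R) : open (box u v r).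
Proof.
  apply open_of_locally_2d. intros x y [Hx Hy].
  destruct (Rabs_lt_open _ _ _ Hx) as [d1 H1].
  destruct (Rabs_lt_open _ _ _ Hy) as [d2 H2].
  apply locally_2d_and; [exists d1 | exists d2]; unfold box; simpl; auto.
Qed.

Lemma box_center (u v r : R) : 0 < r -> box u v r (u, v).
Proof. intros Hr. split; simpl; rewrite Rminus_diag, Rabs_R0; trivial. Qed.

Lemma locally_2d_box (P : R -> R -> Prop) (x y : R) :
  locally_2d P x y ->
  exists r, 0 < r /\ forall a b, box x y r (a, b) -> P a b.
Proof.
  intros [d Hd]. exists d. split; [apply cond_pos|].
  intros a b [H1 H2]. now apply Hd.
Qed.

Lemma between_Rabs (a b c t r : R) :
  Rabs (a - c) < r -> Rabs (b - c) < r -> Rmin a b <= t <= Rmax a b ->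
  Rabs (t - c) < r.
Proof.
  intros Ha Hb. unfold Rmin, Rmax. apply Rabs_def2 in Ha. apply Rabs_def2 in Hb.
  destruct (Rle_dec a b); intros; apply Rabs_def1; lra.
Qed.

Lemma MVT_segment (h h' : R -> R) (a b : R) :
  (forall t, Rmin a b <= t <= Rmax a b -> is_derive h t (h' t)) ->
  exists t, Rmin a b <= t <= Rmax a b /\ h b - h a = h' t * (b - a).
Proof.
  intros Hh. apply (MVT_gen h a b h').
  - intros t Ht. apply Hh. lra.
  - intros t Ht. apply continuity_pt_filterlim.
    apply (ex_derive_continuous h). exists (h' t). now apply Hh.
Qed.

Lemma lipschitz_on_box (h : R -> R -> R) (u v r k : R) :
  smooth_on (box u v r) h ->
  (forall x y, box u v r (x, y) -> Rabs (D1 h x y) <= k /\ Rabs (D2 h x y) <= k) ->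
  forall x y x' y', box u v r (x, y) -> box u v r (x', y') ->
    Rabs (h x' y' - h x y) <= k * (Rabs (x' - x) + Rabs (y' - y)).
Proof.
  intros Hh Hk x y x' y' [Hx Hy] [Hx' Hy']. simpl in *.
  assert (Hd : forall a b, box u v r (a, b) ->
    is_derive (fun t => h t b) a (D1 h a b) /\ is_derive (fun t => h a t) b (D2 h a b)).
  { intros a b Hab. apply differentiable_pt_lim_partials.
    apply (smooth_differentiable (box u v r)); trivial. apply open_box. }
  destruct (MVT_segment (fun t => h t y) (fun t => D1 h t y) x x') as (a & Ha & Ea).
  { intros t Ht. apply Hd. split; simpl; trivial. now apply between_Rabs with (3 := Ht). }
  destruct (MVT_segment (fun t => h x' t) (fun t => D2 h x' t) y y') as (b & Hb & Eb).
  { intros t Ht. apply Hd. split; simpl; trivial. now apply between_Rabs with (3 := Ht). }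
  replace (h x' y' - h x y) with ((h x' y - h x y) + (h x' y' - h x' y)) by ring.
  rewrite Ea, Eb, Rmult_plus_distr_l.
  apply Rle_trans with (1 := Rabs_triang _ _). rewrite !Rabs_mult.
  apply Rplus_le_compat; apply Rmult_le_compat_r; try apply Rabs_pos; apply Hk;
    split; simpl; trivial; eauto using between_Rabs.
Qed.

(** * Fixed points of contractions *)

Lemma pow_half_small (C eps : R) : 0 < eps -> exists n, C * (/ 2) ^ n < eps.
Proof.
  intros He.
  assert (HC : 0 < Rabs C + 1) by (generalize (Rabs_pos C); lra).
  assert (He' : 0 < eps / (Rabs C + 1)) by now apply Rdiv_lt_0_compat.
  destruct (pow_lt_1_zero (/ 2)) with (y := eps / (Rabs C + 1)) as [n Hn]; trivial.
  { rewrite Rabs_pos_eq; lra. }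
  exists n. specialize (Hn n (Nat.le_refl n)).
  assert (Hp : 0 < (/ 2) ^ n) by (apply pow_lt; lra).
  rewrite Rabs_pos_eq in Hn by lra.
  apply Rle_lt_trans with ((Rabs C + 1) * (/ 2) ^ n).
  - apply Rmult_le_compat_r; [lra|]. generalize (Rle_abs C). lra.
  - apply Rmult_lt_compat_l with (r := Rabs C + 1) in Hn; trivial.
    replace ((Rabs C + 1) * (eps / (Rabs C + 1))) with eps in Hn by (field; lra). exact Hn.
Qed.

(** The space of functions is arbitrary: the inverse function theorem uses
    functions on a set with two elements (the two coordinates), the flow of a
    vector field uses functions on the real line. *)
Lemma contraction_fixpoint (X : Type) (P : (X -> R) -> Prop)
    (T : (X -> R) -> X -> R) (f0 : X -> R) (C : R) :
  P f0 -> (forall f, P f -> P (T f)) ->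
  (forall f g, P f -> P g -> forall x, Rabs (f x - g x) <= C) ->
  (forall f g K, P f -> P g -> (forall x, Rabs (f x - g x) <= K) ->
     forall x, Rabs (T f x - T g x) <= K / 2) ->
  (forall f, (forall eps, 0 < eps ->
                exists g, P g /\ forall x, Rabs (g x - f x) <= eps) -> P f) ->
  exists f, P f /\ forall x, T f x = f x.
Proof.
  intros H0 HT Hdiam Hcontr Hclosed.
  set (F := fun n => Nat.iter n T f0).
  assert (HP : forall n, P (F n)).
  { induction n as [|n IH]; [exact H0 | exact (HT _ IH)]. }
  assert (HF : forall n k x, Rabs (F (n + k)%nat x - F n x) <= C * (/ 2) ^ n).
  { induction n as [|n IH]; intros k x.
    - simpl. rewrite Rmult_1_r. apply (Hdiam (F k) f0); trivial.
    - replace (C * (/ 2) ^ S n) with ((C * (/ 2) ^ n) / 2) by (simpl; field).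
      apply (Hcontr (F (n + k)%nat) (F n)); auto. }
  assert (Hlim : forall x, is_lim_seq (fun n => F n x) (real (Lim_seq (fun n => F n x)))).
  { intros x. apply Lim_seq_correct', ex_lim_seq_cauchy_corr. intros eps.
    destruct (pow_half_small C (eps / 2)) as [N HN]; [apply is_pos_div_2|].
    exists N. intros n m Hn Hm.
    assert (Hc : forall k, (N <= k)%nat -> Rabs (F k x - F N x) < eps / 2).
    { intros k Hk. replace k with (N + (k - N))%nat by lia.
      apply Rle_lt_trans with (2 := HN), HF. }
    replace (F n x - F m x) with ((F n x - F N x) - (F m x - F N x)) by ring.
    apply Rle_lt_trans with (1 := Rabs_triang _ _). rewrite Rabs_Ropp.
    generalize (Hc n Hn) (Hc m Hm). simpl. lra. }
  set (f := fun x => real (Lim_seq (fun n => F n x))).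
  assert (Hf : forall n x, Rabs (F n x - f x) <= C * (/ 2) ^ n).
  { intros n x. rewrite Rabs_minus_sym.
    assert (L : is_lim_seq (fun k => Rabs (F (k + n)%nat x - F n x)) (Rabs (f x - F n x))).
    { apply (is_lim_seq_abs _ (f x - F n x)).
      apply (is_lim_seq_minus _ _ (f x) (F n x)).
      - apply (is_lim_seq_incr_n (fun k => F k x)), Hlim.
      - apply is_lim_seq_const.
      - reflexivity. }
    apply (is_lim_seq_le (fun k => Rabs (F (k + n)%nat x - F n x))
             (fun _ => C * (/ 2) ^ n) (Rabs (f x - F n x)) (C * (/ 2) ^ n)); trivial.
    - intros k. rewrite Nat.add_comm. apply HF.
    - apply is_lim_seq_const. }
  assert (Pf : P f).
  { apply Hclosed. intros eps He. destruct (pow_half_small C eps He) as [n Hn].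
    exists (F n). split; auto. intros x. generalize (Hf n x). lra. }
  exists f. split; trivial. intros x.
  apply Rminus_diag_uniq. apply NNPP. intros Hne. apply Rabs_pos_lt in Hne.
  destruct (pow_half_small C _ Hne) as [n Hn].
  assert (H1 := Hcontr f (F n) (C * (/ 2) ^ n) Pf (HP n)).
  specialize (H1 (fun x => eq_ind_r (fun t => t <= _) (Hf n x) (Rabs_minus_sym _ _)) x).
  assert (H2 : Rabs (T (F n) x - f x) <= C * (/ 2) ^ S n) by exact (Hf (S n) x).
  replace (T f x - f x) with ((T f x - T (F n) x) + (T (F n) x - f x)) in Hn by ring.
  generalize (Rabs_triang (T f x - T (F n) x) (T (F n) x - f x)).
  simpl in H2. lra.
Qed.

(** Iterating the hypothesis from the bound K0 makes the excess over 2 a tend to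
    zero.  On a short interval of integration this does the work of Gronwall's
    inequality. *)
Lemma contraction_bound (X : Type) (f : X -> R) (a K0 : R) :
  (forall x, Rabs (f x) <= K0) ->
  (forall K, (forall x, Rabs (f x) <= K) -> forall x, Rabs (f x) <= a + K / 2) ->
  forall x, Rabs (f x) <= 2 * a.
Proof.
  intros H0 Hstep.
  assert (Hn : forall n x, Rabs (f x) <= 2 * a + (K0 - 2 * a) * (/ 2) ^ n).
  { induction n as [|n IH]; intros x.
    - simpl. generalize (H0 x). lra.
    - generalize (Hstep _ IH x). simpl. lra. }
  intros x. apply le_epsilon. intros eps He.
  destruct (pow_half_small (K0 - 2 * a) eps He) as [n Hlt].
  generalize (Hn n x). lra.
Qed.

(** * The inverse function theorem in the plane *)

Lemma differentiable_inverse (phi1 phi2 psi1 psi2 : R -> R -> R)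
    (w1 w2 A B C D L : R) :
  A * D - B * C <> 0 ->
  differentiable_pt_lim phi1 (psi1 w1 w2) (psi2 w1 w2) A B ->
  differentiable_pt_lim phi2 (psi1 w1 w2) (psi2 w1 w2) C D ->
  0 < L ->
  locally_2d (fun a b =>
    phi1 (psi1 a b) (psi2 a b) = a /\ phi2 (psi1 a b) (psi2 a b) = b /\
    Rabs (psi1 a b - psi1 w1 w2) <= L * Rmax (Rabs (a - w1)) (Rabs (b - w2)) /\
    Rabs (psi2 a b - psi2 w1 w2) <= L * Rmax (Rabs (a - w1)) (Rabs (b - w2))) w1 w2 ->
  differentiable_pt_lim psi1 w1 w2 (D / (A * D - B * C)) (- B / (A * D - B * C)) /\
  differentiable_pt_lim psi2 w1 w2 (- C / (A * D - B * C)) (A / (A * D - B * C)).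
Proof.
  intros Hdet H1 H2 HL Hloc.
  destruct (locally_2d_singleton _ _ _ Hloc) as (E1 & E2 & _).
  set (det := A * D - B * C) in *.
  assert (Hdet' : 0 < Rabs det) by now apply Rabs_pos_lt.
  set (S := Rabs A + Rabs B + Rabs C + Rabs D + 1).
  assert (HS : 0 < S).
  { unfold S. generalize (Rabs_pos A) (Rabs_pos B) (Rabs_pos C) (Rabs_pos D). lra. }
  (* The remainders of psi are the inverse of the Jacobian matrix applied to
     those of phi, whence the factors S and |det|; the factor L compares the
     displacement of psi, in which the remainders of phi are small, with that
     of the point. *)
  assert (Hrem : forall eps : posreal, locally_2d (fun a b =>
    Rabs (a - w1 - (A * (psi1 a b - psi1 w1 w2) + B * (psi2 a b - psi2 w1 w2)))
      * S <= eps * Rabs det * Rmax (Rabs (a - w1)) (Rabs (b - w2)) /\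
    Rabs (b - w2 - (C * (psi1 a b - psi1 w1 w2) + D * (psi2 a b - psi2 w1 w2)))
      * S <= eps * Rabs det * Rmax (Rabs (a - w1)) (Rabs (b - w2))) w1 w2).
  { intros eps.
    assert (He' : 0 < eps * Rabs det / (L * S)).
    { apply Rdiv_lt_0_compat; apply Rmult_lt_0_compat; trivial. apply cond_pos. }
    destruct (locally_2d_and _ _ _ _ (H1 (mkposreal _ He')) (H2 (mkposreal _ He')))
      as [d Hd]. simpl in Hd.
    assert (Hd' : 0 < d / L) by (apply Rdiv_lt_0_compat; trivial; apply cond_pos).
    assert (Hball : locally_2d (fun a b => Rmax (Rabs (a - w1)) (Rabs (b - w2)) < d / L) w1 w2).
    { exists (mkposreal _ Hd'). intros a b Ha Hb. now apply Rmax_lub_lt. }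
    generalize (locally_2d_and _ _ _ _ Hloc Hball).
    apply locally_2d_impl, locally_2d_forall.
    intros a b ((F1 & F2 & L1 & L2) & Hm).
    set (m := Rmax (Rabs (a - w1)) (Rabs (b - w2))) in *.
    assert (Hm' : L * m < d).
    { replace (pos d) with (L * (d / L)) by (field; lra).
      now apply Rmult_lt_compat_l. }
    destruct (Hd (psi1 a b) (psi2 a b)) as [G1 G2]; try lra.
    rewrite F1, E1 in G1. rewrite F2, E2 in G2.
    assert (Hmax : Rmax (Rabs (psi1 a b - psi1 w1 w2)) (Rabs (psi2 a b - psi2 w1 w2))
                   <= L * m) by now apply Rmax_lub.
    assert (Hle : forall X, X <= eps * Rabs det / (L * S) *
        Rmax (Rabs (psi1 a b - psi1 w1 w2)) (Rabs (psi2 a b - psi2 w1 w2)) ->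
        X * S <= eps * Rabs det * m).
    { intros X HX.
      replace (eps * Rabs det * m) with ((eps * Rabs det / (L * S) * (L * m)) * S)
        by (field; lra).
      apply Rmult_le_compat_r; [lra|]. apply Rle_trans with (1 := HX).
      apply Rmult_le_compat_l; lra. }
    split; now apply Hle. }
  assert (Hgen : forall p q r1 r2 m (eps : posreal) X,
    Rabs r1 * S <= eps * Rabs det * m -> Rabs r2 * S <= eps * Rabs det * m ->
    Rabs p + Rabs q <= S -> X = (p * r1 + q * r2) / det -> Rabs X <= eps * m).
  { intros p q r1 r2 m eps X R1 R2 Hpq ->.
    unfold Rdiv. rewrite Rabs_mult, Rabs_inv.
    apply Rmult_le_reg_r with (Rabs det); trivial.
    rewrite Rmult_assoc, Rinv_l, Rmult_1_r by lra.
    apply Rle_trans with (1 := Rabs_triang _ _). rewrite !Rabs_mult.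
    set (K := eps * Rabs det * m) in *.
    replace (eps * m * Rabs det) with K by (unfold K; ring).
    assert (HKS : 0 <= K / S).
    { apply Rmult_le_reg_r with S; trivial.
      unfold Rdiv. rewrite Rmult_assoc, Rinv_l, Rmult_0_l, Rmult_1_r by lra.
      apply Rle_trans with (2 := R1).
      apply Rmult_le_pos; [apply Rabs_pos | lra]. }
    assert (R1' : Rabs r1 <= K / S).
    { apply Rmult_le_reg_r with S; trivial.
      unfold Rdiv. rewrite Rmult_assoc, Rinv_l, Rmult_1_r by lra. exact R1. }
    assert (R2' : Rabs r2 <= K / S).
    { apply Rmult_le_reg_r with S; trivial.
      unfold Rdiv. rewrite Rmult_assoc, Rinv_l, Rmult_1_r by lra. exact R2. }
    apply Rle_trans with (Rabs p * (K / S) + Rabs q * (K / S)).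
    - apply Rplus_le_compat; apply Rmult_le_compat_l; trivial; apply Rabs_pos.
    - rewrite <- Rmult_plus_distr_r.
      apply Rle_trans with (S * (K / S)); [now apply Rmult_le_compat_r|].
      right. field. lra. }
  assert (HpS : Rabs D + Rabs (- B) <= S /\ Rabs (- C) + Rabs A <= S).
  { rewrite !Rabs_Ropp. unfold S.
    generalize (Rabs_pos A) (Rabs_pos B) (Rabs_pos C) (Rabs_pos D). lra. }
  split; intros eps; generalize (Hrem eps); apply locally_2d_impl, locally_2d_forall;
    intros a b [R1 R2].
  - apply (Hgen (- D) B _ _ _ _ _ R1 R2).
    + rewrite Rabs_Ropp. rewrite Rabs_Ropp in HpS. lra.
    + unfold det. field. exact Hdet.
  - apply (Hgen C (- A) _ _ _ _ _ R1 R2).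
    + rewrite Rabs_Ropp. rewrite !Rabs_Ropp in HpS. lra.
    + unfold det. field. exact Hdet.
Qed.

Definition jacobian (phi1 phi2 : R -> R -> R) (x y : R) : R :=
  D1 phi1 x y * D2 phi2 x y - D2 phi1 x y * D1 phi2 x y.

Lemma smooth_jacobian (W : R * R -> Prop) (phi1 phi2 : R -> R -> R) :
  open W -> smooth_on W phi1 -> smooth_on W phi2 -> smooth_on W (jacobian phi1 phi2).
Proof.
  intros HW H1 H2. destruct (smooth_D _ _ H1). destruct (smooth_D _ _ H2).
  apply (smooth_minus W (fun x y => D1 phi1 x y * D2 phi2 x y)
           (fun x y => D2 phi1 x y * D1 phi2 x y)); trivial;
    apply smooth_mult; trivial.
Qed.

(** A Lipschitz right inverse of a local diffeomorphism is differentiable, and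
    its derivative is a smooth function of its value, whence all degrees of
    regularity by induction. *)
Lemma smooth_inverse (B V' : R * R -> Prop) (phi1 phi2 psi1 psi2 : R -> R -> R) (L : R) :
  open B -> open V' -> smooth_on B phi1 -> smooth_on B phi2 ->
  (forall x y, B (x, y) -> jacobian phi1 phi2 x y <> 0) ->
  (forall a b, V' (a, b) -> B (psi1 a b, psi2 a b) /\
     phi1 (psi1 a b) (psi2 a b) = a /\ phi2 (psi1 a b) (psi2 a b) = b) ->
  0 < L ->
  (forall a b a' b', V' (a, b) -> V' (a', b') ->
     Rabs (psi1 a' b' - psi1 a b) <= L * Rmax (Rabs (a' - a)) (Rabs (b' - b)) /\
     Rabs (psi2 a' b' - psi2 a b) <= L * Rmax (Rabs (a' - a)) (Rabs (b' - b))) ->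
  smooth_on V' psi1 /\ smooth_on V' psi2.
Proof.
  intros HB HV S1 S2 HJ Hinv HL Hlip.
  set (J := jacobian phi1 phi2) in *.
  assert (Hdiff : forall a b, V' (a, b) ->
    differentiable_pt_lim psi1 a b (D2 phi2 (psi1 a b) (psi2 a b) / J (psi1 a b) (psi2 a b))
       (- D2 phi1 (psi1 a b) (psi2 a b) / J (psi1 a b) (psi2 a b)) /\
    differentiable_pt_lim psi2 a b (- D1 phi2 (psi1 a b) (psi2 a b) / J (psi1 a b) (psi2 a b))
       (D1 phi1 (psi1 a b) (psi2 a b) / J (psi1 a b) (psi2 a b))).
  { intros a b Hab. destruct (Hinv a b Hab) as (Hb & _).
    apply (differentiable_inverse phi1 phi2 psi1 psi2 a b _ _ _ _ L); trivial.
    - exact (HJ _ _ Hb).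
    - now apply (smooth_differentiable B).
    - now apply (smooth_differentiable B).
    - generalize (open_locally_2d _ _ _ HV Hab).
      apply locally_2d_impl, locally_2d_forall. intros a' b' Hab'.
      destruct (Hinv _ _ Hab') as (_ & E1 & E2).
      destruct (Hlip _ _ _ _ Hab Hab'). auto. }
  destruct (smooth_D _ _ S1) as [S11 S12]. destruct (smooth_D _ _ S2) as [S21 S22].
  assert (SJ : smooth_on B J) by now apply smooth_jacobian.
  assert (Hcomp : forall k n, smooth_on B k -> Cn V' n psi1 -> Cn V' n psi2 ->
    Cn V' n (fun a b => k (psi1 a b) (psi2 a b) / J (psi1 a b) (psi2 a b))).
  { intros k n Hk C1 C2.
    apply (Cn_comp V' B n (fun x y => k x y / J x y)); trivial.
    - intros a b Hab. now apply Hinv.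
    - apply smooth_Cn, smooth_div; trivial. }
  assert (Hn : forall n, Cn V' n psi1 /\ Cn V' n psi2).
  { induction n as [|n [C1 C2]].
    - split; apply Cn_0; intros a b Hab; destruct (Hdiff a b Hab) as [G1 G2].
      + exact (differentiable_pt_lim_continuity _ _ _ _ _ G1).
      + exact (differentiable_pt_lim_continuity _ _ _ _ _ G2).
    - split.
      + eapply Cn_succ; [trivial | intros a b Hab; apply (Hdiff a b Hab) | |].
        * now apply Hcomp.
        * apply (Hcomp (fun x y => - D2 phi1 x y)); trivial. now apply smooth_opp.
      + eapply Cn_succ; [trivial | intros a b Hab; apply (Hdiff a b Hab) | |].
        * apply (Hcomp (fun x y => - D1 phi2 x y)); trivial. now apply smooth_opp.
        * now apply Hcomp. }
  split; apply Cn_smooth; intros n; apply Hn.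
Qed.

Lemma smooth_small_near (W : R * R -> Prop) (h : R -> R -> R) (u v eps : R) :
  smooth_on W h -> W (u, v) -> h u v = 0 -> 0 < eps ->
  locally_2d (fun x y => Rabs (h x y) <= eps) u v.
Proof.
  intros Hh Huv H0 He.
  generalize (smooth_continuity _ _ _ _ Hh Huv (mkposreal _ He)).
  apply locally_2d_impl, locally_2d_forall. intros x y. simpl.
  rewrite H0, Rminus_0_r. lra.
Qed.

(** With N the inverse of the derivative at (u, v), the equation phi z = w reads
    z = N w + e z, where e z = z - N (phi z) has zero derivative at (u, v); so
    near (u, v) the right-hand side is a contraction. *)
Theorem inverse_function (W : R * R -> Prop) (phi1 phi2 : R -> R -> R) (u v : R) :
  open W -> W (u, v) -> smooth_on W phi1 -> smooth_on W phi2 ->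
  jacobian phi1 phi2 u v <> 0 ->
  exists V V' psi1 psi2,
    coordinate_change V V' phi1 phi2 psi1 psi2 /\ V (u, v) /\ (forall z, V z -> W z).
Proof.
  intros HW Huv S1 S2 HJ.
  set (A := D1 phi1 u v). set (B := D2 phi1 u v).
  set (C := D1 phi2 u v). set (D := D2 phi2 u v).
  set (det := A * D - B * C).
  assert (Hdet : det <> 0) by exact HJ.
  set (N1 := fun a b => D / det * a + - B / det * b).
  set (N2 := fun a b => - C / det * a + A / det * b).
  set (e1 := fun x y => x - N1 (phi1 x y) (phi2 x y)).
  set (e2 := fun x y => y - N2 (phi1 x y) (phi2 x y)).
  assert (Hlin : forall p q, smooth_on W (fun x y => p * phi1 x y + q * phi2 x y)).
  { intros p q. apply (smooth_plus W (fun x y => p * phi1 x y) (fun x y => q * phi2 x y));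
      trivial.
    - apply (smooth_mult W (fun _ _ => p)); trivial. now apply smooth_const.
    - apply (smooth_mult W (fun _ _ => q)); trivial. now apply smooth_const. }
  assert (Se1 : smooth_on W e1).
  { apply (smooth_minus W (fun x _ => x)); trivial; [now apply smooth_fst | apply Hlin]. }
  assert (Se2 : smooth_on W e2).
  { apply (smooth_minus W (fun _ y => y)); trivial; [now apply smooth_snd | apply Hlin]. }
  assert (Hde : (D1 e1 u v = 0 /\ D2 e1 u v = 0) /\ (D1 e2 u v = 0 /\ D2 e2 u v = 0)).
  { assert (G1 := smooth_differentiable W phi1 u v HW S1 Huv).
    assert (G2 := smooth_differentiable W phi2 u v HW S2 Huv).
    fold A B in G1. fold C D in G2.
    assert (Glin : forall c0 l0 l1 p q, differentiable_pt_lim c0 u v l0 l1 ->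
      differentiable_pt_lim (fun x y => c0 x y + (-1) * (p * phi1 x y + q * phi2 x y)) u v
        (l0 - (p * A + q * C)) (l1 - (p * B + q * D))).
    { intros c0 l0 l1 p q Hc0.
      assert (Gs : forall c f fx fy, differentiable_pt_lim f u v fx fy ->
        differentiable_pt_lim (fun x y => c * f x y) u v (c * fx) (c * fy)).
      { intros c f fx fy Hf.
        replace (c * fx) with (0 * f u v + c * fx) by ring.
        replace (c * fy) with (0 * f u v + c * fy) by ring.
        apply (differentiable_pt_lim_mult (fun _ _ => c)); trivial.
        apply differentiable_pt_lim_const. }
      replace (l0 - (p * A + q * C)) with (l0 + (-1) * (p * A + q * C)) by ring.
      replace (l1 - (p * B + q * D)) with (l1 + (-1) * (p * B + q * D)) by ring.
      apply differentiable_pt_lim_plus; trivial.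
      apply (Gs (-1)), differentiable_pt_lim_plus; now apply Gs. }
    split.
    - apply differentiable_pt_lim_D.
      assert (G := Glin _ _ _ (D / det) (- B / det) (differentiable_pt_lim_fst u v)).
      replace (1 - (D / det * A + - B / det * C)) with 0 in G by (unfold det; field; exact Hdet).
      replace (0 - (D / det * B + - B / det * D)) with 0 in G by (unfold det; field; exact Hdet).
      revert G. apply differentiable_pt_lim_ext, locally_2d_forall.
      intros x y. unfold e1, N1. ring.
    - apply differentiable_pt_lim_D.
      assert (G := Glin _ _ _ (- C / det) (A / det) (differentiable_pt_lim_snd u v)).
      replace (0 - (- C / det * A + A / det * C)) with 0 in G by (unfold det; field; exact Hdet).
      replace (1 - (- C / det * B + A / det * D)) with 0 in G by (unfold det; field; exact Hdet).
      revert G. apply differentiable_pt_lim_ext, locally_2d_forall.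
      intros x y. unfold e2, N2. ring. }
  destruct Hde as [[Z11 Z12] [Z21 Z22]].
  assert (Hloc : locally_2d (fun x y => W (x, y) /\ jacobian phi1 phi2 x y <> 0 /\
     (Rabs (D1 e1 x y) <= / 8 /\ Rabs (D2 e1 x y) <= / 8) /\
     (Rabs (D1 e2 x y) <= / 8 /\ Rabs (D2 e2 x y) <= / 8)) u v).
  { assert (H8 : 0 < / 8) by lra.
    destruct (smooth_D _ _ Se1) as [Se11 Se12]. destruct (smooth_D _ _ Se2) as [Se21 Se22].
    apply locally_2d_and; [now apply open_locally_2d|].
    apply locally_2d_and.
    - apply continuity_2d_pt_neq_0; trivial.
      apply (smooth_continuity W); trivial. now apply smooth_jacobian.
    - apply locally_2d_and; apply locally_2d_and; apply (smooth_small_near W); trivial. }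
  destruct (locally_2d_box _ _ _ Hloc) as (r & Hr & Hbox).
  set (Bx := box u v r).
  assert (HBx : open Bx) by apply open_box.
  assert (HBW : forall z, Bx z -> W z) by (intros [x y] Hz; now apply Hbox).
  assert (L1 : forall x y x' y', Bx (x, y) -> Bx (x', y') ->
    Rabs (e1 x' y' - e1 x y) <= / 8 * (Rabs (x' - x) + Rabs (y' - y))).
  { apply lipschitz_on_box; [now apply smooth_subset with W|]. intros x y Hxy. now apply Hbox. }
  assert (L2 : forall x y x' y', Bx (x, y) -> Bx (x', y') ->
    Rabs (e2 x' y' - e2 x y) <= / 8 * (Rabs (x' - x) + Rabs (y' - y))).
  { apply lipschitz_on_box; [now apply smooth_subset with W|]. intros x y Hxy. now apply Hbox. }
  (* Iterates from (u, v) stay in the box of radius r / 2: there e differs from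
     its value at (u, v) by at most r / 8, and N w differs from N (phi (u, v))
     by less than r / 4. *)
  set (n1 := N1 (phi1 u v) (phi2 u v)). set (n2 := N2 (phi1 u v) (phi2 u v)).
  set (V' := fun w : R * R => Rabs (N1 (fst w) (snd w) - n1) < r / 4 /\
                              Rabs (N2 (fst w) (snd w) - n2) < r / 4).
  assert (HN : forall p q a b, continuity_2d_pt (fun a b => p * a + q * b) a b).
  { intros p q a b. apply continuity_2d_pt_plus; apply continuity_2d_pt_mult;
      auto using continuity_2d_pt_const, continuity_2d_pt_id1, continuity_2d_pt_id2. }
  assert (Hpre : forall (k : R -> R -> R) c s a b, continuity_2d_pt k a b ->
    Rabs (k a b - c) < s -> locally_2d (fun a b => Rabs (k a b - c) < s) a b).
  { intros k c s a b Hk Hs. destruct (Rabs_lt_open _ _ _ Hs) as [d Hd].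
    generalize (Hk d). apply locally_2d_impl, locally_2d_forall. intros a' b'. apply Hd. }
  assert (HV' : open V').
  { apply open_of_locally_2d. intros a b [G1 G2].
    apply locally_2d_and; apply Hpre; trivial; apply HN. }
  set (V := fun z : R * R => Bx z /\ V' (phi1 (fst z) (snd z), phi2 (fst z) (snd z))).
  assert (HV : open V).
  { apply (open_and_locally_2d Bx (fun x y => V' (phi1 x y, phi2 x y))); trivial.
    intros x y Hxy [G1 G2].
    assert (Hc : forall p q, continuity_2d_pt (fun x y => p * phi1 x y + q * phi2 x y) x y).
    { intros p q. apply (smooth_continuity W); trivial. now apply HBW. }
    apply locally_2d_and.
    - apply (Hpre (fun x y => N1 (phi1 x y) (phi2 x y))); [apply Hc | exact G1].
    - apply (Hpre (fun x y => N2 (phi1 x y) (phi2 x y))); [apply Hc | exact G2]. }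
  assert (Hsolve : forall w : R * R, exists z : R * R, V' w ->
    Bx z /\ phi1 (fst z) (snd z) = fst w /\ phi2 (fst z) (snd z) = snd w).
  { intros [a b]. destruct (classic (V' (a, b))) as [[G1 G2]|]; [|now exists (0, 0)].
    simpl in G1, G2.
    set (P := fun f : bool -> R => Rabs (f true - u) <= r / 2 /\ Rabs (f false - v) <= r / 2).
    set (T := fun (f : bool -> R) (c : bool) =>
      if c then N1 a b + e1 (f true) (f false) else N2 a b + e2 (f true) (f false)).
    assert (HPB : forall f, P f -> Bx (f true, f false)).
    { intros f [Q1 Q2]. split; simpl; lra. }
    assert (Hc : Bx (u, v)) by now apply box_center.
    destruct (contraction_fixpoint bool P T (fun c => if c then u else v) r) as (f & Pf & Ef).
    - split; rewrite Rminus_diag, Rabs_R0; lra.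
    - intros f Pf. destruct (Pf) as [Q1 Q2].
      assert (M1 := L1 _ _ _ _ Hc (HPB f Pf)). assert (M2 := L2 _ _ _ _ Hc (HPB f Pf)).
      split; simpl.
      + replace (N1 a b + e1 (f true) (f false) - u)
          with ((N1 a b - n1) + (e1 (f true) (f false) - e1 u v)) by (unfold e1, n1; ring).
        apply Rle_trans with (1 := Rabs_triang _ _). lra.
      + replace (N2 a b + e2 (f true) (f false) - v)
          with ((N2 a b - n2) + (e2 (f true) (f false) - e2 u v)) by (unfold e2, n2; ring).
        apply Rle_trans with (1 := Rabs_triang _ _). lra.
    - intros f g [F1 F2] [G3 G4] c.
      destruct c;
        [replace (f true - g true) with ((f true - u) - (g true - u)) by ring
        |replace (f false - g false) with ((f false - v) - (g false - v)) by ring];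
        apply Rle_trans with (1 := Rabs_triang _ _); rewrite Rabs_Ropp; lra.
    - intros f g K Pf Pg HK c.
      assert (M1 := L1 _ _ _ _ (HPB g Pg) (HPB f Pf)).
      assert (M2 := L2 _ _ _ _ (HPB g Pg) (HPB f Pf)).
      assert (K1 := HK true). assert (K2 := HK false).
      assert (0 <= K) by (apply Rle_trans with (2 := K1), Rabs_pos).
      destruct c; simpl.
      + replace (N1 a b + e1 (f true) (f false) - (N1 a b + e1 (g true) (g false)))
          with (e1 (f true) (f false) - e1 (g true) (g false)) by ring. lra.
      + replace (N2 a b + e2 (f true) (f false) - (N2 a b + e2 (g true) (g false)))
          with (e2 (f true) (f false) - e2 (g true) (g false)) by ring. lra.
    - intros f Hf. split; apply le_epsilon; intros eps He; destruct (Hf eps He) as (g & [Q1 Q2] & Hg).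
      + generalize (Hg true) (Rabs_triang (g true - u) (- (g true - f true))).
        rewrite Rabs_Ropp. replace (g true - u + - (g true - f true)) with (f true - u) by ring. lra.
      + generalize (Hg false) (Rabs_triang (g false - v) (- (g false - f false))).
        rewrite Rabs_Ropp. replace (g false - v + - (g false - f false)) with (f false - v) by ring. lra.
    - exists (f true, f false). intros _. simpl. split; [now apply HPB|].
      assert (E1 := Ef true). assert (E2 := Ef false). simpl in E1, E2.
      unfold e1 in E1. unfold e2 in E2.
      assert (F1 : N1 a b = N1 (phi1 (f true) (f false)) (phi2 (f true) (f false))) by lra.
      assert (F2 : N2 a b = N2 (phi1 (f true) (f false)) (phi2 (f true) (f false))) by lra.
      assert (Hrec : forall a b, A * N1 a b + B * N2 a b = a /\ C * N1 a b + D * N2 a b = b).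
      { intros a' b'. unfold N1, N2. split; unfold det; field; exact Hdet. }
      destruct (Hrec a b) as [R1 R2].
      destruct (Hrec (phi1 (f true) (f false)) (phi2 (f true) (f false))) as [R3 R4].
      rewrite F1, F2 in R1, R2. split; congruence. }
  set (psi := fun w => proj1_sig (constructive_indefinite_description _ (Hsolve w))).
  assert (Hpsi : forall w, V' w -> Bx (psi w) /\
     phi1 (fst (psi w)) (snd (psi w)) = fst w /\ phi2 (fst (psi w)) (snd (psi w)) = snd w).
  { intros w. exact (proj2_sig (constructive_indefinite_description _ (Hsolve w))). }
  (* One estimate gives injectivity of phi and the Lipschitz constant of psi. *)
  assert (Hexp : forall x y x' y', Bx (x, y) -> Bx (x', y') ->
    Rabs (x' - x) + Rabs (y' - y) <=
      2 * (Rabs (N1 (phi1 x' y' - phi1 x y) (phi2 x' y' - phi2 x y)) +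
           Rabs (N2 (phi1 x' y' - phi1 x y) (phi2 x' y' - phi2 x y)))).
  { intros x y x' y' Hz Hz'.
    assert (M1 := L1 _ _ _ _ Hz Hz'). assert (M2 := L2 _ _ _ _ Hz Hz').
    assert (Q1 : x' - x = N1 (phi1 x' y' - phi1 x y) (phi2 x' y' - phi2 x y) + (e1 x' y' - e1 x y))
      by (unfold e1, N1; ring).
    assert (Q2 : y' - y = N2 (phi1 x' y' - phi1 x y) (phi2 x' y' - phi2 x y) + (e2 x' y' - e2 x y))
      by (unfold e2, N2; ring).
    assert (T1 := Rabs_triang (N1 (phi1 x' y' - phi1 x y) (phi2 x' y' - phi2 x y)) (e1 x' y' - e1 x y)).
    assert (T2 := Rabs_triang (N2 (phi1 x' y' - phi1 x y) (phi2 x' y' - phi2 x y)) (e2 x' y' - e2 x y)).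
    rewrite <- Q1 in T1. rewrite <- Q2 in T2.
    generalize (Rabs_pos (x' - x)) (Rabs_pos (y' - y)). lra. }
  assert (Hinj : forall x y x' y', Bx (x, y) -> Bx (x', y') ->
    phi1 x' y' = phi1 x y -> phi2 x' y' = phi2 x y -> x' = x /\ y' = y).
  { intros x y x' y' Hz Hz' E1 E2. assert (Q := Hexp _ _ _ _ Hz Hz').
    rewrite E1, E2, !Rminus_diag in Q. unfold N1, N2 in Q.
    rewrite !Rmult_0_r, Rplus_0_r, Rabs_R0 in Q.
    assert (P1 := Rabs_pos (x' - x)). assert (P2 := Rabs_pos (y' - y)).
    assert (X1 : Rabs (x' - x) = 0) by lra. assert (X2 : Rabs (y' - y) = 0) by lra.
    apply Rabs_eq_0 in X1. apply Rabs_eq_0 in X2. lra. }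
  set (psi1 := fun a b => fst (psi (a, b))). set (psi2 := fun a b => snd (psi (a, b))).
  set (M := Rabs (D / det) + Rabs (- B / det) + Rabs (- C / det) + Rabs (A / det) + 1).
  assert (Hsm : smooth_on V' psi1 /\ smooth_on V' psi2).
  { apply (smooth_inverse Bx V' phi1 phi2 psi1 psi2 (2 * M)); trivial.
    - now apply smooth_subset with W.
    - now apply smooth_subset with W.
    - intros x y Hxy. now apply Hbox.
    - intros a b Hab. unfold psi1, psi2. rewrite <- surjective_pairing. now apply (Hpsi (a, b)).
    - unfold M. generalize (Rabs_pos (D / det)) (Rabs_pos (- B / det)) (Rabs_pos (- C / det))
        (Rabs_pos (A / det)). lra.
    - intros a b a' b' Hab Hab'.
      destruct (Hpsi _ Hab) as (X1 & X2 & X3). destruct (Hpsi _ Hab') as (Y1 & Y2 & Y3).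
      rewrite (surjective_pairing (psi (a, b))) in X1.
      rewrite (surjective_pairing (psi (a', b'))) in Y1.
      assert (Q := Hexp _ _ _ _ X1 Y1). simpl in X2, X3, Y2, Y3.
      rewrite X2, X3, Y2, Y3 in Q.
      fold (psi1 a b) (psi2 a b) (psi1 a' b') (psi2 a' b') in Q.
      set (m := Rmax (Rabs (a' - a)) (Rabs (b' - b))).
      assert (Hm1 : Rabs (a' - a) <= m) by apply Rmax_l.
      assert (Hm2 : Rabs (b' - b) <= m) by apply Rmax_r.
      assert (Hm : 0 <= m) by (apply Rle_trans with (2 := Hm1), Rabs_pos).
      assert (Hlin2 : forall p q, Rabs (p * (a' - a) + q * (b' - b)) <= (Rabs p + Rabs q) * m).
      { intros p q. apply Rle_trans with (1 := Rabs_triang _ _). rewrite !Rabs_mult.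
        rewrite Rmult_plus_distr_r.
        apply Rplus_le_compat; apply Rmult_le_compat_l; trivial; apply Rabs_pos. }
      assert (Q1 := Hlin2 (D / det) (- B / det)). assert (Q2 := Hlin2 (- C / det) (A / det)).
      fold (N1 (a' - a) (b' - b)) in Q1. fold (N2 (a' - a) (b' - b)) in Q2.
      assert (Q3 : Rabs (psi1 a' b' - psi1 a b) + Rabs (psi2 a' b' - psi2 a b) <= 2 * M * m)
        by (unfold M; nra).
      generalize (Rabs_pos (psi1 a' b' - psi1 a b)) (Rabs_pos (psi2 a' b' - psi2 a b)). lra. }
  exists V, V', psi1, psi2. split; [|split].
  - repeat split; try tauto.
    + apply smooth_subset with W; trivial. now intros z [Hz _]; apply HBW.
    + apply smooth_subset with W; trivial. now intros z [Hz _]; apply HBW.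
    + apply H.
    + apply H.
    + destruct H as [Hz Hw]. simpl in Hw. destruct (Hpsi _ Hw) as (X1 & X2 & X3).
      rewrite (surjective_pairing (psi _)) in X1.
      apply (Hinj _ _ _ _ Hz X1 X2 X3).
    + destruct H as [Hz Hw]. simpl in Hw. destruct (Hpsi _ Hw) as (X1 & X2 & X3).
      rewrite (surjective_pairing (psi _)) in X1.
      apply (Hinj _ _ _ _ Hz X1 X2 X3).
    + destruct (Hpsi _ H) as (X1 & X2 & X3). apply X1.
    + destruct (Hpsi _ H) as (X1 & X2 & X3). apply X1.
    + destruct (Hpsi _ H) as (X1 & X2 & X3). simpl in *. unfold psi1, psi2.
      simpl. rewrite X2, X3. apply H.
    + destruct (Hpsi _ H) as (X1 & X2 & X3). simpl in *. unfold psi1, psi2.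
      simpl. rewrite X2, X3. apply H.
    + now apply (Hpsi (x, y)).
    + now apply (Hpsi (x, y)).
  - split; [now apply box_center|]. split; simpl; rewrite Rminus_diag, Rabs_R0; lra.
  - intros z [Hz _]. now apply HBW.
Qed.

(** * Integrals with a parameter *)

Lemma RInt_bound (g : R -> R) (a b K : R) :
  (forall t, Rmin a b <= t <= Rmax a b -> continuous g t) ->
  (forall t, Rmin a b <= t <= Rmax a b -> Rabs (g t) <= K) ->
  Rabs (RInt g a b) <= K * Rabs (b - a).
Proof.
  intros Hc Hb. assert (Hex := ex_RInt_continuous g a b Hc).
  destruct (Rle_dec a b) as [Hab|Hab].
  - rewrite (Rabs_pos_eq (b - a)) by lra. rewrite Rmult_comm.
    apply abs_RInt_le_const; trivial.
    intros t Ht. apply Hb. rewrite Rmin_left, Rmax_right; lra.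
  - rewrite <- (opp_RInt_swap g b a) by now apply ex_RInt_swap.
    change (Rabs (- RInt g b a) <= K * Rabs (b - a)).
    rewrite Rabs_Ropp, (Rabs_left (b - a)), Rmult_comm by lra.
    replace (- (b - a)) with (a - b) by ring.
    apply abs_RInt_le_const; [lra | now apply ex_RInt_swap|].
    intros t Ht. apply Hb. rewrite Rmin_right, Rmax_left; lra.
Qed.

Lemma continuous_comp_2d (h : R -> R -> R) (f g : R -> R) (t : R) :
  continuity_2d_pt h (f t) (g t) -> continuous f t -> continuous g t ->
  continuous (fun s => h (f s) (g s)) t.
Proof.
  intros Hh Hf Hg. apply continuous_comp_2; trivial.
  now apply continuity_2d_pt_filterlim in Hh.
Qed.

Lemma is_derive_RInt_upper (g : R -> R) (a x : R) :
  locally x (fun z => forall t, Rmin a z <= t <= Rmax a z -> continuous g t) ->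
  is_derive (fun z => RInt g a z) x (g x).
Proof.
  intros Hc. apply (is_derive_RInt g (fun z => RInt g a z) a).
  - apply filter_imp with (2 := Hc). intros z Hz.
    apply (RInt_correct (V := R_CompleteNormedModule)), (ex_RInt_continuous g), Hz.
  - apply (locally_singleton _ _ Hc). split; [apply Rmin_r | apply Rmax_r].
Qed.

Lemma box_segment (u v r x y t : R) :
  box u v r (x, y) -> Rmin u x <= t <= Rmax u x -> box u v r (t, y).
Proof.
  intros [Hx Hy] Ht. split; trivial. simpl in *.
  apply between_Rabs with (3 := Ht); trivial.
  rewrite Rminus_diag, Rabs_R0. apply Rle_lt_trans with (2 := Hx), Rabs_pos.
Qed.

Lemma continuous_fst_slice (h : R -> R -> R) (x y : R) :
  continuity_2d_pt h x y -> continuous (fun t => h t y) x.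
Proof.
  intros Hh. apply (continuous_comp_2d h (fun t => t) (fun _ => y)); trivial.
  - apply continuous_id.
  - apply continuous_const.
Qed.

(** The difference of two values is an integral over the short interval between
    the upper bounds, where h is bounded, plus an integral over the fixed
    interval, where h varies little with y, uniformly by compactness. *)
Lemma continuity_RInt_partial (h : R -> R -> R) (u v r : R) :
  (forall x y, box u v r (x, y) -> continuity_2d_pt h x y) ->
  forall x y, box u v r (x, y) ->
    continuity_2d_pt (fun x y => RInt (fun t => h t y) u x) x y.
Proof.
  intros Hh x y Hxy eps.
  assert (He1 : 0 < eps / (2 * (Rabs (x - u) + 1))).
  { apply Rdiv_lt_0_compat; [apply cond_pos|]. generalize (Rabs_pos (x - u)). lra. }
  destruct (uniform_continuity_2d_1d h (Rmin u x) (Rmax u x) y) with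
    (eps := mkposreal _ He1) as [d Hd].
  { intros t Ht. apply Hh. now apply box_segment with x. }
  simpl in Hd.
  set (K := Rabs (h x y) + 1).
  assert (HK : 0 < K) by (unfold K; generalize (Rabs_pos (h x y)); lra).
  destruct (locally_2d_and _ _ x y (Hh x y Hxy (mkposreal 1 Rlt_0_1))
     (open_locally_2d _ _ _ (open_box u v r) Hxy)) as [d' Hd']. simpl in Hd'.
  assert (He2 : 0 < Rmin (eps / (2 * K)) (Rmin d d')).
  { repeat apply Rmin_glb_lt; try apply cond_pos.
    apply Rdiv_lt_0_compat; [apply cond_pos | lra]. }
  exists (mkposreal _ He2). simpl. intros x' y' Hx' Hy'.
  apply Rmin_Rgt in Hx'. destruct Hx' as [Hx1 Hx2]. apply Rmin_Rgt in Hx2.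
  apply Rmin_Rgt in Hy'. destruct Hy' as [Hy1 Hy2]. apply Rmin_Rgt in Hy2.
  assert (Hbox' : forall t, Rmin x x' <= t <= Rmax x x' ->
            Rabs (h t y' - h x y) < 1 /\ box u v r (t, y')).
  { intros t Ht. apply Hd'; [|tauto].
    apply between_Rabs with (3 := Ht); [rewrite Rminus_diag, Rabs_R0; apply cond_pos | tauto]. }
  assert (Cb : forall z, box u v r (x, z) ->
      forall t, Rmin u x <= t <= Rmax u x -> continuous (fun t => h t z) t).
  { intros z Hz t Ht. apply continuous_fst_slice, Hh. now apply box_segment with x. }
  assert (Hxy' : box u v r (x, y')).
  { apply Hbox'. split; [apply Rmin_l | apply Rmax_l]. }
  assert (Cx : forall t, Rmin x x' <= t <= Rmax x x' -> continuous (fun t => h t y') t).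
  { intros t Ht. apply continuous_fst_slice, Hh. now apply Hbox'. }
  rewrite <- (RInt_Chasles (fun t => h t y') u x x')
    by (apply ex_RInt_continuous; auto).
  assert (E : RInt (fun t => h t y') u x - RInt (fun t => h t y) u x
            = RInt (fun t => h t y' - h t y) u x).
  { symmetry. apply (RInt_minus (fun t => h t y') (fun t => h t y));
      apply ex_RInt_continuous; auto. }
  change (plus (RInt (fun t => h t y') u x) (RInt (fun t => h t y') x x'))
    with (RInt (fun t => h t y') u x + RInt (fun t => h t y') x x').
  replace (_ + _ - _) with ((RInt (fun t => h t y') u x - RInt (fun t => h t y) u x)
     + RInt (fun t => h t y') x x') by ring.
  rewrite E.
  assert (B1 : Rabs (RInt (fun t => h t y' - h t y) u x)
               <= eps / (2 * (Rabs (x - u) + 1)) * Rabs (x - u)).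
  { apply RInt_bound.
    - intros t Ht. apply (continuous_minus (fun t => h t y') (fun t => h t y)); auto.
    - intros t Ht. left. apply Hd; trivial.
      + generalize (cond_pos d). lra.
      + destruct Hy2 as [Hy2 _]. apply Rabs_def2 in Hy2. lra.
      + rewrite Rminus_diag, Rabs_R0. apply cond_pos. }
  assert (B2 : Rabs (RInt (fun t => h t y') x x') <= K * Rabs (x' - x)).
  { apply RInt_bound; trivial. intros t Ht. destruct (Hbox' t Ht) as [Hb _].
    unfold K. replace (h t y') with ((h t y' - h x y) + h x y) by ring.
    apply Rle_trans with (1 := Rabs_triang _ _). lra. }
  assert (B3 : eps / (2 * (Rabs (x - u) + 1)) * Rabs (x - u) <= eps / 2).
  { replace (eps / 2) with (eps / (2 * (Rabs (x - u) + 1)) * (Rabs (x - u) + 1))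
      by (field; generalize (Rabs_pos (x - u)); lra).
    apply Rmult_le_compat_l; lra. }
  assert (B4 : K * Rabs (x' - x) < eps / 2).
  { replace (eps / 2) with (K * (eps / (2 * K))) by (field; lra).
    apply Rmult_lt_compat_l; trivial. }
  apply Rle_lt_trans with (1 := Rabs_triang _ _). lra.
Qed.

Lemma is_derive_RInt_partial (h : R -> R -> R) (u v r x y : R) :
  Cn (box u v r) 1 h -> box u v r (x, y) ->
  is_derive (fun z => RInt (fun t => h t z) u x) y (RInt (fun t => D2 h t y) u x).
Proof.
  intros Hh Hxy.
  assert (HB := open_box u v r).
  assert (Hl : locally y (fun z => box u v r (x, z))).
  { apply (locally_2d_1d_const_x (fun a b => box u v r (a, b))).
    now apply open_locally_2d. }
  apply (is_derive_RInt_param (fun z t => h t z)).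
  - apply filter_imp with (2 := Hl). intros z Hz t Ht. exists (D2 h t z).
    apply (differentiable_pt_lim_partials h t z (D1 h t z)).
    apply (Cn_differentiable (box u v r) 0); trivial. now apply box_segment with x.
  - intros t Ht. change (continuity_2d_pt (fun a b => D2 h b a) y t).
    apply (continuity_2d_pt_comp (fun _ b => b) (fun a _ => a) (D2 h)).
    + apply (Cn_continuity (box u v r) 0); [now apply Cn_D | now apply box_segment with x].
    + apply continuity_2d_pt_id2.
    + apply continuity_2d_pt_id1.
  - apply filter_imp with (2 := Hl). intros z Hz.
    apply (ex_RInt_continuous (fun t => h t z)).
    intros t Ht. apply (continuous_fst_slice h).
    apply (Cn_continuity (box u v r) 1); trivial. now apply box_segment with x.
Qed.

Lemma is_derive_RInt_slice (h : R -> R -> R) (u v r x y : R) :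
  (forall x y, box u v r (x, y) -> continuity_2d_pt h x y) -> box u v r (x, y) ->
  is_derive (fun z => RInt (fun t => h t y) u z) x (h x y).
Proof.
  intros Hh Hxy. apply (is_derive_RInt_upper (fun t => h t y)).
  assert (Hl : locally x (fun z => box u v r (z, y))).
  { apply (locally_2d_1d_const_y (fun a b => box u v r (a, b))).
    apply open_locally_2d; trivial. apply open_box. }
  apply filter_imp with (2 := Hl). intros z Hz t Ht.
  apply continuous_fst_slice, Hh. now apply box_segment with z.
Qed.

(** The partial derivatives of the integral are h and the integral of the same
    kind of the y-derivative of h, so the degrees of regularity follow one
    another. *)
Lemma Cn_RInt (u v r : R) (n : nat) (h : R -> R -> R) :
  Cn (box u v r) n h -> Cn (box u v r) n (fun x y => RInt (fun t => h t y) u x).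
Proof.
  revert h. induction n as [|n IH]; intros h Hh.
  - apply Cn_0. apply continuity_RInt_partial.
    intros x y Hxy. now apply (Cn_continuity (box u v r) 0).
  - assert (Hh1 : Cn (box u v r) 1 h) by (apply Cn_le with (2 := Hh); lia).
    assert (Hc : forall x y, box u v r (x, y) -> continuity_2d_pt h x y).
    { intros x y Hxy. now apply (Cn_continuity (box u v r) 1). }
    apply Cn_succ with h (fun x y => RInt (fun t => D2 h t y) u x).
    + apply open_box.
    + intros x y Hxy.
      apply (differentiable_pt_lim_of_partials (box u v r)); auto using open_box.
      * intros a b Hab. now apply is_derive_RInt_slice with v r.
      * now apply is_derive_RInt_partial with v r.
    + apply Cn_le with (2 := Hh). lia.
    + now apply IH, Cn_D.
Qed.

(** The Poincare lemma on a box: the potential is the integral of the form from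
    the centre along a vertical and then a horizontal segment. *)
Lemma closed_form_potential (u v r : R) (w1 w2 : R -> R -> R) :
  smooth_on (box u v r) w1 -> smooth_on (box u v r) w2 ->
  (forall x y, box u v r (x, y) -> D2 w1 x y = D1 w2 x y) ->
  exists phi, smooth_on (box u v r) phi /\
    forall x y, box u v r (x, y) -> D1 phi x y = w1 x y /\ D2 phi x y = w2 x y.
Proof.
  intros S1 S2 Hclosed. assert (HB := open_box u v r).
  set (phi := fun x y => RInt (fun t => w1 t y) u x + RInt (fun t => w2 u t) v y).
  assert (Hc1 : forall x y, box u v r (x, y) -> continuity_2d_pt w1 x y)
    by (intros x y Hxy; now apply (smooth_continuity (box u v r))).
  assert (Hd : forall x y, box u v r (x, y) ->
            differentiable_pt_lim phi x y (w1 x y) (w2 x y)).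
  { intros x y Hxy.
    apply (differentiable_pt_lim_of_partials (box u v r)); auto.
    - intros a b Hab. rewrite <- (Rplus_0_r (w1 a b)).
      apply (is_derive_plus (fun t => RInt (fun s => w1 s b) u t)
               (fun _ => RInt (fun t => w2 u t) v b)).
      + now apply is_derive_RInt_slice with v r.
      + apply (is_derive_const (RInt (fun t => w2 u t) v b)).
    - assert (E : RInt (fun t => D2 w1 t y) u x = w2 x y - w2 u y).
      { transitivity (RInt (Derive (fun t => w2 t y)) u x).
        - apply RInt_ext. intros t Ht. apply Hclosed. apply box_segment with x; trivial. lra.
        - apply (RInt_Derive (fun t => w2 t y)).
          + intros t Ht. exists (D1 w2 t y).
            apply (differentiable_pt_lim_partials w2 t y _ (D2 w2 t y)).
            apply (smooth_differentiable (box u v r)); trivial.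
            now apply box_segment with x.
          + intros t Ht. apply (continuous_fst_slice (D1 w2)).
            apply (smooth_continuity (box u v r)); [now apply smooth_D | now apply box_segment with x]. }
      replace (w2 x y) with (RInt (fun t => D2 w1 t y) u x + w2 u y) by (rewrite E; ring).
      apply (is_derive_plus (fun z => RInt (fun t => w1 t z) u x)
               (fun z => RInt (fun t => w2 u t) v z)).
      + apply is_derive_RInt_partial with v r; trivial. now apply smooth_Cn.
      + apply (is_derive_RInt_upper (fun t => w2 u t)).
        assert (Hl : locally y (fun z => box u v r (x, z))).
        { apply (locally_2d_1d_const_x (fun a b => box u v r (a, b))).
          now apply open_locally_2d. }
        apply filter_imp with (2 := Hl). intros z Hz t Ht.
        apply (continuous_comp_2d w2 (fun _ => u) (fun t => t)).
        * apply (smooth_continuity (box u v r)); trivial.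
          destruct Hz as [Hz1 Hz2]. simpl in *.
          assert (Hr : 0 < r) by (apply Rle_lt_trans with (2 := Hz1), Rabs_pos).
          split; simpl; [rewrite Rminus_diag, Rabs_R0; trivial|].
          apply between_Rabs with (3 := Ht); trivial. rewrite Rminus_diag, Rabs_R0; trivial.
        * apply continuous_const.
        * apply continuous_id. }
  exists phi. split.
  - apply (Cn_bootstrap _ phi w1 w2); trivial.
    intros n _. auto using smooth_Cn.
  - intros x y Hxy. apply differentiable_pt_lim_D, Hd, Hxy.
Qed.

(** * The flow of a vector field *)

Ltac R_ring := match goal with |- @eq _ ?a ?b => change (@eq R a b); first [ring | symmetry; ring] end.

Definition clamp (c r t : R) : R := Rmax (c - r) (Rmin (c + r) t).

Lemma clamp_near (c r t : R) : 0 <= r -> Rabs (clamp c r t - c) <= r.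
Proof.
  intros Hr. unfold clamp, Rmax, Rmin. apply Rabs_le.
  destruct (Rle_dec (c + r) t); destruct (Rle_dec _ _); lra.
Qed.

Lemma clamp_id (c r t : R) : Rabs (t - c) <= r -> clamp c r t = t.
Proof.
  intros Ht. apply Rabs_le_between in Ht. unfold clamp, Rmax, Rmin.
  destruct (Rle_dec (c + r) t); destruct (Rle_dec _ _); lra.
Qed.

Lemma clamp_contracts (c r s t : R) : Rabs (clamp c r s - clamp c r t) <= Rabs (s - t).
Proof.
  unfold clamp, Rmax, Rmin, Rabs.
  repeat (destruct (Rle_dec _ _) || destruct (Rcase_abs _)); lra.
Qed.

Lemma clamp_between (c r t : R) :
  0 <= r -> forall z, Rmin c (clamp c r t) <= z <= Rmax c (clamp c r t) -> Rabs (z - c) <= r.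
Proof.
  intros Hr z. generalize (clamp_near c r t Hr). intros H. apply Rabs_le_between in H.
  unfold Rmin, Rmax. destruct (Rle_dec _ _); intros; apply Rabs_le; lra.
Qed.

Lemma lipschitz_continuous (f : R -> R) (M x : R) :
  (forall s t, Rabs (f s - f t) <= M * Rabs (s - t)) -> continuous f x.
Proof.
  intros Hf. apply continuity_pt_filterlim. intros eps He.
  assert (HM : 0 < Rabs M + 1) by (generalize (Rabs_pos M); lra).
  exists (eps / (Rabs M + 1)). split; [now apply Rdiv_lt_0_compat|].
  intros t [_ Ht]. simpl in *. unfold Rdist in *.
  apply Rle_lt_trans with (1 := Hf t x).
  apply Rle_lt_trans with ((Rabs M + 1) * Rabs (t - x)).
  - apply Rmult_le_compat_r; [apply Rabs_pos|]. generalize (Rle_abs M). lra.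
  - replace eps with ((Rabs M + 1) * (eps / (Rabs M + 1))) by (field; lra).
    now apply Rmult_lt_compat_l.
Qed.

(** Stopping the integral at the ends of the interval makes a solution defined
    on the whole line, so that no estimate below needs a restriction on x. *)
Lemma picard (B : R -> R -> R) (u s d M L : R) :
  0 <= d -> L * d <= / 2 ->
  (forall t y, continuity_2d_pt B t y) ->
  (forall t y, Rabs (B t y) <= M) ->
  (forall t y y', Rabs (B t y - B t y') <= L * Rabs (y - y')) ->
  exists Y : R -> R,
    (forall x, Y x = s + RInt (fun t => B t (Y t)) u (clamp u d x)) /\
    (forall x x', Rabs (Y x - Y x') <= M * Rabs (x - x')) /\
    (forall x, Rabs (Y x - s) <= M * d).
Proof.
  intros Hd HLd Hc HM HL.
  assert (HM0 : 0 <= M) by (apply Rle_trans with (2 := HM 0 0), Rabs_pos).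
  assert (HL0 : 0 <= L).
  { generalize (HL 0 1 0) (Rabs_pos (B 0 1 - B 0 0)).
    rewrite Rminus_0_r, Rabs_R1. lra. }
  assert (Hcl : forall x, Rabs (clamp u d x - u) <= d) by (intros; now apply clamp_near).
  set (P := fun Y : R -> R => (forall x x', Rabs (Y x - Y x') <= M * Rabs (x - x')) /\
                              (forall x, Rabs (Y x - s) <= M * d)).
  set (T := fun (Y : R -> R) x => s + RInt (fun t => B t (Y t)) u (clamp u d x)).
  assert (HB : forall Y, P Y -> forall t, continuous (fun t => B t (Y t)) t).
  { intros Y [PY _] t. apply (continuous_comp_2d B (fun t => t)); trivial.
    - apply continuous_id.
    - now apply lipschitz_continuous with M. }
  destruct (contraction_fixpoint R P T (fun _ => s) (2 * (M * d))) as (Y & [P1 P2] & E).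
  - split; intros; rewrite Rminus_diag, Rabs_R0.
    + apply Rmult_le_pos; trivial. apply Rabs_pos.
    + now apply Rmult_le_pos.
  - intros Y PY. split; unfold T.
    + intros x x'.
      assert (E : RInt (fun t => B t (Y t)) u (clamp u d x)
                = RInt (fun t => B t (Y t)) u (clamp u d x')
                + RInt (fun t => B t (Y t)) (clamp u d x') (clamp u d x)).
      { symmetry. apply (RInt_Chasles (fun t => B t (Y t)));
          apply (ex_RInt_continuous (fun t => B t (Y t))); intros; now apply HB. }
      rewrite E.
      replace (s + _ - _) with (RInt (fun t => B t (Y t)) (clamp u d x') (clamp u d x)) by R_ring.
      apply Rle_trans with (M * Rabs (clamp u d x - clamp u d x')).
      * apply RInt_bound; intros; auto.
      * apply Rmult_le_compat_l; trivial. apply clamp_contracts.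
    + intros x. replace (s + _ - s) with (RInt (fun t => B t (Y t)) u (clamp u d x)) by R_ring.
      apply Rle_trans with (M * Rabs (clamp u d x - u)).
      * apply RInt_bound; intros; auto.
      * now apply Rmult_le_compat_l.
  - intros Y Z [_ P1] [_ P2] x.
    replace (Y x - Z x) with ((Y x - s) - (Z x - s)) by ring.
    apply Rle_trans with (1 := Rabs_triang _ _). rewrite Rabs_Ropp.
    generalize (P1 x) (P2 x). lra.
  - intros Y Z K PY PZ HK x. unfold T.
    assert (HK0 : 0 <= K) by (apply Rle_trans with (2 := HK 0), Rabs_pos).
    assert (E : RInt (fun t => B t (Y t)) u (clamp u d x) - RInt (fun t => B t (Z t)) u (clamp u d x)
              = RInt (fun t => B t (Y t) - B t (Z t)) u (clamp u d x)).
    { symmetry. apply (RInt_minus (fun t => B t (Y t)) (fun t => B t (Z t)));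
        [apply (ex_RInt_continuous (fun t => B t (Y t)))
        |apply (ex_RInt_continuous (fun t => B t (Z t)))]; intros; now apply HB. }
    replace (s + _ - _) with (RInt (fun t => B t (Y t) - B t (Z t)) u (clamp u d x))
      by (rewrite <- E; R_ring).
    apply Rle_trans with ((L * K) * Rabs (clamp u d x - u)).
    + apply RInt_bound; intros t _.
      * apply (continuous_minus (fun t => B t (Y t)) (fun t => B t (Z t))); now apply HB.
      * apply Rle_trans with (1 := HL _ _ _). now apply Rmult_le_compat_l.
    + apply Rle_trans with ((L * K) * d).
      * apply Rmult_le_compat_l; trivial. now apply Rmult_le_pos.
      * replace (K / 2) with (/ 2 * K) by field.
        replace (L * K * d) with (L * d * K) by ring. now apply Rmult_le_compat_r.
  - intros Y HY. split.
    + intros x x'. apply le_epsilon. intros eps He.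
      destruct (HY (eps / 2)) as (Z & [P1 _] & HZ); [lra|].
      replace (Y x - Y x') with ((Z x - Z x') - ((Z x - Y x) - (Z x' - Y x'))) by ring.
      apply Rle_trans with (1 := Rabs_triang _ _). rewrite Rabs_Ropp.
      generalize (P1 x x') (HZ x) (HZ x') (Rabs_triang (Z x - Y x) (- (Z x' - Y x'))).
      rewrite Rabs_Ropp. unfold Rminus. lra.
    + intros x. apply le_epsilon. intros eps He.
      destruct (HY eps) as (Z & [_ P2] & HZ); [lra|].
      replace (Y x - s) with ((Z x - s) - (Z x - Y x)) by ring.
      apply Rle_trans with (1 := Rabs_triang _ _). rewrite Rabs_Ropp.
      generalize (P2 x) (HZ x). lra.
  - exists Y. repeat split; trivial. intros x. symmetry. apply E.
Qed.

Lemma is_derive_quadratic_remainder (f : R -> R) (x l C : R) (d : posreal) :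
  (forall y, Rabs (y - x) < d -> Rabs (f y - f x - l * (y - x)) <= C * (y - x) ^ 2) ->
  is_derive f x l.
Proof.
  intros Hf. apply is_derive_Reals. intros eps He.
  assert (HC : 0 < Rabs C + 1) by (generalize (Rabs_pos C); lra).
  assert (Hd : 0 < Rmin d (eps / (Rabs C + 1))).
  { apply Rmin_glb_lt; [apply cond_pos | now apply Rdiv_lt_0_compat]. }
  exists (mkposreal _ Hd). simpl. intros k Hk Hkd. apply Rmin_Rgt in Hkd. destruct Hkd as [H1 H2].
  assert (Hk' : 0 < Rabs k) by now apply Rabs_pos_lt.
  specialize (Hf (x + k)). replace (x + k - x) with k in Hf by ring. specialize (Hf H1).
  replace ((f (x + k) - f x) / k - l) with ((f (x + k) - f x - l * k) / k) by (now field).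
  unfold Rdiv. rewrite Rabs_mult, Rabs_inv.
  apply Rmult_lt_reg_r with (Rabs k); trivial.
  rewrite Rmult_assoc, Rinv_l, Rmult_1_r by lra.
  apply Rle_lt_trans with (1 := Hf).
  rewrite <- (pow2_abs k).
  replace (C * Rabs k ^ 2) with (C * Rabs k * Rabs k) by ring.
  apply Rmult_lt_compat_r; trivial.
  apply Rle_lt_trans with ((Rabs C + 1) * Rabs k).
  - apply Rmult_le_compat_r; [lra|]. generalize (Rle_abs C). lra.
  - replace eps with ((Rabs C + 1) * (eps / (Rabs C + 1))) by (field; lra).
    now apply Rmult_lt_compat_l.
Qed.

Lemma locally_bounded (h : R -> R -> R) (x y : R) :
  continuity_2d_pt h x y ->
  locally_2d (fun a b => Rabs (h a b) <= Rabs (h x y) + 1) x y.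
Proof.
  intros Hh. generalize (Hh (mkposreal 1 Rlt_0_1)).
  apply locally_2d_impl, locally_2d_forall. simpl. intros a b Hab.
  replace (h a b) with ((h a b - h x y) + h x y) by ring.
  apply Rle_trans with (1 := Rabs_triang _ _). lra.
Qed.

Lemma taylor_on_box (h : R -> R -> R) (u v r k : R) :
  smooth_on (box u v r) h ->
  (forall x y, box u v r (x, y) -> Rabs (D1 (D2 h) x y) <= k /\ Rabs (D2 (D2 h) x y) <= k) ->
  forall x y y', box u v r (x, y) -> box u v r (x, y') ->
    Rabs (h x y' - h x y - D2 h x y * (y' - y)) <= k * (y' - y) ^ 2.
Proof.
  intros Hh Hk x y y' Hy Hy'.
  assert (Hbox : forall t, Rmin y y' <= t <= Rmax y y' -> box u v r (x, t)).
  { intros t Ht. destruct Hy as [Hx Hy]. destruct Hy' as [_ Hy']. split; trivial.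
    now apply between_Rabs with (3 := Ht). }
  destruct (MVT_segment (fun t => h x t) (fun t => D2 h x t) y y') as (t & Ht & E).
  { intros t Ht. refine (proj2 (differentiable_pt_lim_partials h x t (D1 h x t) _ _)).
    apply (smooth_differentiable (box u v r)); auto using open_box. }
  rewrite E, <- Rmult_minus_distr_r, Rabs_mult.
  assert (Q := lipschitz_on_box (D2 h) u v r k (proj2 (smooth_D _ _ Hh)) Hk x y x t Hy (Hbox t Ht)).
  rewrite Rminus_diag, Rabs_R0, Rplus_0_l in Q.
  assert (k0 : 0 <= k) by (apply Rle_trans with (2 := proj1 (Hk x y Hy)), Rabs_pos).
  assert (Q' : Rabs (t - y) <= Rabs (y' - y)).
  { revert Ht. unfold Rmin, Rmax. destruct (Rle_dec y y'); intros.
    - rewrite !Rabs_pos_eq; lra.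
    - rewrite !Rabs_left1; lra. }
  replace (k * (y' - y) ^ 2) with (k * Rabs (y' - y) * Rabs (y' - y))
    by (rewrite <- (pow2_abs (y' - y)); ring).
  apply Rmult_le_compat_r; [apply Rabs_pos|].
  apply Rle_trans with (1 := Q). now apply Rmult_le_compat_l.
Qed.

(** The solution of y' = b(x, y), y(u) = s, as a function of x and s.  The
    derivative in s is the solution of the linearized equation, which for a
    scalar equation is the exponential of an integral along the solution. *)
Theorem flow_smooth (W : R * R -> Prop) (b : R -> R -> R) (u v : R) :
  open W -> smooth_on W b -> W (u, v) ->
  exists d Psi, 0 < d /\ smooth_on (box u v d) Psi /\ Psi u v = v /\
    forall x s, box u v d (x, s) ->
      W (x, Psi x s) /\ D1 Psi x s = b x (Psi x s) /\ 0 < D2 Psi x s.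
Proof.
  intros HW Sb Huv.
  destruct (smooth_D _ _ Sb) as [Sb1 Sb2]. destruct (smooth_D _ _ Sb2) as [Sb21 Sb22].
  assert (Hex : exists L, 0 < L /\ locally_2d (fun x y => W (x, y) /\ Rabs (b x y) <= L /\
     (Rabs (D1 b x y) <= L /\ Rabs (D2 b x y) <= L) /\
     (Rabs (D1 (D2 b) x y) <= L /\ Rabs (D2 (D2 b) x y) <= L)) u v).
  { set (K := fun h : R -> R -> R => Rabs (h u v) + 1).
    assert (HK : forall h, 0 < K h) by (intros h; unfold K; generalize (Rabs_pos (h u v)); lra).
    set (L := K b + K (D1 b) + K (D2 b) + K (D1 (D2 b)) + K (D2 (D2 b))).
    assert (HL : forall h, smooth_on W h -> K h <= L -> locally_2d (fun x y => Rabs (h x y) <= L) u v).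
    { intros h Sh Hh. generalize (locally_bounded h u v (smooth_continuity _ _ _ _ Sh Huv)).
      apply locally_2d_impl, locally_2d_forall. intros x y Hxy. fold (K h) in Hxy. lra. }
    generalize (HK b) (HK (D1 b)) (HK (D2 b)) (HK (D1 (D2 b))) (HK (D2 (D2 b))). intros.
    exists L. split; [unfold L; lra|].
    repeat apply locally_2d_and; try (apply HL; trivial; unfold L; lra).
    now apply open_locally_2d. }
  destruct Hex as (L & HL & Hloc).
  destruct (locally_2d_box _ _ _ Hloc) as (r & Hr & Hbox). clear Hloc.
  (* Outside the box of radius r / 2 the field is replaced by its value at the
     nearest point of that box.  The Lipschitz constant L is kept, and as d and
     L * d are at most r / 4, solutions that start at s with |s - v| <= d do not
     feel the replacement. *)
  set (r2 := r / 2). set (Bx := box u v r).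
  assert (HBW : forall z, Bx z -> W z) by (intros [x y] Hz; now apply Hbox).
  assert (SB : forall h, smooth_on W h -> smooth_on Bx h) by (intros h; now apply smooth_subset).
  assert (Hcl : forall t y, Bx (clamp u r2 t, clamp v r2 y)).
  { intros t y.
    split; simpl; (apply Rle_lt_trans with r2; [apply clamp_near|]); unfold r2; lra. }
  assert (Hclc : forall c t, continuous (clamp c r2) t).
  { intros c t. apply lipschitz_continuous with 1. intros. rewrite Rmult_1_l. apply clamp_contracts. }
  assert (Hcc : forall h, smooth_on W h -> forall t y,
             continuity_2d_pt (fun t y => h (clamp u r2 t) (clamp v r2 y)) t y).
  { intros h Sh t y.
    apply (continuity_2d_pt_comp (fun t _ => clamp u r2 t) (fun _ y => clamp v r2 y) h).
    - apply (smooth_continuity Bx); auto.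
    - apply (continuity_1d_2d_pt_comp (clamp u r2) (fun t _ => t)).
      + apply continuity_pt_filterlim, Hclc.
      + apply continuity_2d_pt_id1.
    - apply (continuity_1d_2d_pt_comp (clamp v r2) (fun _ y => y)).
      + apply continuity_pt_filterlim, Hclc.
      + apply continuity_2d_pt_id2. }
  set (B := fun t y => b (clamp u r2 t) (clamp v r2 y)).
  set (d := Rmin (r / 4) (Rmin (r / (4 * L)) (/ (2 * L)))).
  assert (Hd : 0 < d).
  { repeat apply Rmin_glb_lt; try apply Rdiv_lt_0_compat; try apply Rinv_0_lt_compat; lra. }
  assert (Hd1 : d <= r / 4) by apply Rmin_l.
  assert (Hd2 : L * d <= r / 4).
  { replace (r / 4) with (L * (r / (4 * L))) by (field; lra).
    apply Rmult_le_compat_l; [lra|]. apply Rle_trans with (1 := Rmin_r _ _), Rmin_l. }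
  assert (Hd3 : L * d <= / 2).
  { replace (/ 2) with (L * (/ (2 * L))) by (field; lra).
    apply Rmult_le_compat_l; [lra|]. apply Rle_trans with (1 := Rmin_r _ _), Rmin_r. }
  assert (HBM : forall t y, Rabs (B t y) <= L) by (intros t y; apply (Hbox _ _ (Hcl t y))).
  assert (HBL : forall t y y', Rabs (B t y - B t y') <= L * Rabs (y - y')).
  { intros t y y'. unfold B.
    apply Rle_trans with (L * (Rabs (clamp u r2 t - clamp u r2 t) +
                               Rabs (clamp v r2 y - clamp v r2 y'))).
    - apply lipschitz_on_box with u v r; try apply Hcl; auto.
      intros x z Hxz. now apply Hbox.
    - rewrite Rminus_diag, Rabs_R0, Rplus_0_l.
      apply Rmult_le_compat_l; [lra | apply clamp_contracts]. }
  assert (Hpic : forall s, exists Y : R -> R,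
    (forall x, Y x = s + RInt (fun t => B t (Y t)) u (clamp u d x)) /\
    (forall x x', Rabs (Y x - Y x') <= L * Rabs (x - x')) /\
    (forall x, Rabs (Y x - s) <= L * d)).
  { intros s. apply picard with L; trivial; [lra|]. now apply Hcc. }
  set (Psi := fun x s => proj1_sig (constructive_indefinite_description _ (Hpic s)) x).
  assert (HPsi : forall s,
    (forall x, Psi x s = s + RInt (fun t => B t (Psi t s)) u (clamp u d x)) /\
    (forall x x', Rabs (Psi x s - Psi x' s) <= L * Rabs (x - x')) /\
    (forall x, Rabs (Psi x s - s) <= L * d)).
  { intros s. exact (proj2_sig (constructive_indefinite_description _ (Hpic s))). }
  clearbody Psi. clear Hpic.
  assert (P1 := fun s => proj1 (HPsi s)). assert (P2 := fun s => proj1 (proj2 (HPsi s))).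
  assert (P3 := fun s => proj2 (proj2 (HPsi s))). clear HPsi.
  assert (Hcd : forall x, Rabs (clamp u d x - u) <= d) by (intros; apply clamp_near; lra).
  assert (PsiC : forall s t, continuous (fun x => Psi x s) t).
  { intros s t. now apply lipschitz_continuous with L. }
  assert (BC : forall s t, continuous (fun t => B t (Psi t s)) t).
  { intros s t. apply (continuous_comp_2d B (fun t => t)); auto using continuous_id.
    now apply Hcc. }
  assert (Lip : forall s s' x, Rabs (Psi x s' - Psi x s) <= 2 * Rabs (s' - s)).
  { intros s s'.
    apply (contraction_bound R (fun x => Psi x s' - Psi x s) _ (Rabs (s' - s) + 2 * (L * d))).
    - intros x. replace (Psi x s' - Psi x s)
        with ((s' - s) + ((Psi x s' - s') - (Psi x s - s))) by ring.
      generalize (Rabs_triang (s' - s) ((Psi x s' - s') - (Psi x s - s)))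
        (Rabs_triang (Psi x s' - s') (- (Psi x s - s))) (P3 s' x) (P3 s x).
      rewrite Rabs_Ropp. unfold Rminus. lra.
    - intros K HK x.
      assert (HK0 : 0 <= K) by (apply Rle_trans with (2 := HK 0), Rabs_pos).
      assert (E : Psi x s' - Psi x s =
        (s' - s) + RInt (fun t => B t (Psi t s') - B t (Psi t s)) u (clamp u d x)).
      { rewrite (P1 s' x), (P1 s x).
        rewrite (RInt_minus (fun t => B t (Psi t s')) (fun t => B t (Psi t s)))
          by (apply (ex_RInt_continuous (V := R_CompleteNormedModule)); auto).
        unfold minus, plus, opp; simpl. R_ring. }
      rewrite E. apply Rle_trans with (1 := Rabs_triang _ _). apply Rplus_le_compat_l.
      apply Rle_trans with ((L * K) * Rabs (clamp u d x - u)).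
      + apply RInt_bound; intros t _.
        * apply (continuous_minus (fun t => B t (Psi t s')) (fun t => B t (Psi t s))); apply BC.
        * apply Rle_trans with (1 := HBL _ _ _). apply Rmult_le_compat_l; [lra | apply HK].
      + apply Rle_trans with ((L * K) * d).
        * apply Rmult_le_compat_l; trivial. apply Rmult_le_pos; lra.
        * replace (K / 2) with (/ 2 * K) by field.
          replace (L * K * d) with (L * d * K) by ring. now apply Rmult_le_compat_r. }
  assert (PsiC2 : forall x s, continuity_2d_pt Psi x s).
  { intros x s eps.
    assert (He : 0 < eps / (L + 2)) by (apply Rdiv_lt_0_compat; [apply cond_pos | lra]).
    exists (mkposreal _ He). simpl. intros x' s' Hx Hs.
    replace (Psi x' s' - Psi x s) with ((Psi x' s' - Psi x s') + (Psi x s' - Psi x s)) by ring.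
    apply Rle_lt_trans with (1 := Rabs_triang _ _).
    apply Rle_lt_trans with (L * Rabs (x' - x) + 2 * Rabs (s' - s)).
    { apply Rplus_le_compat; [apply P2 | apply Lip]. }
    replace (pos eps) with (L * (eps / (L + 2)) + 2 * (eps / (L + 2))) by (field; lra).
    apply Rplus_lt_compat; apply Rmult_lt_compat_l; lra. }
  set (c := fun t s => D2 b (clamp u r2 t) (clamp v r2 (Psi t s))).
  assert (cC2 : forall t s, continuity_2d_pt c t s).
  { intros t s.
    apply (continuity_2d_pt_comp (fun t _ => t) Psi (fun t y => D2 b (clamp u r2 t) (clamp v r2 y)));
      [now apply Hcc | apply continuity_2d_pt_id1 | apply PsiC2]. }
  assert (cC : forall s t, continuous (fun t => c t s) t)
    by (intros s t; now apply continuous_fst_slice).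
  assert (cB : forall t s, Rabs (c t s) <= L) by (intros t s; apply (Hbox _ _ (Hcl t (Psi t s)))).
  set (E := fun x s => exp (RInt (fun t => c t s) u x)).
  assert (dE : forall s x, is_derive (fun x => E x s) x (c x s * E x s)).
  { intros s x. apply (is_derive_comp exp (fun x => RInt (fun t => c t s) u x)).
    - apply is_derive_exp.
    - apply (is_derive_RInt_upper (fun t => c t s)). apply filter_forall. auto. }
  assert (EC : forall s x, continuous (fun x => E x s) x).
  { intros s x. apply (ex_derive_continuous (fun x => E x s)). eexists. apply dE. }
  assert (cEC : forall s x, continuous (fun x => c x s * E x s) x).
  { intros s x. apply (continuous_mult (fun x => c x s) (fun x => E x s)); auto. }
  assert (Eint : forall s x, E x s = 1 + RInt (fun t => c t s * E t s) u x).
  { intros s x.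
    rewrite (is_RInt_unique _ _ _ _ (is_RInt_derive (fun x => E x s) (fun t => c t s * E t s) u x
      (fun t _ => dE s t) (fun t _ => cEC s t))).
    unfold minus, plus, opp; simpl. unfold E at 3. rewrite RInt_point.
    unfold zero; simpl. rewrite exp_0. R_ring. }
  assert (Hreg : forall x s, Rabs (x - u) <= d -> Rabs (s - v) <= d ->
            clamp u r2 x = x /\ clamp v r2 (Psi x s) = Psi x s).
  { intros x s Hx Hs. split; apply clamp_id; unfold r2; [lra|].
    replace (Psi x s - v) with ((Psi x s - s) + (s - v)) by ring.
    apply Rle_trans with (1 := Rabs_triang _ _). generalize (P3 s x). lra. }
  assert (Hin : forall x s, Rabs (x - u) <= d -> Rabs (s - v) <= d -> Bx (x, Psi x s)).
  { intros x s Hx Hs. destruct (Hreg x s Hx Hs) as [E1 E2].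
    rewrite <- E1 at 1. rewrite <- E2. apply Hcl. }
  (* E solves the equation linearized along the solution through s; so the
     remainder below solves the same equation up to an error that is quadratic
     in s' - s by Taylor's formula. *)
  assert (Rem : forall s s', Rabs (s - v) <= d -> Rabs (s' - v) <= d -> forall x,
    Rabs (Psi x s' - Psi x s - (s' - s) * E (clamp u d x) s) <= 2 * (2 * (s' - s) ^ 2)).
  { intros s s' Hs Hs'.
    apply (contraction_bound R (fun x => Psi x s' - Psi x s - (s' - s) * E (clamp u d x) s) _
             (2 * Rabs (s' - s) + Rabs (s' - s) * exp (L * d))).
    - intros x. unfold Rminus at 1. apply Rle_trans with (1 := Rabs_triang _ _).
      rewrite Rabs_Ropp, Rabs_mult.
      apply Rplus_le_compat; [apply Lip|]. apply Rmult_le_compat_l; [apply Rabs_pos|].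
      unfold E. rewrite (Rabs_pos_eq (exp _)) by (left; apply exp_pos).
      assert (Hle : RInt (fun t => c t s) u (clamp u d x) <= L * d).
      { apply Rle_trans with (1 := Rle_abs _).
        apply Rle_trans with (L * Rabs (clamp u d x - u)).
        - apply RInt_bound; auto.
        - apply Rmult_le_compat_l; [lra | apply Hcd]. }
      destruct Hle as [Hlt | ->]; [left; now apply exp_increasing | right; reflexivity].
    - intros K HK x.
      assert (HK0 : 0 <= K) by (apply Rle_trans with (2 := HK 0), Rabs_pos).
      set (g := fun t => B t (Psi t s') - B t (Psi t s) - (s' - s) * (c t s * E t s)).
      assert (Eg : Psi x s' - Psi x s - (s' - s) * E (clamp u d x) s = RInt g u (clamp u d x)).
      { unfold g.
        rewrite (RInt_minus (fun t => B t (Psi t s') - B t (Psi t s))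
                   (fun t => scal (s' - s) (c t s * E t s))).
        - rewrite (RInt_minus (fun t => B t (Psi t s')) (fun t => B t (Psi t s)))
            by (apply (ex_RInt_continuous (V := R_CompleteNormedModule)); auto).
          rewrite (RInt_scal (fun t => c t s * E t s))
            by (apply (ex_RInt_continuous (V := R_CompleteNormedModule)); auto).
          rewrite (P1 s' x), (P1 s x), (Eint s (clamp u d x)).
          unfold minus, plus, opp, scal; simpl. unfold mult; simpl. R_ring.
        - apply (ex_RInt_continuous (V := R_CompleteNormedModule)). intros t _.
          apply (continuous_minus (fun t => B t (Psi t s')) (fun t => B t (Psi t s))); apply BC.
        - apply (ex_RInt_continuous (V := R_CompleteNormedModule)). intros t _.
          apply (continuous_scal_r (s' - s) (fun t => c t s * E t s)), cEC. }
      rewrite Eg.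
      apply Rle_trans with ((L * (4 * (s' - s) ^ 2) + L * K) * Rabs (clamp u d x - u)).
      + apply RInt_bound; intros t Ht.
        * apply (continuous_minus (fun t => B t (Psi t s') - B t (Psi t s))
                   (fun t => scal (s' - s) (c t s * E t s))).
          -- apply (continuous_minus (fun t => B t (Psi t s')) (fun t => B t (Psi t s))); apply BC.
          -- apply (continuous_scal_r (s' - s) (fun t => c t s * E t s)), cEC.
        * apply clamp_between in Ht; [|lra].
          assert (Ht' := Hreg t s Ht Hs). assert (Ht'' := Hreg t s' Ht Hs').
          replace (g t) with ((b t (Psi t s') - b t (Psi t s) - D2 b t (Psi t s) * (Psi t s' - Psi t s))
             + c t s * (Psi t s' - Psi t s - (s' - s) * E (clamp u d t) s)).
          2:{ unfold g, c, B. rewrite (proj1 Ht'), (proj2 Ht'), (proj2 Ht''), (clamp_id u d t Ht). ring. }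
          apply Rle_trans with (1 := Rabs_triang _ _). apply Rplus_le_compat.
          -- apply Rle_trans with (L * (Psi t s' - Psi t s) ^ 2).
             ++ apply taylor_on_box with u v r; try now apply Hin.
                ** now apply SB.
                ** intros x' y' Hxy. now apply Hbox.
             ++ apply Rmult_le_compat_l; [lra|].
                rewrite <- (pow2_abs (Psi t s' - Psi t s)), <- (pow2_abs (s' - s)).
                generalize (Lip s s' t) (Rabs_pos (Psi t s' - Psi t s)). nra.
          -- rewrite Rabs_mult. apply Rmult_le_compat; auto using Rabs_pos.
      + assert (Hsq : 0 <= (s' - s) ^ 2) by apply pow2_ge_0.
        apply Rle_trans with ((L * (4 * (s' - s) ^ 2) + L * K) * d).
        * apply Rmult_le_compat_l; [|apply Hcd].
          generalize (Rmult_le_pos L (4 * (s' - s) ^ 2)) (Rmult_le_pos L K). lra.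
        * replace ((L * (4 * (s' - s) ^ 2) + L * K) * d)
            with ((L * d) * (4 * (s' - s) ^ 2 + K)) by ring.
          apply Rle_trans with (/ 2 * (4 * (s' - s) ^ 2 + K)); [|lra].
          apply Rmult_le_compat_r; lra. }
  assert (HO := open_box u v d).
  assert (Dif : forall x s, box u v d (x, s) ->
            differentiable_pt_lim Psi x s (b x (Psi x s)) (E x s)).
  { intros x s Hxs.
    apply (differentiable_pt_lim_of_partials (box u v d) Psi (fun x s => b x (Psi x s))); trivial.
    - intros a s' [Ha Hs]. simpl in Ha, Hs.
      apply (is_derive_ext_loc (fun t => s' + RInt (fun t => B t (Psi t s')) u t)).
      + destruct (Rabs_lt_open _ _ _ Ha) as [e He]. exists e. intros t Ht.
        rewrite (P1 s' t), clamp_id; trivial. left. now apply He.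
      + replace (b a (Psi a s')) with (0 + B a (Psi a s')).
        2:{ unfold B. destruct (Hreg a s') as [-> ->]; lra. }
        apply (is_derive_plus (fun _ => s') (fun t => RInt (fun t => B t (Psi t s')) u t)).
        * apply (is_derive_const s').
        * apply (is_derive_RInt_upper (fun t => B t (Psi t s'))), filter_forall. auto.
    - destruct Hxs as [Hx Hs]. simpl in Hx, Hs.
      destruct (Rabs_lt_open _ _ _ Hs) as [e He].
      apply (is_derive_quadratic_remainder _ _ _ 4 e). intros s' Hs'.
      assert (Q := Rem s s' (Rlt_le _ _ Hs) (Rlt_le _ _ (He _ Hs')) x).
      rewrite clamp_id in Q by lra. rewrite (Rmult_comm (E x s)). lra.
    - apply (continuity_2d_pt_comp (fun x _ => x) Psi b); auto using continuity_2d_pt_id1.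
      destruct Hxs as [Hx Hs]. apply (smooth_continuity W); trivial.
      apply HBW, Hin; left; assumption. }
  exists d, Psi. split; [exact Hd|]. split; [|split].
  - apply Cn_bootstrap with (fun x s => b x (Psi x s)) E; trivial.
    intros n Cn_Psi.
    assert (Hcomp : forall h, smooth_on W h -> Cn (box u v d) n (fun x s => h x (Psi x s))).
    { intros h Sh. apply (Cn_comp _ W n h (fun x _ => x) Psi); auto using Cn_fst, smooth_Cn.
      intros x s [Hx Hs]. apply HBW, Hin; left; assumption. }
    split; [now apply Hcomp|].
    apply Cn_exp; trivial. apply Cn_RInt.
    apply (Cn_ext _ n (fun x s => D2 b x (Psi x s))); auto.
    intros x s [Hx Hs]. unfold c. simpl in *. destruct (Hreg x s) as [-> ->]; lra.
  - rewrite P1, clamp_id by (rewrite Rminus_diag, Rabs_R0; lra).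
    rewrite RInt_point. apply Rplus_0_r.
  - intros x s Hxs. destruct (differentiable_pt_lim_D _ _ _ _ _ (Dif x s Hxs)) as [-> ->].
    destruct Hxs as [Hx Hs]. repeat split; [apply HBW, Hin; left; assumption | apply exp_pos].
Qed.

(** * Functions annihilated by a vector field *)

Lemma open_neq_0 (W : R * R -> Prop) (h : R -> R -> R) :
  open W -> smooth_on W h -> open (fun z => W z /\ h (fst z) (snd z) <> 0).
Proof.
  intros HW Sh. apply (open_and_locally_2d W (fun x y => h x y <> 0)); trivial.
  intros x y Hxy. apply continuity_2d_pt_neq_0. now apply (smooth_continuity W).
Qed.

(** The function constant along the solutions of y' = a2 / a1 is the second
    component of the inverse of (x, s) -> (x, Psi x s), Psi being the flow. *)
Lemma annihilated_function_graph (W : R * R -> Prop) (a1 a2 : R -> R -> R) (u v : R) :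
  open W -> smooth_on W a1 -> smooth_on W a2 -> W (u, v) -> a1 u v <> 0 ->
  exists V phi, open V /\ V (u, v) /\ (forall z, V z -> W z) /\ smooth_on V phi /\
    forall x y, V (x, y) ->
      a1 x y * D1 phi x y + a2 x y * D2 phi x y = 0 /\
      (D1 phi x y <> 0 \/ D2 phi x y <> 0).
Proof.
  intros HW S1 S2 Huv Ha.
  set (W1 := fun z : R * R => W z /\ a1 (fst z) (snd z) <> 0).
  assert (HW1 : open W1) by now apply open_neq_0.
  set (b := fun x y => a2 x y / a1 x y).
  assert (Sb : smooth_on W1 b).
  { apply smooth_div; trivial.
    - intros x y Hxy. apply Hxy.
    - now apply smooth_subset with W; [intros z [Hz _]|].
    - now apply smooth_subset with W; [intros z [Hz _]|]. }
  destruct (flow_smooth W1 b u v HW1 Sb) as (d & Psi & Hd & SPsi & Psi0 & HPsi); [now split|].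
  assert (HB := open_box u v d).
  assert (Hfst : forall x s, D1 (fun x _ => x) x s = 1 /\ D2 (fun x _ => x) x s = 0).
  { intros x s. apply differentiable_pt_lim_D, differentiable_pt_lim_fst. }
  destruct (inverse_function (box u v d) (fun x _ => x) Psi u v)
    as (V & V' & psi1 & psi2 & HC & HVuv & HVB); trivial.
  - now apply box_center.
  - now apply smooth_fst.
  - unfold jacobian. destruct (Hfst u v) as [-> ->].
    destruct (HPsi u v) as (_ & _ & Hpos); [now apply box_center | lra].
  - destruct HC as (HV & HV' & _ & _ & Sp1 & Sp2 & Hl & Hr).
    (* The derivatives of psi2 (x, Psi x s) = s in x and in s. *)
    assert (Hder : forall x y, V' (x, y) -> W1 (x, y) /\
      D1 psi2 x y + D2 psi2 x y * b x y = 0 /\ D2 psi2 x y <> 0).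
    { intros x y Hxy. destruct (Hr x y Hxy) as (H1 & H2 & H3).
      set (s := psi2 x y) in *. rewrite H2 in H1, H3.
      destruct (HPsi x s (HVB _ H1)) as (HWx & HPx & HPs).
      assert (Dcomp := differentiable_pt_lim_comp psi2 (fun t _ => t) Psi x s _ _ _ _ _ _
        (smooth_differentiable V' psi2 x (Psi x s) HV' Sp2 (proj1 (Hl x s H1)))
        (differentiable_pt_lim_fst x s)
        (smooth_differentiable _ Psi x s HB SPsi (HVB _ H1))).
      assert (Dsnd : differentiable_pt_lim (fun t r => psi2 t (Psi t r)) x s 0 1).
      { apply differentiable_pt_lim_ext with (2 := differentiable_pt_lim_snd x s).
        generalize (open_locally_2d _ _ _ HV H1). apply locally_2d_impl, locally_2d_forall.
        intros t r Htr. symmetry. apply (Hl t r Htr). }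
      destruct (differentiable_pt_lim_D _ _ _ _ _ Dcomp) as [Ec1 Ec2].
      destruct (differentiable_pt_lim_D _ _ _ _ _ Dsnd) as [Es1 Es2].
      rewrite Es1, HPx in Ec1. rewrite Es2 in Ec2. rewrite H3 in HWx, Ec1, Ec2.
      split; [exact HWx|]. split; [lra|]. intros Hz. rewrite Hz in Ec2. lra. }
    exists V', psi2. split; [trivial|]. split; [|split; [|split]]; trivial.
    + destruct (Hl u v HVuv) as [Hz _]. now rewrite Psi0 in Hz.
    + intros [x y] Hz. now apply Hder.
    + intros x y Hxy. destruct (Hder x y Hxy) as ([_ Hax] & E & Hne). simpl in Hax.
      split; [|now right].
      replace (a1 x y * D1 psi2 x y + a2 x y * D2 psi2 x y)
        with (a1 x y * (D1 psi2 x y + D2 psi2 x y * b x y)) by (unfold b; field; trivial).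
      rewrite E. ring.
Qed.

Theorem annihilated_function (W : R * R -> Prop) (a1 a2 : R -> R -> R) (u v : R) :
  open W -> smooth_on W a1 -> smooth_on W a2 -> W (u, v) ->
  (a1 u v <> 0 \/ a2 u v <> 0) ->
  exists V phi, open V /\ V (u, v) /\ (forall z, V z -> W z) /\ smooth_on V phi /\
    forall x y, V (x, y) ->
      a1 x y * D1 phi x y + a2 x y * D2 phi x y = 0 /\
      (D1 phi x y <> 0 \/ D2 phi x y <> 0).
Proof.
  intros HW S1 S2 Huv [Ha|Ha]; [now apply annihilated_function_graph|].
  assert (Hsw : forall Z : R * R -> Prop, open Z -> open (fun z => Z (snd z, fst z))).
  { intros Z HZ. apply open_of_locally_2d. intros x y Hxy.
    destruct (open_locally_2d Z y x HZ Hxy) as [e He]. exists e. intros a b Ha' Hb. now apply He. }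
  assert (Ssw : forall Z h, open Z -> smooth_on Z h ->
            smooth_on (fun z => Z (snd z, fst z)) (fun x y => h y x)).
  { intros Z h HZ Sh.
    apply (smooth_comp (fun z => Z (snd z, fst z)) Z h (fun _ y => y) (fun x _ => x));
      auto using smooth_fst, smooth_snd. }
  destruct (annihilated_function_graph (fun z => W (snd z, fst z)) (fun x y => a2 y x)
              (fun x y => a1 y x) v u) as (V & phi & HV & HVuv & HVW & Sphi & Hphi); auto.
  exists (fun z => V (snd z, fst z)), (fun x y => phi y x). repeat split; auto.
  - intros [x y] Hz. exact (HVW _ Hz).
  - destruct (Hphi y x H) as [E _].
    change (a1 x y * D2 phi y x + a2 x y * D1 phi y x = 0). lra.
  - destruct (Hphi y x H) as [_ E].
    change (D2 phi y x <> 0 \/ D1 phi y x <> 0). tauto.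
Qed.

(** * Linear factors of a first integral *)

Definition quadratic (A B C : R -> R -> R) (x y p1 p2 : R) : R :=
  / 2 * (A x y * (p1 * p1) + 2 * B x y * (p1 * p2) + C x y * (p2 * p2)).

Definition linear_form (a1 a2 : R -> R -> R) (x y p1 p2 : R) : R :=
  a1 x y * p1 + a2 x y * p2.

(** The Poisson bracket of [linear_form a1 a2] and [quadratic A B C]. *)
Definition linear_bracket (A B C a1 a2 : R -> R -> R) (x y p1 p2 : R) : R :=
  (D1 a1 x y * p1 + D1 a2 x y * p2) * (A x y * p1 + B x y * p2)
  - a1 x y * quadratic (D1 A) (D1 B) (D1 C) x y p1 p2
  + ((D2 a1 x y * p1 + D2 a2 x y * p2) * (B x y * p1 + C x y * p2)
     - a2 x y * quadratic (D2 A) (D2 B) (D2 C) x y p1 p2).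

(** The products over lists of indices make inductions on the factors possible;
    [linear_product N] is the case of the list 1, ..., N. *)
Definition product_of (a1 a2 : nat -> R -> R -> R) (l : list nat) (x y p1 p2 : R) : R :=
  fold_right Rmult 1 (map (fun m => a1 m x y * p1 + a2 m x y * p2) l).

(** The logarithmic derivative {f, H} / f of the product f of the factors. *)
Definition log_bracket (A B C : R -> R -> R) (a1 a2 : nat -> R -> R -> R) (l : list nat)
    (x y p1 p2 : R) : R :=
  fold_right Rplus 0
    (map (fun m => linear_bracket A B C (a1 m) (a2 m) x y p1 p2
                   / linear_form (a1 m) (a2 m) x y p1 p2) l).

Lemma smooth_is_derive (W : R * R -> Prop) (h : R -> R -> R) (x y : R) :
  open W -> smooth_on W h -> W (x, y) ->
  is_derive (fun t => h t y) x (D1 h x y) /\ is_derive (fun t => h x t) y (D2 h x y).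
Proof.
  intros HW Sh Hxy. apply differentiable_pt_lim_partials.
  now apply (smooth_differentiable W).
Qed.

Lemma is_derive_times_const (f : R -> R) (k x l : R) :
  is_derive f x l -> is_derive (fun t => f t * k) x (l * k).
Proof. intros Hf. apply (is_derive_scal_l (K := R_AbsRing) f x l k Hf). Qed.

(** Since {., H} is a derivation, {f, H} / f is the sum of the {L_m, H} / L_m. *)
Lemma poisson_product (W : R * R -> Prop) (A B C : R -> R -> R)
    (a1 a2 : nat -> R -> R -> R) (l : list nat) (x y p1 p2 : R) :
  open W -> W (x, y) -> smooth_on W A -> smooth_on W B -> smooth_on W C ->
  (forall m, In m l -> smooth_on W (a1 m) /\ smooth_on W (a2 m)) ->
  (forall m, In m l -> linear_form (a1 m) (a2 m) x y p1 p2 <> 0) ->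
  poisson (product_of a1 a2 l) (quadratic A B C) x y p1 p2
  = product_of a1 a2 l x y p1 p2 * log_bracket A B C a1 a2 l x y p1 p2.
Proof.
  intros HW Hxy SA SB SC Sa Hne.
  destruct (smooth_is_derive W A x y HW SA Hxy) as [A1 A2].
  destruct (smooth_is_derive W B x y HW SB Hxy) as [B1 B2].
  destruct (smooth_is_derive W C x y HW SC Hxy) as [C1 C2].
  assert (H1 : Derive (fun t => quadratic A B C x y t p2) p1 = A x y * p1 + B x y * p2).
  { apply is_derive_unique. unfold quadratic. auto_derive; trivial. field. }
  assert (H2 : Derive (fun t => quadratic A B C x y p1 t) p2 = B x y * p1 + C x y * p2).
  { apply is_derive_unique. unfold quadratic. auto_derive; trivial. field. }
  assert (Hquad : forall a b c a' b' c' z,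
    is_derive a z a' -> is_derive b z b' -> is_derive c z c' ->
    Derive (fun t => / 2 * (a t * (p1 * p1) + 2 * b t * (p1 * p2) + c t * (p2 * p2))) z
    = / 2 * (a' * (p1 * p1) + 2 * b' * (p1 * p2) + c' * (p2 * p2))).
  { intros a b c a' b' c' z Ha Hb Hc. apply is_derive_unique.
    assert (Ea := is_derive_unique _ _ _ Ha). assert (Eb := is_derive_unique _ _ _ Hb).
    assert (Ec := is_derive_unique _ _ _ Hc).
    auto_derive.
    - repeat split; eexists; eassumption.
    - change (fun x => a x) with a. change (fun x => b x) with b. change (fun x => c x) with c.
      rewrite Ea, Eb, Ec. ring. }
  assert (Hx : Derive (fun t => quadratic A B C t y p1 p2) x
             = quadratic (D1 A) (D1 B) (D1 C) x y p1 p2).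
  { now apply (Hquad (fun t => A t y) (fun t => B t y) (fun t => C t y)). }
  assert (Hy : Derive (fun t => quadratic A B C x t p1 p2) y
             = quadratic (D2 A) (D2 B) (D2 C) x y p1 p2).
  { now apply (Hquad (fun t => A x t) (fun t => B x t) (fun t => C x t)). }
  unfold poisson. rewrite H1, H2, Hx, Hy.
  assert (Hind : exists fx fy f1 f2,
    (is_derive (fun t => product_of a1 a2 l t y p1 p2) x fx /\
     is_derive (fun t => product_of a1 a2 l x t p1 p2) y fy /\
     is_derive (fun t => product_of a1 a2 l x y t p2) p1 f1 /\
     is_derive (fun t => product_of a1 a2 l x y p1 t) p2 f2) /\
    fx * (A x y * p1 + B x y * p2) - f1 * quadratic (D1 A) (D1 B) (D1 C) x y p1 p2
    + (fy * (B x y * p1 + C x y * p2) - f2 * quadratic (D2 A) (D2 B) (D2 C) x y p1 p2)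
    = product_of a1 a2 l x y p1 p2 * log_bracket A B C a1 a2 l x y p1 p2).
  { clear Hquad. induction l as [|m l IH].
    - exists 0, 0, 0, 0. split; [|cbn; ring].
      split; [|split; [|split]]; apply (is_derive_const 1).
    - destruct IH as (fx & fy & f1 & f2 & (Fx & Fy & F1 & F2) & E).
      { intros k Hk. apply Sa. now right. }
      { intros k Hk. apply Hne. now right. }
      destruct (Sa m) as [S1 S2]; [now left|].
      destruct (smooth_is_derive W _ x y HW S1 Hxy) as [G11 G12].
      destruct (smooth_is_derive W _ x y HW S2 Hxy) as [G21 G22].
      assert (Hm := Hne m (or_introl eq_refl)).
      set (Q := product_of a1 a2 l x y p1 p2) in *.
      set (S := log_bracket A B C a1 a2 l x y p1 p2) in *.
      set (L := a1 m x y * p1 + a2 m x y * p2).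
      exists ((D1 (a1 m) x y * p1 + D1 (a2 m) x y * p2) * Q + L * fx),
        ((D2 (a1 m) x y * p1 + D2 (a2 m) x y * p2) * Q + L * fy),
        (a1 m x y * Q + L * f1), (a2 m x y * Q + L * f2).
      split; [split; [|split; [|split]]|].
      + apply (is_derive_mult (fun t => a1 m t y * p1 + a2 m t y * p2)
                 (fun t => product_of a1 a2 l t y p1 p2)); trivial; [|apply Rmult_comm].
        apply (is_derive_plus (fun t => a1 m t y * p1) (fun t => a2 m t y * p2));
          apply is_derive_times_const; trivial.
      + apply (is_derive_mult (fun t => a1 m x t * p1 + a2 m x t * p2)
                 (fun t => product_of a1 a2 l x t p1 p2)); trivial; [|apply Rmult_comm].
        apply (is_derive_plus (fun t => a1 m x t * p1) (fun t => a2 m x t * p2));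
          apply is_derive_times_const; trivial.
      + apply (is_derive_mult (fun t => a1 m x y * t + a2 m x y * p2)
                 (fun t => product_of a1 a2 l x y t p2)); trivial; [|apply Rmult_comm].
        auto_derive; trivial. ring.
      + apply (is_derive_mult (fun t => a1 m x y * p1 + a2 m x y * t)
                 (fun t => product_of a1 a2 l x y p1 t)); trivial; [|apply Rmult_comm].
        auto_derive; trivial. ring.
      + change (product_of a1 a2 (m :: l) x y p1 p2) with (L * Q).
        change (log_bracket A B C a1 a2 (m :: l) x y p1 p2)
          with (linear_bracket A B C (a1 m) (a2 m) x y p1 p2 / L + S).
        change (L <> 0) in Hm.
        replace (L * Q * (linear_bracket A B C (a1 m) (a2 m) x y p1 p2 / L + S))
          with (Q * linear_bracket A B C (a1 m) (a2 m) x y p1 p2 + L * (Q * S))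
          by (field; exact Hm).
        rewrite <- E. unfold linear_bracket. ring. }
  destruct Hind as (fx & fy & f1 & f2 & (Fx & Fy & F1 & F2) & <-).
  apply is_derive_unique in Fx, Fy, F1, F2.
  change (Derive (fun t : R => product_of a1 a2 l t y p1 p2) x = fx) in Fx.
  change (Derive (fun t : R => product_of a1 a2 l x t p1 p2) y = fy) in Fy.
  change (Derive (fun t : R => product_of a1 a2 l x y t p2) p1 = f1) in F1.
  change (Derive (fun t : R => product_of a1 a2 l x y p1 t) p2 = f2) in F2.
  rewrite Fx, Fy, F1, F2.
  reflexivity.
Qed.

(** Two linear forms may have a common root over a set of points that is neither
    open nor empty; this does not occur after restriction to a smaller open set.
    Either the forms are independent at some point, hence near it, or they are
    proportional everywhere. *)
Lemma generic_dichotomy (U : R * R -> Prop) (a1 a2 : nat -> R -> R -> R)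
    (b1 b2 : R -> R -> R) (l : list nat) :
  open U ->
  smooth_on U b1 -> smooth_on U b2 ->
  (forall m, In m l -> smooth_on U (a1 m) /\ smooth_on U (a2 m)) ->
  (forall m, In m l -> forall W, open W -> (exists z, W z) -> (forall z, W z -> U z) ->
     exists x y, W (x, y) /\ (a1 m x y <> 0 \/ a2 m x y <> 0)) ->
  forall W, open W -> (exists z, W z) -> (forall z, W z -> U z) ->
  exists W', open W' /\ (exists z, W' z) /\ (forall z, W' z -> W z) /\
    forall m, In m l ->
      (forall x y, W' (x, y) -> b1 x y * a2 m x y - b2 x y * a1 m x y <> 0) \/
      (forall x y, W' (x, y) -> b1 x y * a2 m x y - b2 x y * a1 m x y = 0 /\
                                (a1 m x y <> 0 \/ a2 m x y <> 0)).
Proof.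
  intros HU Sb1 Sb2. induction l as [|m l IH]; intros Sa Hnz W HW HWne HWU.
  - exists W. split; [|split; [|split]]; auto.
  - destruct (IH (fun k Hk => Sa k (or_intror Hk)) (fun k Hk => Hnz k (or_intror Hk))
                W HW HWne HWU) as (W1 & HW1 & HW1ne & HW1W & Hl).
    assert (HW1U : forall z, W1 z -> U z) by auto.
    destruct (Sa m (or_introl eq_refl)) as [S1 S2].
    set (r := fun x y => b1 x y * a2 m x y - b2 x y * a1 m x y).
    assert (Sr : smooth_on U r).
    { apply (smooth_minus U (fun x y => b1 x y * a2 m x y) (fun x y => b2 x y * a1 m x y));
        trivial; apply smooth_mult; trivial. }
    assert (Hsub : forall W2 : R * R -> Prop, open W2 -> (exists z, W2 z) ->
      (forall z, W2 z -> W1 z) ->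
      (forall x y, W2 (x, y) -> r x y <> 0) \/
      (forall x y, W2 (x, y) -> r x y = 0 /\ (a1 m x y <> 0 \/ a2 m x y <> 0)) ->
      exists W', open W' /\ (exists z, W' z) /\ (forall z, W' z -> W z) /\
        forall k, In k (m :: l) ->
          (forall x y, W' (x, y) -> b1 x y * a2 k x y - b2 x y * a1 k x y <> 0) \/
          (forall x y, W' (x, y) -> b1 x y * a2 k x y - b2 x y * a1 k x y = 0 /\
                                    (a1 k x y <> 0 \/ a2 k x y <> 0))).
    { intros W2 H1 H2 H3 H4. exists W2. split; [|split; [|split]]; auto.
      intros k [<-|Hk]; [exact H4|].
      destruct (Hl k Hk) as [H|H]; [left | right]; auto. }
    destruct (classic (exists x y, W1 (x, y) /\ r x y <> 0)) as [(x & y & Hxy & Hr)|Hr].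
    + apply (Hsub (fun z => W1 z /\ r (fst z) (snd z) <> 0)).
      * apply open_neq_0; trivial. now apply smooth_subset with U.
      * exists (x, y). now split.
      * now intros z [Hz _].
      * left. now intros a b [_ Hab].
    + destruct (Hnz m (or_introl eq_refl) W1 HW1 HW1ne HW1U) as (x & y & Hxy & Hne).
      assert (Hr0 : forall a b, W1 (a, b) -> r a b = 0).
      { intros a b Hab. apply NNPP. intros H. apply Hr. now exists a, b. }
      destruct Hne as [Hne|Hne].
      * apply (Hsub (fun z => W1 z /\ a1 m (fst z) (snd z) <> 0)).
        -- apply open_neq_0; trivial. now apply smooth_subset with U.
        -- exists (x, y). now split.
        -- now intros z [Hz _].
        -- right. intros a b [Hab Hn]. simpl in Hn. auto.
      * apply (Hsub (fun z => W1 z /\ a2 m (fst z) (snd z) <> 0)).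
        -- apply open_neq_0; trivial. now apply smooth_subset with U.
        -- exists (x, y). now split.
        -- now intros z [Hz _].
        -- right. intros a b [Hab Hn]. simpl in Hn. auto.
Qed.

(** The bracket of H with a linear form that has the same root as b, taken at
    that root, does not see the derivatives of the proportionality factor. *)
Lemma bracket_proportional (U W : R * R -> Prop) (A B C a1 a2 b1 b2 : R -> R -> R)
    (x y c : R) :
  open U -> smooth_on U a1 -> smooth_on U a2 -> smooth_on U b1 -> smooth_on U b2 ->
  open W -> (forall z, W z -> U z) -> W (x, y) ->
  (forall s t, W (s, t) -> b1 s t * a2 s t - b2 s t * a1 s t = 0) ->
  a1 x y = c * b1 x y -> a2 x y = c * b2 x y ->
  linear_bracket A B C a1 a2 x y (- b2 x y) (b1 x y)
  = c * linear_bracket A B C b1 b2 x y (- b2 x y) (b1 x y).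
Proof.
  intros HU Sa1 Sa2 Sb1 Sb2 HW HWU Hxy H0 E1 E2.
  assert (HUxy := HWU _ Hxy).
  assert (Da1 := smooth_differentiable U a1 x y HU Sa1 HUxy).
  assert (Da2 := smooth_differentiable U a2 x y HU Sa2 HUxy).
  assert (Db1 := smooth_differentiable U b1 x y HU Sb1 HUxy).
  assert (Db2 := smooth_differentiable U b2 x y HU Sb2 HUxy).
  assert (D := differentiable_pt_lim_plus _ _ _ _ _ _ _ _
    (differentiable_pt_lim_mult _ _ _ _ _ _ _ _ Db1 Da2)
    (differentiable_pt_lim_mult _ _ _ _ _ _ _ _ (differentiable_pt_lim_const (-1) x y)
       (differentiable_pt_lim_mult _ _ _ _ _ _ _ _ Db2 Da1))).
  assert (D0 : differentiable_pt_lim (fun s t => b1 s t * a2 s t + -1 * (b2 s t * a1 s t)) x y 0 0).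
  { apply differentiable_pt_lim_ext with (2 := differentiable_pt_lim_const 0 x y).
    generalize (open_locally_2d _ _ _ HW Hxy). apply locally_2d_impl, locally_2d_forall.
    intros s t Hst. generalize (H0 s t Hst). lra. }
  destruct (differentiable_pt_lim_D _ _ _ _ _ D) as [F1 F2].
  destruct (differentiable_pt_lim_D _ _ _ _ _ D0) as [G1 G2].
  rewrite G1 in F1. rewrite G2 in F2.
  assert (K1 : - b2 x y * D1 a1 x y + b1 x y * D1 a2 x y
             = c * (- b2 x y * D1 b1 x y + b1 x y * D1 b2 x y)) by (rewrite E1, E2 in F1; lra).
  assert (K2 : - b2 x y * D2 a1 x y + b1 x y * D2 a2 x y
             = c * (- b2 x y * D2 b1 x y + b1 x y * D2 b2 x y)) by (rewrite E1, E2 in F2; lra).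
  unfold linear_bracket.
  replace (D1 a1 x y * - b2 x y + D1 a2 x y * b1 x y)
    with (c * (- b2 x y * D1 b1 x y + b1 x y * D1 b2 x y)) by (rewrite <- K1; ring).
  replace (D2 a1 x y * - b2 x y + D2 a2 x y * b1 x y)
    with (c * (- b2 x y * D2 b1 x y + b1 x y * D2 b2 x y)) by (rewrite <- K2; ring).
  rewrite E1, E2. ring.
Qed.

Lemma is_lim_continuous_eq (f g : R -> R) (l : R) :
  ex_derive g 0 -> g 0 = l -> (forall s, s <> 0 -> g s = f s) -> is_lim f 0 l.
Proof.
  intros Hg <- Hfg. apply (is_lim_ext_loc g).
  - exists (mkposreal 1 Rlt_0_1). intros s _ Hs. now apply Hfg.
  - apply is_lim_continuity. apply continuity_pt_filterlim.
    now apply (ex_derive_continuous g).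
Qed.

(** Along a line of momenta that crosses the root p0 of b at s = 0, the
    summand {L_m, H} / L_m of {f, H} / f is regular at s = 0 if p0 is no root of
    L_m; otherwise L_m = c b near the point and, L_m vanishing to the first order
    in s, the product of the summand and s tends to {b, H}(p0) / |b|^2. *)
Lemma log_bracket_limit (U W : R * R -> Prop) (A B C : R -> R -> R)
    (a1 a2 : nat -> R -> R -> R) (b1 b2 : R -> R -> R) (l : list nat) (x y : R) :
  open U -> smooth_on U b1 -> smooth_on U b2 ->
  (forall m, In m l -> smooth_on U (a1 m) /\ smooth_on U (a2 m)) ->
  open W -> (forall z, W z -> U z) -> W (x, y) ->
  (b1 x y <> 0 \/ b2 x y <> 0) ->
  (forall m, In m l ->
     (forall x y, W (x, y) -> b1 x y * a2 m x y - b2 x y * a1 m x y <> 0) \/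
     (forall x y, W (x, y) -> b1 x y * a2 m x y - b2 x y * a1 m x y = 0 /\
                              (a1 m x y <> 0 \/ a2 m x y <> 0))) ->
  let p1 := fun s => - b2 x y + s * b1 x y in
  let p2 := fun s => b1 x y + s * b2 x y in
  locally' 0 (fun s => forall m, In m l -> linear_form (a1 m) (a2 m) x y (p1 s) (p2 s) <> 0) /\
  exists k : nat,
    is_lim (fun s => s * log_bracket A B C a1 a2 l x y (p1 s) (p2 s)) 0
      (INR k * (linear_bracket A B C b1 b2 x y (- b2 x y) (b1 x y)
                / (b1 x y * b1 x y + b2 x y * b2 x y))) /\
    ((exists m, In m l /\ a1 m x y = b1 x y /\ a2 m x y = b2 x y) -> (1 <= k)%nat).
Proof.
  intros HU Sb1 Sb2 Sa HW HWU Hxy Hb Hdich p1 p2.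
  set (n := b1 x y * b1 x y + b2 x y * b2 x y).
  set (T := linear_bracket A B C b1 b2 x y (- b2 x y) (b1 x y)).
  assert (Hn : 0 < n).
  { unfold n. generalize (Rle_0_sqr (b1 x y)) (Rle_0_sqr (b2 x y)). unfold Rsqr.
    destruct Hb as [Hb|Hb]; generalize (Rsqr_pos_lt _ Hb); unfold Rsqr; lra. }
  induction l as [|m l IH].
  - split; [exists (mkposreal 1 Rlt_0_1); intros s _ _ m []|].
    exists O. split; [|intros (m & [] & _)].
    apply (is_lim_ext (fun _ => 0)); [intros s; cbn; ring|].
    simpl. rewrite Rmult_0_l. apply is_lim_const.
  - destruct IH as (IHne & k & IHlim & IHk).
    { intros j Hj. apply Sa. now right. }
    { intros j Hj. apply Hdich. now right. }
    destruct (Sa m (or_introl eq_refl)) as [S1 S2].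
    set (f := fun s => linear_bracket A B C (a1 m) (a2 m) x y (p1 s) (p2 s)).
    set (L := fun s => linear_form (a1 m) (a2 m) x y (p1 s) (p2 s)).
    assert (EL : forall s, L s = (b1 x y * a2 m x y - b2 x y * a1 m x y)
                                 + s * (a1 m x y * b1 x y + a2 m x y * b2 x y)).
    { intros s. unfold L, linear_form, p1, p2. ring. }
    assert (Hf : ex_derive f 0).
    { unfold f, linear_bracket, quadratic, p1, p2. auto_derive; trivial. }
    assert (Hstep : forall (kap : R) (j : nat), locally' 0 (fun s => L s <> 0) ->
       is_lim (fun s => s * (f s / L s)) 0 kap -> kap = INR j * (T / n) ->
       (a1 m x y = b1 x y /\ a2 m x y = b2 x y -> (1 <= j)%nat) ->
       locally' 0 (fun s => forall m', In m' (m :: l) ->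
                     linear_form (a1 m') (a2 m') x y (p1 s) (p2 s) <> 0) /\
       exists k : nat,
         is_lim (fun s => s * log_bracket A B C a1 a2 (m :: l) x y (p1 s) (p2 s)) 0
           (INR k * (T / n)) /\
         ((exists m', In m' (m :: l) /\ a1 m' x y = b1 x y /\ a2 m' x y = b2 x y) ->
          (1 <= k)%nat)).
    { intros kap j HL Hlim Hkap Hj. split.
      - generalize (filter_and _ _ HL IHne). apply filter_imp.
        intros s [Q1 Q2] m' [<-|Hm']; [exact Q1 | now apply Q2].
      - exists (j + k)%nat. split.
        + apply (is_lim_ext (fun s => s * (f s / L s) +
                   s * log_bracket A B C a1 a2 l x y (p1 s) (p2 s))).
          { intros s. change (log_bracket A B C a1 a2 (m :: l) x y (p1 s) (p2 s))
              with (f s / L s + log_bracket A B C a1 a2 l x y (p1 s) (p2 s)). ring. }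
          rewrite plus_INR, Rmult_plus_distr_r, <- Hkap.
          apply (is_lim_plus _ _ _ _ _ _ Hlim IHlim). reflexivity.
        + intros (m' & [Hm'|Hm'] & Q).
          * subst m'. specialize (Hj Q). lia.
          * assert (1 <= k)%nat by (apply IHk; now exists m'). lia. }
    destruct (Hdich m (or_introl eq_refl)) as [Hd|Hd].
    + specialize (Hd x y Hxy).
      assert (HL0 : L 0 <> 0) by (rewrite EL, Rmult_0_l, Rplus_0_r; exact Hd).
      assert (HL : locally' 0 (fun s => L s <> 0)).
      { apply filter_le_within.
        assert (CL : continuous L 0).
        { apply (ex_derive_continuous L). unfold L, linear_form, p1, p2. auto_derive; trivial. }
        exact (CL (fun z => z <> 0) (open_neq 0 (L 0) HL0)). }
      apply (Hstep 0 0%nat); trivial.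
      * apply (is_lim_continuous_eq _ (fun s => s * (f s / L s))); trivial.
        -- apply ex_derive_mult; [apply ex_derive_id|].
           apply ex_derive_div; trivial. unfold L, linear_form, p1, p2. auto_derive; trivial.
        -- ring.
      * simpl. ring.
      * intros [Q1 Q2]. exfalso. apply Hd. rewrite Q1, Q2. ring.
    + destruct (Hd x y Hxy) as [Hd0 Hne].
      set (c := (a1 m x y * b1 x y + a2 m x y * b2 x y) / n).
      assert (E1 : a1 m x y = c * b1 x y).
      { apply Rmult_eq_reg_r with n; [|lra].
        unfold c. replace (_ / n * b1 x y * n)
          with ((a1 m x y * b1 x y + a2 m x y * b2 x y) * b1 x y) by (field; lra).
        replace (a1 m x y * n) with ((a1 m x y * b1 x y + a2 m x y * b2 x y) * b1 x y
          - b2 x y * (b1 x y * a2 m x y - b2 x y * a1 m x y)) by (unfold n; ring).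
        rewrite Hd0. ring. }
      assert (E2 : a2 m x y = c * b2 x y).
      { apply Rmult_eq_reg_r with n; [|lra].
        unfold c. replace (_ / n * b2 x y * n)
          with ((a1 m x y * b1 x y + a2 m x y * b2 x y) * b2 x y) by (field; lra).
        replace (a2 m x y * n) with ((a1 m x y * b1 x y + a2 m x y * b2 x y) * b2 x y
          + b1 x y * (b1 x y * a2 m x y - b2 x y * a1 m x y)) by (unfold n; ring).
        rewrite Hd0. ring. }
      assert (Hc : c <> 0).
      { intros Hc. rewrite E1, E2, Hc in Hne. lra. }
      assert (ELs : forall s, L s = s * (c * n)).
      { intros s. rewrite EL, Hd0. unfold c. field. lra. }
      assert (Hbr : f 0 = c * T).
      { unfold f, p1, p2. rewrite !Rmult_0_l, !Rplus_0_r.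
        apply (bracket_proportional U W); trivial. intros s t Hst. now apply Hd. }
      apply (Hstep (T / n) 1%nat); trivial.
      * exists (mkposreal 1 Rlt_0_1). intros s _ Hs. rewrite ELs.
        apply Rmult_integral_contrapositive_currified; trivial.
        apply Rmult_integral_contrapositive_currified; lra.
      * apply (is_lim_continuous_eq _ (fun s => f s * / (c * n))).
        -- apply ex_derive_mult; trivial. apply ex_derive_const.
        -- rewrite Hbr. field. lra.
        -- intros s Hs. rewrite ELs. field. lra.
      * simpl. ring.
Qed.

Lemma product_of_neq_0 (a1 a2 : nat -> R -> R -> R) (l : list nat) (x y p1 p2 : R) :
  product_of a1 a2 l x y p1 p2 <> 0 <->
  (forall m, In m l -> linear_form (a1 m) (a2 m) x y p1 p2 <> 0).
Proof.
  induction l as [|m l IH].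
  - split; [intros _ m [] | intros _; exact R1_neq_R0].
  - change (product_of a1 a2 (m :: l) x y p1 p2)
      with (linear_form (a1 m) (a2 m) x y p1 p2 * product_of a1 a2 l x y p1 p2).
    split.
    + intros H k [<-|Hk].
      * intros H0. apply H. rewrite H0. ring.
      * apply IH; trivial. intros H0. apply H. rewrite H0. ring.
    + intros H. apply Rmult_integral_contrapositive_currified.
      * apply H. now left.
      * apply IH. intros k Hk. apply H. now right.
Qed.

Lemma smooth_quadratic (W : R * R -> Prop) (A B C q1 q2 : R -> R -> R) :
  open W -> smooth_on W A -> smooth_on W B -> smooth_on W C ->
  smooth_on W q1 -> smooth_on W q2 ->
  smooth_on W (fun x y => quadratic A B C x y (q1 x y) (q2 x y)).
Proof.
  intros HW SA SB SC S1 S2.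
  assert (M : forall f g, smooth_on W f -> smooth_on W g -> smooth_on W (fun x y => f x y * g x y))
    by (intros; now apply smooth_mult).
  assert (P : forall f g, smooth_on W f -> smooth_on W g -> smooth_on W (fun x y => f x y + g x y))
    by (intros; now apply smooth_plus).
  unfold quadratic.
  apply (M (fun _ _ => / 2)); [now apply smooth_const|].
  apply P; [apply P|].
  - apply M; trivial. now apply M.
  - apply (M (fun x y => 2 * B x y)); [|now apply M].
    apply (M (fun _ _ => 2)); trivial. now apply smooth_const.
  - apply M; trivial. now apply M.
Qed.

Lemma smooth_linear_bracket (W : R * R -> Prop) (A B C a1 a2 q1 q2 : R -> R -> R) :
  open W -> smooth_on W A -> smooth_on W B -> smooth_on W C ->
  smooth_on W a1 -> smooth_on W a2 -> smooth_on W q1 -> smooth_on W q2 ->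
  smooth_on W (fun x y => linear_bracket A B C a1 a2 x y (q1 x y) (q2 x y)).
Proof.
  intros HW SA SB SC Sa1 Sa2 S1 S2.
  destruct (smooth_D _ _ SA). destruct (smooth_D _ _ SB). destruct (smooth_D _ _ SC).
  destruct (smooth_D _ _ Sa1). destruct (smooth_D _ _ Sa2).
  assert (M : forall f g, smooth_on W f -> smooth_on W g -> smooth_on W (fun x y => f x y * g x y))
    by (intros; now apply smooth_mult).
  assert (P : forall f g, smooth_on W f -> smooth_on W g -> smooth_on W (fun x y => f x y + g x y))
    by (intros; now apply smooth_plus).
  assert (Q : forall f g, smooth_on W f -> smooth_on W g -> smooth_on W (fun x y => f x y - g x y))
    by (intros; now apply smooth_minus).
  unfold linear_bracket.
  apply P; apply Q; apply M; trivial; try (now apply smooth_quadratic);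
    apply P; apply M; trivial.
Qed.

(** Where {L_i, H} is nonzero at the root of L_i, the sum of the {L_m, H} / L_m,
    which vanishes, would have a pole there. *)
Theorem bracket_vanishes_at_root (U : R * R -> Prop) (A B C : R -> R -> R)
    (N : nat) (a1 a2 : nat -> R -> R -> R) (i : nat) :
  open U -> smooth_on U A -> smooth_on U B -> smooth_on U C ->
  (forall m, (1 <= m <= N)%nat -> smooth_on U (a1 m) /\ smooth_on U (a2 m)) ->
  (forall W : R * R -> Prop, open W -> (exists z, W z) -> (forall z, W z -> U z) ->
     exists x y p1 p2, W (x, y) /\ linear_product N a1 a2 x y p1 p2 <> 0) ->
  first_integral_on U (linear_product N a1 a2) (quadratic A B C) ->
  (1 <= i <= N)%nat ->
  forall x y, U (x, y) ->
    linear_bracket A B C (a1 i) (a2 i) x y (- a2 i x y) (a1 i x y) = 0.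
Proof.
  intros HU SA SB SC Sa Hne Hfi Hi x y Hxy.
  set (l := seq 1 N).
  assert (Sl : forall m, In m l -> smooth_on U (a1 m) /\ smooth_on U (a2 m)).
  { intros m Hm. apply in_seq in Hm. apply Sa. lia. }
  assert (Hil : In i l) by (apply in_seq; lia).
  destruct (Sl i Hil) as [S1 S2].
  set (T := fun x y => linear_bracket A B C (a1 i) (a2 i) x y (- a2 i x y) (a1 i x y)).
  assert (ST : smooth_on U T).
  { apply smooth_linear_bracket; trivial. now apply smooth_opp. }
  apply NNPP. intros HT.
  destruct (generic_dichotomy U a1 a2 (a1 i) (a2 i) l HU S1 S2 Sl) with
    (W := fun z : R * R => U z /\ T (fst z) (snd z) <> 0)
    as (W & HW & [[s t] Hz] & HWT & Hdich).
  - intros m Hm W HW HWne HWU. destruct (Hne W HW HWne HWU) as (s & t & p1 & p2 & Hst & Hp).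
    exists s, t. split; trivial.
    apply (product_of_neq_0 a1 a2 l) with (m := m) in Hp; trivial. unfold linear_form in Hp.
    destruct (Req_dec (a1 m s t) 0) as [E|E]; [|now left].
    right. intros E'. apply Hp. rewrite E, E'. ring.
  - now apply open_neq_0.
  - exists (x, y). now split.
  - now intros z [Hz _].
  - assert (HWU : forall z, W z -> U z) by (intros z Hz'; now apply HWT).
    assert (HTz : T s t <> 0) by now apply (HWT (s, t)).
    assert (Hb : a1 i s t <> 0 \/ a2 i s t <> 0).
    { destruct (Req_dec (a1 i s t) 0) as [E|E]; [|now left].
      right. intros E'. apply HTz. unfold T, linear_bracket, quadratic. rewrite E, E'. ring. }
    destruct (log_bracket_limit U W A B C a1 a2 (a1 i) (a2 i) l s t HU S1 S2 Sl HW HWU Hz Hb Hdich)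
      as (Hnz & k & Hlim & Hk).
    assert (Hk1 : (1 <= k)%nat) by (apply Hk; now exists i).
    set (p1 := fun r => - a2 i s t + r * a1 i s t) in *.
    set (p2 := fun r => a1 i s t + r * a2 i s t) in *.
    assert (Hlim0 : is_lim (fun r => r * log_bracket A B C a1 a2 l s t (p1 r) (p2 r)) 0 0).
    { apply (is_lim_ext_loc (fun _ => 0)); [|apply is_lim_const].
      revert Hnz. apply filter_imp. intros r Hr.
      assert (HP := poisson_product U A B C a1 a2 l s t (p1 r) (p2 r) HU (HWU _ Hz) SA SB SC Sl Hr).
      change (product_of a1 a2 l) with (linear_product N a1 a2) in HP.
      rewrite (Hfi s t (p1 r) (p2 r) (HWU _ Hz)) in HP.
      symmetry in HP. apply Rmult_integral in HP. destruct HP as [HP|HP].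
      - exfalso. revert HP. now apply (product_of_neq_0 a1 a2 l).
      - rewrite HP. ring. }
    apply is_lim_unique in Hlim. apply is_lim_unique in Hlim0.
    assert (E := eq_trans (eq_sym Hlim) Hlim0). injection E. clear E. intros E.
    apply le_INR in Hk1. simpl in Hk1.
    apply Rmult_integral in E. destruct E as [E|E]; [lra|].
    apply HTz. unfold T.
    set (n := a1 i s t * a1 i s t + a2 i s t * a2 i s t) in E.
    assert (Hn : 0 < n).
    { unfold n. generalize (Rle_0_sqr (a1 i s t)) (Rle_0_sqr (a2 i s t)). unfold Rsqr.
      destruct Hb as [Hb|Hb]; generalize (Rsqr_pos_lt _ Hb); unfold Rsqr; lra. }
    apply Rmult_eq_reg_r with (/ n); [rewrite Rmult_0_l; exact E|].
    apply Rinv_neq_0_compat. lra.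
Qed.

(** * Coordinate functions adapted to a factor *)

Lemma annihilated_covector (a1 a2 w1 w2 : R) :
  a1 <> 0 \/ a2 <> 0 -> a1 * w1 + a2 * w2 = 0 ->
  exists k, w1 = k * - a2 /\ w2 = k * a1.
Proof.
  intros Ha Hw. destruct Ha as [Ha|Ha].
  - exists (w2 / a1). split; [|now field].
    apply Rmult_eq_reg_l with a1; trivial.
    replace (a1 * (w2 / a1 * - a2)) with (- (a2 * w2)) by now field. lra.
  - exists (- w1 / a2). split; [now field|].
    apply Rmult_eq_reg_l with a2; trivial.
    replace (a2 * (- w1 / a2 * a1)) with (- (a1 * w1)) by now field. lra.
Qed.

Lemma quadratic_scale (A B C : R -> R -> R) (x y k p1 p2 : R) :
  quadratic A B C x y (k * p1) (k * p2) = k * k * quadratic A B C x y p1 p2.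
Proof. unfold quadratic. ring. Qed.

(** A 1-form on which H has a constant nonzero value and which a linear form L
    with {L, H} = 0 on L = 0 annihilates is closed: its image is then a surface in
    the cotangent bundle on which two functions in involution are constant, and
    such a surface is Lagrangian.  In coordinates, with h twice the value of H at
    the root (- a2, a1), the closedness reads 2 h div a = a . grad h. *)
Lemma divergence_identity (W : R * R -> Prop) (A B C a1 a2 : R -> R -> R) (x y : R) :
  open W -> smooth_on W A -> smooth_on W B -> smooth_on W C ->
  smooth_on W a1 -> smooth_on W a2 -> W (x, y) ->
  linear_bracket A B C a1 a2 x y (- a2 x y) (a1 x y) = 0 ->
  let h := fun x y => 2 * quadratic A B C x y (- a2 x y) (a1 x y) in
  a1 x y * D1 h x y + a2 x y * D2 h x y = 2 * h x y * (D1 a1 x y + D2 a2 x y).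
Proof.
  intros HW SA SB SC Sa1 Sa2 Hxy HT h.
  assert (GA := smooth_differentiable W A x y HW SA Hxy).
  assert (GB := smooth_differentiable W B x y HW SB Hxy).
  assert (GC := smooth_differentiable W C x y HW SC Hxy).
  assert (G1 := smooth_differentiable W a1 x y HW Sa1 Hxy).
  assert (G2 := smooth_differentiable W a2 x y HW Sa2 Hxy).
  assert (Gh := differentiable_pt_lim_plus _ _ _ _ _ _ _ _
    (differentiable_pt_lim_mult _ _ _ _ _ _ _ _ GA
      (differentiable_pt_lim_mult _ _ _ _ _ _ _ _ G2 G2))
    (differentiable_pt_lim_plus _ _ _ _ _ _ _ _
      (differentiable_pt_lim_mult _ _ _ _ _ _ _ _ (differentiable_pt_lim_const (-2) x y)
        (differentiable_pt_lim_mult _ _ _ _ _ _ _ _ GB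
          (differentiable_pt_lim_mult _ _ _ _ _ _ _ _ G1 G2)))
      (differentiable_pt_lim_mult _ _ _ _ _ _ _ _ GC
        (differentiable_pt_lim_mult _ _ _ _ _ _ _ _ G1 G1)))).
  apply differentiable_pt_lim_ext with (f2 := h) in Gh.
  2:{ apply locally_2d_forall. intros s t. unfold h, quadratic. field. }
  destruct (differentiable_pt_lim_D _ _ _ _ _ Gh) as [-> ->].
  apply Rminus_diag_uniq.
  transitivity (- 2 * linear_bracket A B C a1 a2 x y (- a2 x y) (a1 x y)).
  - unfold h, linear_bracket, quadratic. field.
  - rewrite HT. ring.
Qed.

Lemma sign_cases (x : R) :
  (x < 0 /\ sign x = -1) \/ (x = 0 /\ sign x = 0) \/ (0 < x /\ sign x = 1).
Proof.
  destruct (Rtotal_order x 0) as [H|[H|H]].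
  - left. split; trivial. now apply sign_eq_m1.
  - right; left. split; trivial. rewrite H. apply sign_0.
  - right; right. split; trivial. now apply sign_eq_1.
Qed.

(** If H vanishes at the root of L near the point, any function with differential
    proportional to the root does; otherwise the root normalized by the value of
    H is closed, hence a differential. *)
Theorem adapted_function (W : R * R -> Prop) (A B C a1 a2 : R -> R -> R) (u v : R) :
  open W -> smooth_on W A -> smooth_on W B -> smooth_on W C ->
  smooth_on W a1 -> smooth_on W a2 -> W (u, v) ->
  (forall x y, W (x, y) -> a1 x y <> 0 \/ a2 x y <> 0) ->
  (forall x y, W (x, y) -> linear_bracket A B C a1 a2 x y (- a2 x y) (a1 x y) = 0) ->
  root_sign_locally_constant (quadratic A B C) a1 a2 u v ->
  exists V phi e, open V /\ V (u, v) /\ (forall z, V z -> W z) /\ smooth_on V phi /\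
    is_epsilon e /\
    forall x y, V (x, y) ->
      a1 x y * D1 phi x y + a2 x y * D2 phi x y = 0 /\
      (D1 phi x y <> 0 \/ D2 phi x y <> 0) /\
      quadratic A B C x y (D1 phi x y) (D2 phi x y) = / 2 * e.
Proof.
  intros HW SA SB SC Sa1 Sa2 Huv Hne HT Hsign.
  set (h := fun x y => 2 * quadratic A B C x y (- a2 x y) (a1 x y)).
  set (e := sign (quadratic A B C u v (- a2 u v) (a1 u v))).
  destruct (locally_2d_box _ _ _ (locally_2d_and _ _ _ _ Hsign (open_locally_2d W u v HW Huv)))
    as (r & Hr & Hbox). fold e in Hbox.
  set (Bx := box u v r). assert (HB : open Bx) by apply open_box.
  assert (HBW : forall z, Bx z -> W z) by (intros [x y] Hz; now apply Hbox).
  assert (HBuv : Bx (u, v)) by now apply box_center.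
  assert (SB' : forall k, smooth_on W k -> smooth_on Bx k) by (intros k; now apply smooth_subset).
  assert (Hsq : forall x y, Bx (x, y) -> sign (quadratic A B C x y (- a2 x y) (a1 x y)) = e)
    by (intros x y Hxy; now apply Hbox).
  destruct (Req_dec e 0) as [He|He].
  - destruct (annihilated_function Bx a1 a2 u v) as (V & phi & HV & HVuv & HVB & Sphi & Hphi); auto.
    exists V, phi, 0. split; [|split; [|split; [|split; [|split]]]]; auto.
    { now right; left. }
    intros x y Hxy. destruct (Hphi x y Hxy) as [E1 E2]. split; [|split]; trivial.
    destruct (annihilated_covector _ _ _ _ (Hne x y (HBW _ (HVB _ Hxy))) E1) as (k & -> & ->).
    rewrite quadratic_scale. specialize (Hsq x y (HVB _ Hxy)).
    destruct (sign_cases (quadratic A B C x y (- a2 x y) (a1 x y))) as [[_ Q]|[[-> _]|[_ Q]]];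
      [lra | ring | lra].
  - assert (He1 : e = -1 \/ e = 1).
    { destruct (sign_cases (quadratic A B C u v (- a2 u v) (a1 u v))) as [[_ Q]|[[_ Q]|[_ Q]]];
        fold e in Q; auto. contradiction. }
    assert (Hpos : forall x y, Bx (x, y) -> 0 < e * h x y).
    { intros x y Hxy. specialize (Hsq x y Hxy). unfold h.
      destruct (sign_cases (quadratic A B C x y (- a2 x y) (a1 x y))) as [[P Q]|[[_ Q]|[P Q]]];
        rewrite Hsq in Q; rewrite Q; try lra; contradiction. }
    assert (Hee : e * e = 1) by (destruct He1 as [-> | ->]; ring).
    assert (Sh : smooth_on Bx h).
    { apply (smooth_mult Bx (fun _ _ => 2)); auto using smooth_const.
      apply smooth_quadratic; auto. apply smooth_opp; auto. }
    set (lam := fun x y => / sqrt (e * h x y)).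
    assert (Seh : smooth_on Bx (fun x y => e * h x y)).
    { apply (smooth_mult Bx (fun _ _ => e)); auto using smooth_const. }
    assert (Slam : smooth_on Bx lam).
    { apply smooth_inv; trivial.
      - intros x y Hxy. apply Rgt_not_eq, sqrt_lt_R0; auto.
      - now apply smooth_sqrt. }
    assert (Hlam0 : forall x y, Bx (x, y) -> lam x y <> 0).
    { intros x y Hxy. apply Rinv_neq_0_compat, Rgt_not_eq, sqrt_lt_R0; auto. }
    assert (Hlam : forall x y, Bx (x, y) -> lam x y * lam x y * h x y = e).
    { intros x y Hxy. specialize (Hpos x y Hxy). unfold lam.
      rewrite <- Rinv_mult, sqrt_sqrt by lra.
      assert (h x y <> 0) by (intros Q; rewrite Q in Hpos; lra).
      replace (/ (e * h x y) * h x y) with (/ e) by (field; auto).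
      apply Rmult_eq_reg_l with e; trivial. rewrite Rinv_r by trivial. now symmetry. }
    (* Derivative of lam ^ 2 * h, which is constant. *)
    assert (Dlam : forall x y, Bx (x, y) ->
      2 * h x y * D1 lam x y = - lam x y * D1 h x y /\
      2 * h x y * D2 lam x y = - lam x y * D2 h x y).
    { intros x y Hxy.
      assert (Gl := smooth_differentiable Bx lam x y HB Slam Hxy).
      assert (G := differentiable_pt_lim_mult _ _ _ _ _ _ _ _
        (differentiable_pt_lim_mult _ _ _ _ _ _ _ _ Gl Gl)
        (smooth_differentiable Bx h x y HB Sh Hxy)).
      assert (G0 : differentiable_pt_lim (fun x y => lam x y * lam x y * h x y) x y 0 0).
      { apply differentiable_pt_lim_ext with (2 := differentiable_pt_lim_const e x y).
        generalize (open_locally_2d _ _ _ HB Hxy). apply locally_2d_impl, locally_2d_forall.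
        intros s t Hst. symmetry. now apply Hlam. }
      destruct (differentiable_pt_lim_D _ _ _ _ _ G) as [F1 F2].
      destruct (differentiable_pt_lim_D _ _ _ _ _ G0) as [K1 K2].
      rewrite K1 in F1. rewrite K2 in F2. specialize (Hlam0 x y Hxy).
      split; apply Rmult_eq_reg_l with (lam x y); trivial; lra. }
    set (w1 := fun x y => lam x y * - a2 x y). set (w2 := fun x y => lam x y * a1 x y).
    assert (Sw1 : smooth_on Bx w1).
    { apply (smooth_mult Bx lam (fun x y => - a2 x y)); trivial. apply smooth_opp; auto. }
    assert (Sw2 : smooth_on Bx w2) by (apply (smooth_mult Bx lam a1); auto).
    destruct (closed_form_potential u v r w1 w2 Sw1 Sw2) as (phi & Sphi & Dphi).
    { intros x y Hxy.
      assert (Gl := smooth_differentiable Bx lam x y HB Slam Hxy).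
      assert (G1 := differentiable_pt_lim_mult _ _ _ _ _ _ _ _ Gl
        (smooth_differentiable Bx a1 x y HB (SB' _ Sa1) Hxy)).
      assert (G2 := differentiable_pt_lim_mult _ _ _ _ _ _ _ _
        (differentiable_pt_lim_const (-1) x y)
        (differentiable_pt_lim_mult _ _ _ _ _ _ _ _ Gl
          (smooth_differentiable Bx a2 x y HB (SB' _ Sa2) Hxy))).
      apply differentiable_pt_lim_ext with (f2 := w1) in G2.
      2:{ apply locally_2d_forall. intros s t. unfold w1. ring. }
      destruct (differentiable_pt_lim_D _ _ _ _ _ G1) as [E1 _].
      destruct (differentiable_pt_lim_D _ _ _ _ _ G2) as [_ E2].
      unfold w2. rewrite E1, E2.
      destruct (Dlam x y Hxy) as [L1 L2].
      assert (Hdiv := divergence_identity W A B C a1 a2 x y HW SA SB SC Sa1 Sa2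
        (HBW _ Hxy) (HT x y (HBW _ Hxy))).
      fold h in Hdiv.
      assert (Hh : h x y <> 0).
      { intros Q. specialize (Hpos x y Hxy). rewrite Q in Hpos. lra. }
      apply Rminus_diag_uniq. apply Rmult_eq_reg_l with (2 * h x y); [|lra].
      rewrite Rmult_0_r.
      transitivity (- (a1 x y * (2 * h x y * D1 lam x y) + a2 x y * (2 * h x y * D2 lam x y)
        + lam x y * (2 * h x y * (D1 a1 x y + D2 a2 x y)))); [ring|].
      rewrite L1, L2, <- Hdiv. ring. }
    exists Bx, phi, e. split; [|split; [|split; [|split; [|split]]]]; auto.
    { unfold is_epsilon. tauto. }
    intros x y Hxy. destruct (Dphi x y Hxy) as [-> ->].
    specialize (Hlam0 x y Hxy).
    split; [|split].
    + unfold w1, w2. ring.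
    + unfold w1, w2. destruct (Hne x y (HBW _ Hxy)) as [Q|Q]; [right | left];
        apply Rmult_integral_contrapositive_currified; trivial. lra.
    + unfold w1, w2. rewrite quadratic_scale, <- (Hlam x y Hxy). unfold h. field.
Qed.

(** * The normal form *)

Lemma linear_product_coordinates (N : nat) (a1 a2 : nat -> R -> R -> R)
    (P11 P12 P21 P22 x y q1 q2 : R) :
  linear_product N a1 a2 x y (P11 * q1 + P12 * q2) (P21 * q1 + P22 * q2)
  = linear_product N (fun m s t => a1 m s t * P11 + a2 m s t * P21)
      (fun m s t => a1 m s t * P12 + a2 m s t * P22) x y q1 q2.
Proof.
  unfold linear_product. f_equal. apply map_ext. intros m. ring.
Qed.

(** This normalizes to 1 the scalar by which the momenta q1 q2 come multiplied. *)
Lemma linear_product_absorb (k : nat) (c : R) (b1 b2 : nat -> R -> R -> R) (x y q1 q2 : R) :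
  linear_product (S k) (fun i s t => (if Nat.eqb i 1 then c else 1) * b1 i s t)
    (fun i s t => (if Nat.eqb i 1 then c else 1) * b2 i s t) x y q1 q2
  = c * linear_product (S k) b1 b2 x y q1 q2.
Proof.
  unfold linear_product. simpl seq. simpl map. simpl fold_right.
  rewrite <- Rmult_assoc. f_equal; [ring|].
  f_equal. apply map_ext_in. intros m Hm. apply in_seq in Hm.
  destruct (Nat.eqb_spec m 1); [lia | ring].
Qed.

Lemma linear_product_split (k : nat) (a1 a2 : nat -> R -> R -> R) (x y q1 q2 : R) :
  linear_product (S (S k)) a1 a2 x y q1 q2
  = (a1 1%nat x y * q1 + a2 1%nat x y * q2) * ((a1 2%nat x y * q1 + a2 2%nat x y * q2)
    * linear_product k (fun i => a1 (S (S i))) (fun i => a2 (S (S i))) x y q1 q2).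
Proof.
  unfold linear_product. simpl seq. simpl map. simpl fold_right.
  do 2 f_equal. f_equal. rewrite <- 2!seq_shift, !map_map. reflexivity.
Qed.

(** With d phi1 at the root of the second factor and d phi2 at the root of the
    first, the first two factors become multiples of q1 and q2, and the values of
    H at the two differentials become the coefficients of q1 ^ 2 and q2 ^ 2. *)
Theorem normal_form_at (W : R * R -> Prop) (A B C : R -> R -> R) (k : nat)
    (a1 a2 : nat -> R -> R -> R) (u v : R) :
  open W -> W (u, v) -> smooth_on W A -> smooth_on W B -> smooth_on W C ->
  (forall m, (1 <= m <= S (S k))%nat -> smooth_on W (a1 m) /\ smooth_on W (a2 m)) ->
  (forall x y, W (x, y) -> a1 1%nat x y * a2 2%nat x y - a1 2%nat x y * a2 1%nat x y <> 0) ->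
  (forall i x y, (1 <= i <= 2)%nat -> W (x, y) ->
     linear_bracket A B C (a1 i) (a2 i) x y (- a2 i x y) (a1 i x y) = 0) ->
  root_sign_locally_constant (quadratic A B C) (a1 1%nat) (a2 1%nat) u v ->
  root_sign_locally_constant (quadratic A B C) (a1 2%nat) (a2 2%nat) u v ->
  exists V, open V /\ V (u, v) /\ (forall z, V z -> W z) /\
    has_normal_form_on V (S (S k)) (quadratic A B C) (linear_product (S (S k)) a1 a2).
Proof.
  intros HW Huv SA SB SC Sa Hdet HT Hs1 Hs2.
  assert (Hne1 : forall x y, W (x, y) -> a1 1%nat x y <> 0 \/ a2 1%nat x y <> 0).
  { intros x y Hxy. specialize (Hdet x y Hxy).
    destruct (Req_dec (a1 1%nat x y) 0) as [E|E]; [right | now left].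
    intros E'. apply Hdet. rewrite E, E'. ring. }
  assert (Hne2 : forall x y, W (x, y) -> a1 2%nat x y <> 0 \/ a2 2%nat x y <> 0).
  { intros x y Hxy. specialize (Hdet x y Hxy).
    destruct (Req_dec (a1 2%nat x y) 0) as [E|E]; [right | now left].
    intros E'. apply Hdet. rewrite E, E'. ring. }
  destruct (adapted_function W A B C (a1 1%nat) (a2 1%nat) u v)
    as (V2 & phi2 & e2 & HV2 & HV2uv & HV2W & Sphi2 & He2 & Hphi2); trivial;
    try (apply Sa; lia); [intros; apply HT; trivial; lia|].
  destruct (adapted_function W A B C (a1 2%nat) (a2 2%nat) u v)
    as (V1 & phi1 & e1 & HV1 & HV1uv & HV1W & Sphi1 & He1 & Hphi1); trivial;
    try (apply Sa; lia); [intros; apply HT; trivial; lia|].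
  set (W' := fun z => V1 z /\ V2 z).
  assert (HW' : open W') by now apply open_and.
  assert (HW'W : forall z, W' z -> W z) by (intros z [Hz _]; auto).
  assert (S1 : smooth_on W' phi1) by (apply smooth_subset with V1; trivial; now intros z [Hz _]).
  assert (S2 : smooth_on W' phi2) by (apply smooth_subset with V2; trivial; now intros z [_ Hz]).
  (* The factors of q1 in the first form and of q2 in the second one. *)
  set (mu1 := fun x y => a1 1%nat x y * D1 phi1 x y + a2 1%nat x y * D2 phi1 x y).
  set (mu2 := fun x y => a1 2%nat x y * D1 phi2 x y + a2 2%nat x y * D2 phi2 x y).
  assert (Hcov : forall x y, W' (x, y) ->
    mu1 x y <> 0 /\ mu2 x y <> 0 /\ jacobian phi1 phi2 x y <> 0).
  { intros x y [Hz1 Hz2].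
    destruct (Hphi1 x y Hz1) as (E1 & N1 & _). destruct (Hphi2 x y Hz2) as (E2 & N2 & _).
    assert (Hz := HV1W _ Hz1). specialize (Hdet x y Hz).
    destruct (annihilated_covector _ _ _ _ (Hne2 x y Hz) E1) as (k1 & F1 & F2).
    destruct (annihilated_covector _ _ _ _ (Hne1 x y Hz) E2) as (k2 & G1 & G2).
    assert (Hk1 : k1 <> 0) by (intros Q; rewrite F1, F2, Q in N1; lra).
    assert (Hk2 : k2 <> 0) by (intros Q; rewrite G1, G2, Q in N2; lra).
    unfold mu1, mu2, jacobian. rewrite F1, F2, G1, G2.
    set (D := a1 1%nat x y * a2 2%nat x y - a1 2%nat x y * a2 1%nat x y) in *.
    split; [|split].
    - replace (_ + _) with (- k1 * D) by (unfold D; ring).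
      apply Rmult_integral_contrapositive_currified; trivial. lra.
    - replace (_ + _) with (k2 * D) by (unfold D; ring).
      now apply Rmult_integral_contrapositive_currified.
    - replace (_ - _) with (- (k1 * k2) * D) by (unfold D; ring).
      apply Rmult_integral_contrapositive_currified; trivial.
      apply Ropp_neq_0_compat. now apply Rmult_integral_contrapositive_currified. }
  destruct (inverse_function W' phi1 phi2 u v) as (V & V' & psi1 & psi2 & HC & HVuv & HVW'); trivial.
  { now split. }
  { apply Hcov. now split. }
  destruct (smooth_D _ _ S1) as [S11 S12]. destruct (smooth_D _ _ S2) as [S21 S22].
  assert (HC' := HC). destruct HC' as (HV & HV' & _ & _ & Sp1 & Sp2 & Hl & Hr).
  assert (Hpull : forall h, smooth_on W' h -> smooth_on V' (fun s t => h (psi1 s t) (psi2 s t))).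
  { intros h Sh. apply (smooth_comp V' W' h psi1 psi2); trivial.
    intros s t Hst. now apply HVW', Hr. }
  assert (M : forall f g, smooth_on W' f -> smooth_on W' g -> smooth_on W' (fun x y => f x y * g x y))
    by (intros; now apply smooth_mult).
  assert (P : forall f g, smooth_on W' f -> smooth_on W' g -> smooth_on W' (fun x y => f x y + g x y))
    by (intros; now apply smooth_plus).
  assert (R' : forall h, smooth_on W h -> smooth_on W' h) by (intros h; now apply smooth_subset).
  assert (Sa' : forall m, (1 <= m <= S (S k))%nat -> smooth_on W' (a1 m) /\ smooth_on W' (a2 m)).
  { intros m Hm. destruct (Sa m Hm). auto. }
  assert (Smu1 : smooth_on W' mu1) by (apply P; apply M; trivial; apply Sa'; lia).
  assert (Smu2 : smooth_on W' mu2) by (apply P; apply M; trivial; apply Sa'; lia).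
  set (G := fun x y => A x y * (D1 phi1 x y * D1 phi2 x y)
    + B x y * (D1 phi1 x y * D2 phi2 x y + D2 phi1 x y * D1 phi2 x y)
    + C x y * (D2 phi1 x y * D2 phi2 x y)).
  assert (SG : smooth_on W' G).
  { apply P; [apply P|]; apply M; auto. }
  set (mu := fun x y => mu1 x y * mu2 x y).
  set (c1 := fun m x y => a1 m x y * D1 phi1 x y + a2 m x y * D2 phi1 x y).
  set (c2 := fun m x y => a1 m x y * D1 phi2 x y + a2 m x y * D2 phi2 x y).
  set (scale := fun i x y => if Nat.eqb i 1 then mu x y else 1).
  exists V. split; [exact HV|]. split; [exact HVuv|]. split; [auto|].
  exists V', phi1, phi2, psi1, psi2, e1, e2, (fun s t => G (psi1 s t) (psi2 s t)),
    (fun s t => if Nat.eqb k 0 then mu (psi1 s t) (psi2 s t) else 1),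
    (fun i s t => scale i (psi1 s t) (psi2 s t) * c1 (S (S i)) (psi1 s t) (psi2 s t)),
    (fun i s t => scale i (psi1 s t) (psi2 s t) * c2 (S (S i)) (psi1 s t) (psi2 s t)).
  assert (Smu : smooth_on W' mu) by now apply M.
  split; [exact HC|]. split; [exact He1|]. split; [exact He2|]. split; [now apply Hpull|].
  split; [|split; [|split; [|split]]].
  - destruct (Nat.eqb k 0); [now apply (Hpull mu) | now apply smooth_const].
  - intros i Hi. destruct (Sa' (S (S i))) as [Si1 Si2]; [lia|].
    assert (Ss : smooth_on W' (scale i)).
    { unfold scale. destruct (Nat.eqb i 1); [exact Smu | now apply smooth_const]. }
    split.
    + apply (Hpull (fun x y => scale i x y * c1 (S (S i)) x y)).
      apply M; trivial. apply P; now apply M.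
    + apply (Hpull (fun x y => scale i x y * c2 (S (S i)) x y)).
      apply M; trivial. apply P; now apply M.
  - intros s t Hst. destruct (Hr s t Hst) as [Hz _]. apply HVW' in Hz.
    destruct (Hcov _ _ Hz) as (Q1 & Q2 & _).
    split.
    + destruct (Nat.eqb k 0); [|exact R1_neq_R0].
      now apply Rmult_integral_contrapositive_currified.
    + intros Hk. destruct k; [lia | reflexivity].
  - intros s t q1 q2 Hst. destruct (Hr s t Hst) as [Hz _]. apply HVW' in Hz.
    unfold in_coordinates. set (x := psi1 s t) in *. set (y := psi2 s t) in *.
    destruct Hz as [Hz1 Hz2].
    destruct (Hphi1 x y Hz1) as (_ & _ & E1). destruct (Hphi2 x y Hz2) as (_ & _ & E2).
    rewrite <- E1, <- E2. unfold quadratic, G. field.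
  - intros s t q1 q2 Hst. destruct (Hr s t Hst) as [Hz _]. apply HVW' in Hz.
    unfold in_coordinates. set (x := psi1 s t) in *. set (y := psi2 s t) in *.
    destruct Hz as [Hz1 Hz2].
    destruct (Hphi1 x y Hz1) as (E1 & _). destruct (Hphi2 x y Hz2) as (E2 & _).
    rewrite linear_product_split.
    replace (a1 1%nat x y * (D1 phi1 x y * q1 + D1 phi2 x y * q2)
           + a2 1%nat x y * (D2 phi1 x y * q1 + D2 phi2 x y * q2))
      with (mu1 x y * q1 + (a1 1%nat x y * D1 phi2 x y + a2 1%nat x y * D2 phi2 x y) * q2)
      by (unfold mu1; ring).
    replace (a1 2%nat x y * (D1 phi1 x y * q1 + D1 phi2 x y * q2)
           + a2 2%nat x y * (D2 phi1 x y * q1 + D2 phi2 x y * q2))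
      with ((a1 2%nat x y * D1 phi1 x y + a2 2%nat x y * D2 phi1 x y) * q1 + mu2 x y * q2)
      by (unfold mu2; ring).
    rewrite E1, E2, linear_product_coordinates.
    replace (S (S k) - 2)%nat with k by lia.
    transitivity (q1 * q2 * (mu x y * linear_product k
      (fun m _ _ => c1 (S (S m)) x y) (fun m _ _ => c2 (S (S m)) x y) s t q1 q2)).
    { match goal with |- context [linear_product k ?b1 ?b2 x y q1 q2] =>
        change (linear_product k b1 b2 x y q1 q2) with (linear_product k
          (fun m _ _ => c1 (S (S m)) x y) (fun m _ _ => c2 (S (S m)) x y) s t q1 q2) end.
      unfold mu. ring. }
    destruct k as [|k].
    + reflexivity.
    + simpl Nat.eqb. rewrite Rmult_1_l, <- linear_product_absorb. reflexivity.
Qed.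

(** A function is nonzero near some point or zero everywhere. *)
Lemma sign_locally_constant_nearby (W : R * R -> Prop) (h : R -> R -> R) :
  open W -> (exists z, W z) -> smooth_on W h ->
  exists W' s, open W' /\ (exists z, W' z) /\ (forall z, W' z -> W z) /\
    forall x y, W' (x, y) -> sign (h x y) = s.
Proof.
  intros HW [[x0 y0] Hz0] Sh.
  destruct (classic (exists x y, W (x, y) /\ h x y <> 0)) as [(x & y & Hxy & Hh)|Hn].
  - assert (Hpos : 0 < Rabs (h x y)) by now apply Rabs_pos_lt.
    destruct (locally_2d_box _ _ _ (locally_2d_and _ _ _ _
      (smooth_continuity W h x y Sh Hxy (mkposreal _ Hpos))
      (open_locally_2d W x y HW Hxy))) as (r & Hr & Hbox). simpl in Hbox.
    exists (box x y r), (sign (h x y)). split; [apply open_box|]. split; [|split].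
    + exists (x, y). now apply box_center.
    + intros [a b] Hab. now apply Hbox.
    + intros a b Hab. destruct (Hbox a b Hab) as [Q _].
      destruct (Rdichotomy _ _ Hh) as [Hlt|Hgt].
      * rewrite (Rabs_left (h x y)) in Q by trivial. apply Rabs_def2 in Q.
        rewrite !sign_eq_m1; trivial. lra.
      * rewrite (Rabs_pos_eq (h x y)) in Q by lra. apply Rabs_def2 in Q.
        rewrite !sign_eq_1; trivial. lra.
  - exists W, 0. split; [trivial|]. split; [now exists (x0, y0)|]. split; [trivial|].
    intros x y Hxy. replace (h x y) with 0; [apply sign_0|].
    symmetry. apply NNPP. intros Q. apply Hn. now exists x, y.
Qed.

Theorem proposition1p4
  (U : R * R -> Prop) (g11 g12 g22 : R -> R -> R)
  (N : nat) (a1 a2 : nat -> R -> R -> R) (u v : R)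
  (H := hamiltonian g11 g12 g22)
  (f := linear_product N a1 a2) :
  open U ->
  pseudo_riemannian_on U g11 g12 g22 ->
  (2 <= N)%nat ->
  (forall m, (1 <= m <= N)%nat -> smooth_on U (a1 m) /\ smooth_on U (a2 m)) ->
  (* f has degree N: it vanishes identically over no nonempty open set *)
  (forall W : R * R -> Prop, open W -> (exists z, W z) ->
     (forall z, W z -> U z) ->
     exists x y p1 p2, W (x, y) /\ f x y p1 p2 <> 0) ->
  first_integral_on U f H ->
  U (u, v) ->
  a1 1%nat u v * a2 2%nat u v - a1 2%nat u v * a2 1%nat u v <> 0 ->
  (a1 1%nat u v, a2 1%nat u v) <> (0, 0) ->
  (a1 2%nat u v, a2 2%nat u v) <> (0, 0) ->
  (* coordinates exist on open sets arbitrarily close to the point *)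
  (forall W : R * R -> Prop, open W -> W (u, v) ->
     exists V : R * R -> Prop,
       open V /\ (exists z, V z) /\ (forall z, V z -> W z /\ U z) /\
       has_normal_form_on V N H f)
  /\
  (* and around the point itself whenever the signs e1, e2 can be constant *)
  (root_sign_locally_constant H (a1 1%nat) (a2 1%nat) u v ->
   root_sign_locally_constant H (a1 2%nat) (a2 2%nat) u v ->
   exists V : R * R -> Prop,
     open V /\ V (u, v) /\ (forall z, V z -> U z) /\
     has_normal_form_on V N H f).
Proof.
  intros HU (Sg11 & Sg12 & Sg22 & Hg) HN Sa Hne Hfi Huv Hdet _ _.
  destruct N as [|[|k]]; [lia | lia |].
  set (det := metric_det g11 g12 g22).
  set (A := fun x y => g22 x y / det x y).
  set (B := fun x y => - g12 x y / det x y).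
  set (C := fun x y => g11 x y / det x y).
  change H with (quadratic A B C) in *.
  assert (Sdet : smooth_on U det).
  { apply (smooth_minus U (fun x y => g11 x y * g22 x y) (fun x y => g12 x y * g12 x y));
      trivial; now apply smooth_mult. }
  assert (SA : smooth_on U A) by now apply smooth_div.
  assert (SB : smooth_on U B).
  { apply (smooth_div U (fun x y => - g12 x y)); trivial. now apply smooth_opp. }
  assert (SC : smooth_on U C) by now apply smooth_div.
  assert (HT : forall i x y, (1 <= i <= 2)%nat -> U (x, y) ->
     linear_bracket A B C (a1 i) (a2 i) x y (- a2 i x y) (a1 i x y) = 0).
  { intros i x y Hi Hxy.
    apply (bracket_vanishes_at_root U A B C (S (S k)) a1 a2 i); trivial. lia. }
  destruct (Sa 1%nat) as [S11 S12]; [lia|]. destruct (Sa 2%nat) as [S21 S22]; [lia|].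
  set (D := fun x y => a1 1%nat x y * a2 2%nat x y - a1 2%nat x y * a2 1%nat x y).
  assert (SD : smooth_on U D).
  { apply (smooth_minus U (fun x y => a1 1%nat x y * a2 2%nat x y)
             (fun x y => a1 2%nat x y * a2 1%nat x y)); trivial; now apply smooth_mult. }
  assert (Hlocal : forall (W : R * R -> Prop) s t, open W -> (forall z, W z -> U z) ->
    W (s, t) -> D s t <> 0 ->
    root_sign_locally_constant (quadratic A B C) (a1 1%nat) (a2 1%nat) s t ->
    root_sign_locally_constant (quadratic A B C) (a1 2%nat) (a2 2%nat) s t ->
    exists V, open V /\ V (s, t) /\ (forall z, V z -> W z) /\
      has_normal_form_on V (S (S k)) (quadratic A B C) f).
  { intros W s t HW HWU Hst HDst Hs1 Hs2.
    destruct (normal_form_at (fun z => W z /\ D (fst z) (snd z) <> 0) A B C k a1 a2 s t)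
      as (V & HV & HVst & HVW & Hnf); trivial.
    - apply open_neq_0; trivial. now apply smooth_subset with U.
    - now split.
    - apply smooth_subset with U; trivial. intros z [Hz _]. auto.
    - apply smooth_subset with U; trivial. intros z [Hz _]. auto.
    - apply smooth_subset with U; trivial. intros z [Hz _]. auto.
    - intros m Hm. destruct (Sa m Hm).
      split; apply smooth_subset with U; trivial; intros z [Hz _]; auto.
    - now intros x y [_ Hxy].
    - intros i x y Hi [Hxy _]. auto.
    - exists V. split; [|split; [|split]]; trivial. intros z Hz. now apply HVW. }
  split.
  - intros W HW HWuv.
    set (W0 := fun z : R * R => (W z /\ U z) /\ D (fst z) (snd z) <> 0).
    assert (HWU : open (fun z => W z /\ U z)) by now apply open_and.
    assert (HW0 : open W0).
    { apply open_neq_0; trivial. apply smooth_subset with U; trivial. now intros z [_ Hz]. }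
    assert (HW0U : forall z, W0 z -> U z) by (intros z Hz; apply Hz).
    assert (Sroot : forall b1 b2, smooth_on U b1 -> smooth_on U b2 ->
      smooth_on U (fun x y => quadratic A B C x y (- b2 x y) (b1 x y))).
    { intros b1 b2 Sb1 Sb2. apply smooth_quadratic; trivial. now apply smooth_opp. }
    destruct (sign_locally_constant_nearby W0
      (fun x y => quadratic A B C x y (- a2 1%nat x y) (a1 1%nat x y)))
      as (W1 & s1 & HW1 & HW1ne & HW1W & Hs1); trivial.
    { exists (u, v). now repeat split. }
    { apply smooth_subset with U; auto. }
    destruct (sign_locally_constant_nearby W1
      (fun x y => quadratic A B C x y (- a2 2%nat x y) (a1 2%nat x y)))
      as (W2 & s2 & HW2 & [[s t] Hst] & HW2W & Hs2); trivial.
    { apply smooth_subset with U; auto. }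
    destruct (Hlocal W2 s t) as (V & HV & HVst & HVW & Hnf); auto.
    + apply (HW1W (s, t)). auto.
    + generalize (open_locally_2d _ _ _ HW2 Hst). apply locally_2d_impl, locally_2d_forall.
      intros x y Hxy. rewrite !Hs1; auto.
    + generalize (open_locally_2d _ _ _ HW2 Hst). apply locally_2d_impl, locally_2d_forall.
      intros x y Hxy. rewrite !Hs2; auto.
    + exists V. split; [trivial|]. split; [now exists (s, t)|]. split; trivial.
      intros z Hz. apply (HW1W z). auto.
  - intros Hs1 Hs2. now apply Hlocal.
Qed.
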